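(* Let $\Omega$ be an open subset of $\mathbb{R}^n$, and let $x_0\in\partial\Omega$. Assume that $\Omega$ satisfies an interior sphere condition at $x_0$, with interior balls $B_r(x_r)$, $r\in(0,\bar r]$. Let $s\in(0,1)$, let $a\in L^\infty(S^{n-1})$ be such that $a(\theta)=a(-\theta)$ and $\lambda\leqslant a(\theta)\leqslant\Lambda$ for all $\theta\in S^{n-1}$, for some constants $0<\lambda\leqslant\Lambda$, and let $L$ be the operator $$Lw(x)=PV\int_{\mathbb{R}^n}\frac{w(x)-w(x+y)}{|y|^{n+2s}}\,a\left(\frac{y}{|y|}\right)dy.$$ Let $u\in\mathcal{Z}_\Omega$ be such that $u(x_0)=0$ and $u^+\in L^\infty(\mathbb{R}^n)$. Suppose that $$Lu\leqslant V(x)\,u\quad\text{in }\Omega$$ pointwise, where $V\in L^1_{\mathrm{loc}}(\Omega)$ is such that $V^-\in L^\infty(\Omega)$. Suppose moreover that there exists $R>0$ such that $u\leqslant0$ in $B_R(x_0)$, $u<0$ in $B_R(x_0)\cap\Omega$, and that $u$ grows faster than the power $2s$ at $x_0$. Then, for every $\beta\in(0,\pi/2)$, $$\limsup_{\Omega\ni x\to x_0}\frac{u(x)}{|x-x_0|^s}<0,$$ where the $\limsup$ is taken over those $x$ such that the angle between $x-x_0$ and the vector joining $x_0$ to the center of the interior sphere is smaller than $\pi/2-\beta$. In particular, if $d(x):=\mathrm{dist}(x,\partial\Omega)$, and $u/d^s$ can be extended as a continuous function on a neighborhood of $x_0$ in $\partial\Omega$, then $$\frac{u}{d^s}(x_0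)<0.$$
   Context: $f^+:=\max\{f,0\}$ and $f^-:=\max\{-f,0\}$ denote the positive and negative parts of $f$. $PV$ stands for principal value, i.e. the limit as $\varepsilon\searrow0$ of the integral over $\mathbb{R}^n\setminus B_\varepsilon$. $\mathcal{Z}_\Omega$ is the space of continuous functions $u:\mathbb{R}^n\to\mathbb{R}$ such that $\int_{\mathbb{R}^n}\frac{|u(x)|}{1+|x|^{n+2s}}\,dx<+\infty$ and such that for every $x\in\Omega$ the limit $\lim_{\varepsilon\searrow0}\int_{\mathbb{R}^n\setminus B_\varepsilon}\frac{u(x)-u(x+y)}{|y|^{n+2s}}a\left(\frac{y}{|y|}\right)dy$ exists. Interior sphere condition at $x_0\in\partial\Omega$: there exists $\bar r>0$ such that, for every $r\in(0,\bar r]$, there exists a ball $B_r(x_r)\subseteq\Omega$ with $x_0\in(\partial\Omega)\cap(\partial B_r(x_r))$. Growth condition: given a continuous function $u:\mathbb{R}^n\to\mathbb{R}$ with $u(x_0)=0$ and $|u|>0$ in $B_r(x_r)$ for every sufficiently small $r$, we say that $u$ grows faster than the power $2s$ at $x_0$ if $\limsup_{r\to0^+}\Phi(r)=+\infty$, where $\Phi(r):=\frac{\inf_{B_{r/2}(x_r)}|u|}{r^{2s}}$. *)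

(* Defs.v *)
From HB Require Import structures.
From mathcomp Require Import all_boot all_order all_algebra.
From mathcomp Require Import all_classical all_reals all_analysis.

Set Implicit Arguments.
Unset Strict Implicit.
Unset Printing Implicit Defensive.

Import Order.TTheory GRing.Theory Num.Theory.
Import numFieldNormedType.Exports.

Local Open Scope classical_set_scope.
Local Open Scope ring_scope.

(* ['rV[R]_n] carries the Borel (= product) sigma-algebra, generated by the
   coordinate functions. *)
Definition rV_display : measure_display -> measure_display.
Proof. exact. Qed.

Section measurable_rV.
Context {R : realType} {n : nat}.

Definition rV_coord (i : 'I_n) (x : 'rV[R]_n) : measurableTypeR R := x ord0 i.

Let rV_set0 : g_sigma_preimage rV_coord set0.
Proof. exact: sigma_algebra0. Qed.

Let rV_setC A : g_sigma_preimage rV_coord A -> g_sigma_preimage rV_coord (~` A).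
Proof. exact: sigma_algebraC. Qed.

Let rV_bigcup (F : _^nat) : (forall i, g_sigma_preimage rV_coord (F i)) ->
  g_sigma_preimage rV_coord (\bigcup_i (F i)).
Proof. exact: sigma_algebra_bigcup. Qed.

HB.instance Definition _ := @isMeasurable.Build
  (rV_display (R.-ocitv.-measurable).-sigma)
  'rV[R]_n (g_sigma_preimage rV_coord) rV_set0 rV_setC rV_bigcup.

End measurable_rV.

Section lebesgue_rV.
Context {R : realType}.
Implicit Type n : nat.

Lemma measurable_rV_coord n (i : 'I_n) :
  measurable_fun [set: 'rV[R]_n] (@rV_coord R n i).
Proof.
move=> _ A mA; rewrite setTI; apply: sub_sigma_algebra.
case: n i => [[] []//|n i].
rewrite -bigcup_mkord_ord; exists i; first exact: ltn_ord.
by exists A => //; rewrite inord_val setTI.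
Qed.

Lemma measurable_fun_rVP d (T : measurableType d) n (f : T -> 'rV[R]_n) :
  measurable_fun [set: T] f <->
  forall i, measurable_fun [set: T] (rV_coord i \o f).
Proof.
split=> [mf i|mf].
  by apply: measurableT_comp => //; exact: measurable_rV_coord.
move=> _ A mA; rewrite setTI.
suff : g_sigma_preimage (@rV_coord R n) `<=` [set A | measurable (f @^-1` A)].
  exact.
apply: smallest_sub.
  split => /=.
  - by rewrite preimage_set0.
  - by move=> B mB; rewrite setTD preimage_setC; exact: measurableC.
  - by move=> F mF; rewrite preimage_bigcup; exact: bigcup_measurable.
case: n f mf {A mA} => [|n] f mf; first by rewrite big_ord0.
rewrite -bigcup_mkord_ord; apply: bigcup_sub => i Ii.
move=> A [B mB <-] /=.
by have := mf (inord i) measurableT B mB; rewrite !setTI.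
Qed.

Definition rV_cons n (p : measurableTypeR R * 'rV[R]_n) : 'rV[R]_n.+1 :=
  \row_i oapp (p.2 ord0) p.1 (unlift ord0 i).

Definition rV_uncons n (x : 'rV[R]_n.+1) : measurableTypeR R * 'rV[R]_n :=
  (x ord0 ord0, \row_j x ord0 (lift ord0 j)).

Lemma measurable_rV_cons n : measurable_fun setT (@rV_cons n).
Proof.
apply/measurable_fun_rVP => i.
case: (unliftP ord0 i) => [j ->|->].
- rewrite (_ : _ \o _ = rV_coord j \o snd).
    apply: measurableT_comp; [exact: measurable_rV_coord|exact: measurable_snd].
  by apply/funext => p; rewrite /rV_coord /= mxE liftK.
- rewrite (_ : _ \o _ = fst); first exact: measurable_fst.
  by apply/funext => p; rewrite /rV_coord /= mxE unlift_none.
Qed.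

Lemma measurable_rV_uncons n : measurable_fun setT (@rV_uncons n).
Proof.
apply/measurable_fun_pairP; split; first exact: (measurable_rV_coord ord0).
apply/measurable_fun_rVP => j.
rewrite (_ : _ \o _ = rV_coord (lift ord0 j)); first exact: measurable_rV_coord.
by apply/funext => x; rewrite /rV_coord /= mxE.
Qed.

Lemma rV_consK n : cancel (@rV_cons n) (@rV_uncons n).
Proof.
move=> [x y]; rewrite /rV_uncons mxE unlift_none /=; congr pair.
by apply/rowP => j; rewrite !mxE liftK.
Qed.

Lemma rV_unconsK n : cancel (@rV_uncons n) (@rV_cons n).
Proof.
move=> x; apply/rowP => i; rewrite mxE.
by case: (unliftP ord0 i) => [j ->|->]; rewrite /= ?mxE.
Qed.

Section step.
Variables (n : nat) (mu : {sigma_finite_measure set 'rV[R]_n -> \bar R}).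

Definition lebesgue_cons : set 'rV[R]_n.+1 -> \bar R :=
  pushforward (lebesgue_measure \x mu)%E (@rV_cons n).

HB.instance Definition _ := isMeasurableFun.Build _ _ _ _ (@rV_cons n)
  (@measurable_rV_cons n).

Let lebesgue_cons0 : lebesgue_cons set0 = 0%E.
Proof. by rewrite /lebesgue_cons /pushforward preimage_set0 measure0. Qed.

Let lebesgue_cons_ge0 A : (0 <= lebesgue_cons A)%E.
Proof. exact: measure_ge0. Qed.

Let lebesgue_cons_sigma_additive : semi_sigma_additive lebesgue_cons.
Proof. exact: measure_semi_sigma_additive. Qed.

HB.instance Definition _ := isMeasure.Build _ _ _ lebesgue_cons
  lebesgue_cons0 lebesgue_cons_ge0 lebesgue_cons_sigma_additive.

Let lebesgue_cons_sigma_finite : sigma_finite setT lebesgue_cons.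
Proof.
have /sigma_finiteP[F [TF ndF Foo]] := sigma_finiteT (@lebesgue_measure R).
have /sigma_finiteP[G [TG ndG Goo]] := sigma_finiteT mu.
exists (fun k => @rV_uncons n @^-1` (F k `*` G k)).
  rewrite -preimage_bigcup (_ : \bigcup_k _ = setT) ?preimage_setT//.
  apply/seteqP; split => // -[x y] _.
  have [k _ Fkx] : (\bigcup_k F k) x by rewrite -TF.
  have [l _ Gly] : (\bigcup_k G k) y by rewrite -TG.
  exists (maxn k l) => //; split => /=.
    by move: x Fkx; exact/subsetPset/ndF/leq_maxl.
  by move: y Gly; exact/subsetPset/ndG/leq_maxr.
move=> k; have [mFk Fkoo] := Foo k; have [mGk Gkoo] := Goo k; split.
  rewrite -[X in measurable X]setTI; apply: measurable_rV_uncons => //.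
  exact: measurableX.
rewrite /lebesgue_cons /pushforward -comp_preimage.
rewrite (_ : _ \o _ = id); last by apply/funext => p /=; rewrite rV_consK.
by rewrite preimage_id product_measure1E// lte_mul_pinfty// ge0_fin_numE.
Qed.

HB.instance Definition _ := Measure_isSigmaFinite.Build _ _ _ lebesgue_cons
  lebesgue_cons_sigma_finite.

End step.

(* Lebesgue measure on R^n: the n-fold product of the Lebesgue measure on R. *)
Fixpoint lebesgue_rV n : {sigma_finite_measure set 'rV[R]_n -> \bar R} :=
  match n with
  | 0 => dirac (0 : 'rV[R]_0)
  | m.+1 => lebesgue_cons (lebesgue_rV m)
  end.

Lemma lebesgue_rV_box n (A : 'I_n -> set (measurableTypeR R)) :
  (forall i, measurable (A i)) ->
  lebesgue_rV n [set x | forall i, A i (x ord0 i)] =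
  (\prod_(i < n) lebesgue_measure (A i))%E.
Proof.
elim: n A => [|n IH] A mA.
  by rewrite big_ord0 /= diracE mem_set//= => -[].
rewrite big_ord_recl -IH//= /lebesgue_cons /pushforward.
rewrite -product_measure1E//; last first.
  rewrite [X in measurable X](_ : _ =
      \bigcap_(i in [set: 'I_n]) (rV_coord i @^-1` A (lift ord0 i))).
    apply: fin_bigcap_measurable => // i _.
    by rewrite -[X in measurable X]setTI; exact: measurable_rV_coord.
  by apply/seteqP; split => x /= Ax i => [_|]; exact: Ax.
congr (product_measure1 _ _ _); apply/seteqP; split => -[x y] /=.
  move=> Axy; split=> [|i].
    by have := Axy ord0; rewrite mxE unlift_none.
  by have := Axy (lift ord0 i); rewrite mxE liftK.
move=> [Ax Ay] i; rewrite mxE.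
by case: (unliftP ord0 i) => [j ->|->] //=; exact: Ay.
Qed.

End lebesgue_rV.

(* The norm that the library puts on ['rV[R]_n] is the sup norm: it is used
   here only for the topology. *)
Section euclidean.
Context {R : realType} {n : nat}.
Implicit Types (x y v : 'rV[R]_n) (A Omega : set 'rV[R]_n) (r : R).

Definition edot x y : R := \sum_i x ord0 i * y ord0 i.

Definition enorm x : R := Num.sqrt (edot x x).

Definition eball x r : set 'rV[R]_n := [set y | enorm (y - x) < r].

Definition bdry A : set 'rV[R]_n := closure A `\` interior A.

Definition bdry_dist Omega x : R := inf [set enorm (x - z) | z in bdry Omega].

Definition angle x y : R := acos (edot x y / (enorm x * enorm y)).

Definition sphere : set 'rV[R]_n := [set theta | enorm theta = 1].

Definition direction y : 'rV[R]_n := (enorm y)^-1 *: y.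

End euclidean.
Arguments sphere {R n}.

Section function_spaces.
Context {R : realType} {n : nat}.
Implicit Types (D Omega : set 'rV[R]_n) (f u V a : 'rV[R]_n -> R).

(* Lebesgue measurability, i.e. agreement almost everywhere with a Borel
   function. *)
Definition lebesgue_measurable_fun D f : Prop :=
  exists g : 'rV[R]_n -> measurableTypeR R, measurable_fun D g /\
    {ae lebesgue_rV n, forall x, D x -> f x = g x}.

Definition L1loc Omega V : Prop :=
  lebesgue_measurable_fun Omega V /\
  forall K, K `<=` Omega -> compact K ->
    (\int[lebesgue_rV n]_(x in K) `|V x|%:E < +oo)%E.

(* Elements of L^infty are taken as functions defined at every point, not as
   classes modulo null sets: they enter conditions imposed at every point. *)
Definition Linfty D f : Prop :=
  lebesgue_measurable_fun D f /\ exists C : R, forall x, D x -> `|f x| <= C.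

(* By polar coordinates the surface measure of E is n times the volume of the
   part of the unit ball spanned by E. *)
Definition surface_measure (E : set 'rV[R]_n) : \bar R :=
  (n%:R%:E *
   lebesgue_rV n [set y | (0 < enorm y <= 1)%R /\ E (direction y)])%E.

Definition surface_negligible (N : set 'rV[R]_n) : Prop :=
  exists F : set 'rV[R]_n,
    [/\ measurable F, F `<=` sphere, N `<=` F & surface_measure F = 0%E].

Definition Linfty_sphere a : Prop :=
  (exists b : 'rV[R]_n -> measurableTypeR R, measurable_fun sphere b /\
    surface_negligible [set theta | sphere theta /\ a theta <> b theta]) /\
  exists C : R, forall theta, sphere theta -> `|a theta| <= C.

End function_spaces.

Section operator.
Context {R : realType} {n : nat}.
Variables (s : R) (a : 'rV[R]_n -> R).
Implicit Types (w u : 'rV[R]_n -> R) (x : 'rV[R]_n) (Omega : set 'rV[R]_n).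

(* For w in [Zspace] this integral converges absolutely for every eps > 0, so
   the real-valued integral is not used at its default value. *)
Definition Ltrunc w x (eps : R) : R :=
  \int[lebesgue_rV n]_(y in ~` eball 0 eps)
    ((w x - w (x + y)) / enorm y `^ (n%:R + 2 * s) * a (direction y)).

Definition Lop w x : R := lim (Ltrunc w x eps @[eps --> 0^'+]).

Definition Zspace Omega u : Prop :=
  [/\ continuous u,
      (\int[lebesgue_rV n]_x
         (`|u x| / (1 + enorm x `^ (n%:R + 2 * s)))%:E < +oo)%E &
      forall x, Omega x -> cvg (Ltrunc u x eps @[eps --> 0^'+])].

End operator.

Section geometry.
Context {R : realType} {n : nat}.
Implicit Types (v : 'rV[R]_n) (Omega : set 'rV[R]_n) (xc : R -> 'rV[R]_n).

(* [xc r] is the center of the interior ball of radius [r]. *)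
Definition interior_balls Omega (x0 : 'rV[R]_n) (rbar : R) xc : Prop :=
  0 < rbar /\
  forall r, 0 < r <= rbar ->
    eball (xc r) r `<=` Omega /\ (bdry Omega `&` bdry (eball (xc r) r)) x0.

Definition Phi (s : R) (u : 'rV[R]_n -> R) xc (r : R) : R :=
  inf [set `|u y| | y in eball (xc r) (r / 2)] / r `^ (2 * s).

Definition grows_faster (s : R) (u : 'rV[R]_n -> R) (x0 : 'rV[R]_n) xc : Prop :=
  [/\ continuous u, u x0 = 0,
      \forall r \near 0^'+, forall y, eball (xc r) r y -> 0 < `|u y| &
      limf_esup (fun r => (Phi s u xc r)%:E) 0^'+ = +oo%E].

Definition cone (x0 : 'rV[R]_n) v (beta : R) : set 'rV[R]_n :=
  [set x | angle (x - x0) v < pi / 2 - beta].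

End geometry.

(* Main.v *)
(* The barrier of an interior ball is [b = (r^2 - |x - c|^2)_+^s]. On every line
   through a point of the ball, [b] is the positive part of a concave quadratic;
   comparison with the half-line profile [x_+^s] bounds its one-dimensional
   fractional Laplacian from above, and integration over lines bounds [L b],
   whatever the regularity of [a].

   Suppose that [u + d b] has a positive maximum over the ball at [x]. If
   [u <= - eta] on a cube of side comparable to [r], this cube contributes a
   positive amount of order [eta r^(-2s)] to [L (u + d b) x]; when it exceeds
   the contribution of [u^+] away from [x0], the inequality [L u <= V u] is
   contradicted for small [d], and so [u <= - d b] in the ball. Growth faster
   than the power [2s] makes this work in one interior ball. There [u <= - d b]
   gives [u <= - C t^s] at depth [t] along its axis, and [t^s t^(-2s)] is
   unbounded as [t -> 0], so the argument applies again to small balls tangent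
   at [x0] inside any other interior ball. Finally [b] is bounded from below by
   a multiple of [|x - x0|^s] in cones around the axis. *)
Require Import Defs.
From HB Require Import structures.
From mathcomp Require Import all_boot all_order all_algebra.
From mathcomp Require Import all_classical all_reals all_analysis.
From mathcomp Require Import measurable_realfun ring lra.

Set Implicit Arguments.
Unset Strict Implicit.
Unset Printing Implicit Defensive.

Import Order.TTheory GRing.Theory Num.Theory.
Import numFieldNormedType.Exports.

Local Open Scope classical_set_scope.
Local Open Scope ring_scope.

(** * Lebesgue integrals on the space of row vectors *)

(** The difficulty is that [L b] must be bounded up to the edge of the ball, where [b] is not
    Lipschitz, with a constant that does not depend on the ball. On a line through [x] the barrier
    is [(A + B t - D t^2)_+^s], and the error against the affine profile is bounded by a multiple of
    [D^s] alone: neither [A], which tends to 0 at the edge, nor [B] enters. For direction [z] one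
    has [D = |z|^2], and [D^s |z|^(-n - 2s) = |z|^(-n)] has the homogeneity that sums over lines to
    a constant.

    All estimates are for the kernel cut off at [e], and the principal value for [b] is never
    formed. The cut-off must be small in terms of [A], which is harmless since [x] is fixed when [e]
    tends to 0.

    At a positive maximum, [- d b(x) < u(x) <= 0], so a lower bound on [V] gives
    [V u <= C d r^(2s)]: this is small with [d], like [d L b].

    A second round of comparison is needed because growth provides good radii only along a sequence,
    and the centres belonging to different radii need not lie on one axis through [x0]. *)

Section affine_line.
Context {R : realType}.
Local Notation leb := (@lebesgue_measure R).
Implicit Types l b : R.

Definition affine_line l b : measurableTypeR R -> measurableTypeR R :=
  fun x => l * x + b.

Lemma measurable_affine_line l b : measurable_fun setT (affine_line l b).
Proof.
apply: continuous_measurable_fun => x /=.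
by apply: cvgD; [apply: cvgM; [exact: cvg_cst|exact: cvg_id]|exact: cvg_cst].
Qed.

HB.instance Definition _ l b := isMeasurableFun.Build _ _ _ _ (affine_line l b)
  (@measurable_affine_line l b).

Lemma affine_line_preimage_itv_pos l b (u v : R) : 0 < l ->
  affine_line l b @^-1` `]u, v] = `](u - b) / l, (v - b) / l]%classic.
Proof.
move=> l0; apply/seteqP; split => x /=; rewrite !in_itv/= /affine_line.
  by rewrite ltr_pdivrMr// ler_pdivlMr// ltrBlDr lerBrDr mulrC.
by rewrite ltr_pdivrMr// ler_pdivlMr// ltrBlDr lerBrDr mulrC.
Qed.

Lemma affine_line_preimage_itv_neg l b (u v : R) : l < 0 ->
  affine_line l b @^-1` `]u, v] = `[(v - b) / l, (u - b) / l[%classic.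
Proof.
move=> l0; apply/seteqP; split => x /=; rewrite !in_itv/= /affine_line.
  by rewrite ltr_ndivlMr// ler_ndivrMr// ltrBlDr lerBrDr mulrC andbC.
by rewrite ltr_ndivlMr// ler_ndivrMr// ltrBlDr lerBrDr mulrC andbC.
Qed.

(** By uniqueness of Lebesgue measure only half-open intervals matter. For [l < 0] the preimage is
    closed at the other end, which leaves its length unchanged. *)
Lemma lebesgue_measure_affine l b (A : set (measurableTypeR R)) : l != 0 ->
  measurable A ->
  (leb A = `|l|%:E * pushforward leb (affine_line l b) A)%E.
Proof.
move=> l0 mA.
pose k : {nonneg R} := NngNum (normr_ge0 l).
apply: (@lebesgue_measure_unique R (mscale k (pushforward leb (affine_line l b)))) => //= _ [[u v]] _ <-.
rewrite /mscale/= /pushforward.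
case: (ltgtP l 0) l0 => // l0 _.
  rewrite affine_line_preimage_itv_neg// !lebesgue_measure_itv/= !lte_fin.
  rewrite ltr_nM2r ?invr_lt0// ltrD2r.
  case: ifP => _; last by rewrite mule0.
  rewrite -!EFinB -EFinM; congr (_%:E); rewrite (ltr0_norm l0); field.
  by rewrite lt_eqF.
rewrite affine_line_preimage_itv_pos// !lebesgue_measure_itv/= !lte_fin.
rewrite ltr_pM2r ?invr_gt0// ltrD2r.
case: ifP => _; last by rewrite mule0.
rewrite -!EFinB -EFinM; congr (_%:E); rewrite (gtr0_norm l0); field.
by rewrite gt_eqF.
Qed.

Lemma ge0_integral_affine_line l b (f : measurableTypeR R -> \bar R) : l != 0 ->
  measurable_fun setT f -> (forall x, (0 <= f x)%E) ->
  (\int[leb]_x f x = `|l|%:E * \int[leb]_x f (l * x + b)%R)%E.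
Proof.
move=> l0 mf f0.
pose k : {nonneg R} := NngNum (normr_ge0 l).
pose push : {measure set (measurableTypeR R) -> \bar R} :=
  pushforward leb (affine_line l b).
transitivity (\int[mscale k (push (@measurable_affine_line l b))]_x f x)%E.
  by apply: eq_measure_integral => A mA _; exact: lebesgue_measure_affine.
rewrite ge0_integral_mscale//; congr (_ * _)%E.
by rewrite (ge0_integral_pushforward (@measurable_affine_line l b))// preimage_setT.
Qed.

End affine_line.

Section affine_rV.
Context {R : realType}.
Local Notation leb := (@lebesgue_measure R).
Local Open Scope ereal_scope.

Lemma ge0_integral_rV_cons n (f : 'rV[R]_n.+1 -> \bar R) :
  measurable_fun setT f -> (forall x, 0 <= f x) ->
  \int[lebesgue_rV n.+1]_x f x =
  \int[leb]_x \int[lebesgue_rV n]_y f (rV_cons (x, y)).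
Proof.
move=> mf f0.
rewrite -[LHS]/(\int[pushforward (leb \x lebesgue_rV n) (@rV_cons R n)]_x f x).
rewrite (ge0_integral_pushforward (@measurable_rV_cons R n))// preimage_setT.
rewrite fubini_tonelli1//; last by move=> x; exact: f0.
by apply: measurableT_comp => //; exact: measurable_rV_cons.
Qed.

Lemma measurable_affine_rV n (l : R) (b : 'rV[R]_n) :
  measurable_fun setT (fun x : 'rV[R]_n => (l *: x + b)%R).
Proof.
apply/measurable_fun_rVP => i.
rewrite (_ : _ \o _ = affine_line l (b ord0 i) \o rV_coord i); last first.
  by apply/funext => x; rewrite /rV_coord /affine_line /= !mxE.
by apply: measurableT_comp => //; exact: measurable_rV_coord.
Qed.

Lemma ge0_integral_affine_rV n (l : R) (b : 'rV[R]_n) (f : 'rV[R]_n -> \bar R) :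
  l != 0%R -> measurable_fun setT f -> (forall x, 0 <= f x) ->
  \int[lebesgue_rV n]_x f x =
  (`|l| ^+ n)%:E * \int[lebesgue_rV n]_x f (l *: x + b)%R.
Proof.
move=> l0; elim: n b f => [|n IH] b f mf f0.
  rewrite expr0 mul1e; apply: eq_integral => x _.
  by congr (f _); apply/rowP => -[].
rewrite !ge0_integral_rV_cons//; last first.
  by apply: measurableT_comp => //; exact: measurable_affine_rV.
pose b' : 'rV[R]_n := (rV_uncons b).2.
have E x y : (l *: rV_cons (x, y) + b)%R =
    rV_cons ((l * x + b ord0 ord0)%R, (l *: y + b')%R).
  apply/rowP => i; rewrite !mxE; case: (unliftP ord0 i) => [j ->|->] /=.
    by rewrite !mxE.
  by [].
pose F (x : measurableTypeR R) := \int[lebesgue_rV n]_y f (rV_cons (x, y)).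
have mF : measurable_fun setT F.
  apply: (@measurable_fun_fubini_tonelli_F _ _ _ _ _ _ (f \o @rV_cons R n)).
    by apply: measurableT_comp => //; exact: measurable_rV_cons.
  by move=> x; exact: f0.
have F0 x : 0 <= F x by exact: integral_ge0.
have mg : measurable_fun setT (fun x : 'rV[R]_n.+1 => f (l *: x + b)%R).
  by apply: measurableT_comp => //; exact: measurable_affine_rV.
pose G := fubini_F (lebesgue_rV n)
  (fun p : measurableTypeR R * 'rV[R]_n => f (l *: rV_cons p + b)%R).
have mG : measurable_fun setT G.
  apply: measurable_fun_fubini_tonelli_F.
    by apply: (measurableT_comp mg); exact: measurable_rV_cons.
  by move=> x; exact: f0.
have G0 x : 0 <= G x by apply: integral_ge0 => y _; exact: f0.
have FG x : F (l * x + b ord0 ord0)%R = (`|l| ^+ n)%:E * G x.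
  rewrite /F (IH b').
  - by congr (_ * _); apply: eq_integral => y _; rewrite E.
  - apply: measurableT_comp => //; apply: measurableT_comp; first exact: measurable_rV_cons.
    exact: measurable_pair1.
  - by move=> y; exact: f0.
transitivity (\int[leb]_x F x) => //.
rewrite (ge0_integral_affine_line (b ord0 ord0) l0 mF F0).
under eq_integral do rewrite FG.
by rewrite ge0_integralZl// muleA -EFinM -exprS.
Qed.

End affine_rV.

(** * Euclidean norm and balls *)

Section euclidean_norm.
Context {R : realType} {n : nat}.
Implicit Types (x y z : 'rV[R]_n) (l : R).

Lemma edotC x y : edot x y = edot y x.
Proof. by apply: eq_bigr => i _; rewrite mulrC. Qed.

Lemma edotDl x y z : edot (x + y) z = edot x z + edot y z.
Proof. by rewrite /edot -big_split; apply: eq_bigr => i _ /=; rewrite mxE mulrDl. Qed.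

Lemma edotZl l x y : edot (l *: x) y = l * edot x y.
Proof. by rewrite /edot mulr_sumr; apply: eq_bigr => i _; rewrite mxE mulrA. Qed.

Lemma edotDr x y z : edot x (y + z) = edot x y + edot x z.
Proof. by rewrite edotC edotDl !(edotC _ x). Qed.

Lemma edotZr l x y : edot x (l *: y) = l * edot x y.
Proof. by rewrite edotC edotZl edotC. Qed.

Lemma edotNl x y : edot (- x) y = - edot x y.
Proof. by rewrite -scaleN1r edotZl mulN1r. Qed.

Lemma edotNr x y : edot x (- y) = - edot x y.
Proof. by rewrite edotC edotNl edotC. Qed.

Lemma edot_ge0 x : 0 <= edot x x.
Proof. by apply: sumr_ge0 => i _; rewrite -expr2 sqr_ge0. Qed.

Lemma enorm_ge0 x : 0 <= enorm x.
Proof. exact: sqrtr_ge0. Qed.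

Lemma enorm_sqr x : enorm x ^+ 2 = edot x x.
Proof. by rewrite sqr_sqrtr// edot_ge0. Qed.

Lemma enormZ l x : enorm (l *: x) = `|l| * enorm x.
Proof.
by rewrite /enorm edotZl edotZr mulrA -expr2 sqrtrM ?sqr_ge0// sqrtr_sqr.
Qed.

Lemma enormN x : enorm (- x) = enorm x.
Proof. by rewrite -scaleN1r enormZ normrN1 mul1r. Qed.

Lemma enormC x y : enorm (x - y) = enorm (y - x).
Proof. by rewrite -enormN opprB. Qed.

Lemma enorm_coord x i : `|x ord0 i| <= enorm x.
Proof.
rewrite -(ler_pXn2r (ltn0Sn 1)) ?nnegrE ?enorm_ge0// enorm_sqr real_normK ?num_real//.
by rewrite /edot (bigD1 i)//= expr2 lerDl sumr_ge0// => j _; rewrite -expr2 sqr_ge0.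
Qed.

(** With the crude factor [n], in place of its square root, a cube of half-side [t / (4 n)] lies
    within distance [t / 4] of its centre. *)
Lemma enorm_le_coord x l : 0 <= l -> (forall i, `|x ord0 i| <= l) ->
  enorm x <= n%:R * l.
Proof.
move=> l0 xl.
rewrite -(ler_pXn2r (ltn0Sn 1)) ?nnegrE ?enorm_ge0// ?mulr_ge0// enorm_sqr.
apply: (@le_trans _ _ (\sum_(i < n) l ^+ 2)).
  apply: ler_sum => i _; rewrite -expr2 -(real_normK (num_real (x ord0 i))).
  by rewrite lerXn2r// ?nnegrE.
rewrite sumr_const card_ord -[X in X <= _]mulr_natl exprMn ler_wpM2r ?sqr_ge0//.
by rewrite -natrX ler_nat -mulnn; case: (n) => // m; rewrite leq_pmulr.
Qed.

Lemma enorm_eq0 x : (enorm x == 0) = (x == 0).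
Proof.
apply/eqP/eqP => [x0|->].
  apply/rowP => i; rewrite mxE; apply/eqP; rewrite -normr_le0 -x0.
  exact: enorm_coord.
by rewrite -[0](scale0r 0) enormZ normr0 mul0r.
Qed.

Lemma enorm0 : enorm (0 : 'rV[R]_n) = 0.
Proof. by apply/eqP; rewrite enorm_eq0. Qed.

Lemma enorm_gt0 x : (0 < enorm x) = (x != 0).
Proof. by rewrite lt0r enorm_ge0 andbT enorm_eq0. Qed.

Lemma edot_le_enorm x y : edot x y <= enorm x * enorm y.
Proof.
have [->|y0] := eqVneq y 0.
  by rewrite enorm0 mulr0 -[0](scale0r 0) edotZr mul0r.
have ny0 : 0 < enorm y by rewrite enorm_gt0.
(* The square of this vector is [|y|^2 (|x|^2 |y|^2 - (x.y)^2)]. *)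
have := edot_ge0 (enorm y ^+ 2 *: x - edot x y *: y).
rewrite edotDl !edotDr !(edotNl, edotNr) !(edotZl, edotZr) -!enorm_sqr (edotC y x).
move=> H.
have : edot x y ^+ 2 <= (enorm x * enorm y) ^+ 2.
  by rewrite -(ler_pM2l (exprn_gt0 2 ny0)); lra.
move=> H2; rewrite (le_trans (ler_norm _))//.
rewrite -(ler_pXn2r (ltn0Sn 1)) ?nnegrE ?mulr_ge0 ?enorm_ge0//.
by rewrite real_normK ?num_real.
Qed.

Lemma ler_enormD x y : enorm (x + y) <= enorm x + enorm y.
Proof.
rewrite -(ler_pXn2r (ltn0Sn 1)) ?nnegrE ?addr_ge0 ?enorm_ge0//.
rewrite enorm_sqr edotDl !edotDr (edotC y x) -!enorm_sqr.
have := edot_le_enorm x y; lra.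
Qed.

Lemma ler_edistD z x y : enorm (x - y) <= enorm (x - z) + enorm (z - y).
Proof. by rewrite (le_trans _ (ler_enormD _ _))// addrA subrK. Qed.

Lemma direction_enorm x : x != 0 -> enorm (direction x) = 1.
Proof.
by rewrite -enorm_gt0 => x0; rewrite /direction enormZ ger0_norm ?invr_ge0 ?ltW// mulVf// gt_eqF.
Qed.

Lemma directionZ l x : 0 < l -> direction (l *: x) = direction x.
Proof.
move=> l0; rewrite /direction enormZ gtr0_norm// scalerA invfM -mulrA mulrCA mulVf ?mulr1//.
by rewrite gt_eqF.
Qed.

Lemma directionN x : direction (- x) = - direction x.
Proof. by rewrite /direction enormN scalerN. Qed.

Lemma continuous_enorm : continuous (@enorm R n).
Proof.
move=> x; apply: (@continuous_comp _ _ _ (fun x => edot x x) Num.sqrt).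
  apply: continuous_big => [|i _ y]; first exact: add_continuous.
  by apply: continuousM; exact: coord_continuous.
exact: sqrt_continuous.
Qed.

Lemma open_eball x l : open (eball x l).
Proof.
rewrite (_ : eball x l = (fun y => enorm (y - x)) @^-1` [set r | r < l])//.
apply: open_comp; last exact: open_lt.
move=> y _; apply: (@continuous_comp _ _ _ (fun y => y - x) enorm).
  by apply: continuousB; [exact: cvg_id|exact: cst_continuous].
exact: continuous_enorm.
Qed.

Lemma ball_sub_eball x l : 0 < l -> exists2 e, 0 < e & forall y, ball x e y -> eball x l y.
Proof.
move=> l0; have /nbhs_ballP[e e0 xe] : nbhs x (eball x l).
  by apply: open_nbhs_nbhs; split; [exact: open_eball|rewrite /eball/= subrr enorm0].
by exists e.
Qed.

Lemma eball_sub_ball x l : forall y, eball x l y -> ball x l y.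
Proof.
move=> y xy; split=> [|i j]; first exact: le_lt_trans (enorm_ge0 _) xy.
rewrite ord1 /ball/= -normrN opprB.
have := enorm_coord (y - x) j; rewrite !mxE => /le_lt_trans; exact.
Qed.

(** The topology comes from the sup norm; this allows Euclidean balls as a basis of
    neighbourhoods. *)
Lemma nbhs_eball x (A : set 'rV[R]_n) : nbhs x A <->
  exists2 e, 0 < e & eball x e `<=` A.
Proof.
split=> [/nbhs_ballP[e e0 xA]|[e e0 xA]].
  by exists e => // y /eball_sub_ball; exact: xA.
have [d d0 dA] := ball_sub_eball x e0.
by apply/nbhs_ballP; exists d => // y /dA /xA.
Qed.

End euclidean_norm.

Section measurability.
Context {R : realType} {n : nat}.

Lemma measurable_rV_ball (x : 'rV[R]_n) (e : R) : measurable (ball x e).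
Proof.
have [e0|e0] := ltP 0 e; last first.
  by rewrite (_ : ball x e = set0)//; apply/seteqP; split => // y [+ _]; rewrite ltNge e0.
rewrite (_ : ball x e = \bigcap_(i in [set: 'I_n]) (rV_coord i @^-1` ball (x ord0 i) e)).
  apply: fin_bigcap_measurable => // i _; rewrite -[X in measurable X]setTI.
  by apply: measurable_rV_coord => //; exact: measurable_ball.
apply/seteqP; split => [y [_ xy] i _|y xy]; first exact: (xy ord0 i).
by split=> // i j; rewrite ord1; exact: xy.
Qed.

(** The sigma-algebra is generated by coordinates and the topology by sup-norm balls, so a countable
    base is needed: balls with rational centre and radius [1 / (m + 1)]. *)
Lemma measurable_open_rV (U : set 'rV[R]_n) : open U -> measurable U.
Proof.
move=> oU.
pose B (p : 'rV[rat]_n * nat) : set 'rV[R]_n :=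
  ball (map_mx ratr p.1 : 'rV[R]_n) (p.2.+1%:R^-1).
rewrite (_ : U = \bigcup_p (if `[< B p `<=` U >] then B p else set0)).
  apply: countable_bigcupT_measurable => // p.
  by case: ifP => // _; exact: measurable_rV_ball.
apply/seteqP; split => [x Ux|x [p _]]; last by case: asboolP => // + xp; exact.
have /nbhs_ballP[e /= e0 xeU] : nbhs x U by exact: open_nbhs_nbhs.
have [k ke] : exists k : nat, k.+1%:R^-1 < e / 2.
  have [k _ ke] := near_infty_natSinv_lt (PosNum (divr_gt0 e0 (ltr0n R 2))).
  by exists k; exact: (ke k (leqnn _)).
have H i : exists q : rat, `|x ord0 i - ratr q| < k.+1%:R^-1.
  have [|q] := @rat_in_itvoo R (x ord0 i - k.+1%:R^-1) (x ord0 i + k.+1%:R^-1).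
    by rewrite ltrBlDr -addrA ltrDl addr_gt0 ?invr_gt0.
  rewrite in_itv/= => /andP[q1 q2]; by exists q; rewrite distrC ltr_distl q1 q2.
have [q Hq] := choice H.
exists (\row_i q i, k) => //; case: asboolP => [_|[]].
  by split=> [|i j]; [rewrite invr_gt0|rewrite ord1 /ball/= !mxE distrC].
move=> y [_ xy]; apply: xeU; split=> // i j; rewrite ord1 /ball/=.
have := xy ord0 j; rewrite /ball/= !mxE => xy'.
rewrite (le_lt_trans (ler_distD (ratr (q j)) _ _))//.
by rewrite (lt_trans (ltrD (Hq j) xy'))// [ltRHS]splitr ltrD.
Qed.

Lemma continuous_measurable_rV (f : 'rV[R]_n -> R) : continuous f ->
  measurable_fun setT (f : 'rV[R]_n -> measurableTypeR R).
Proof.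
move=> /continuousP cf; apply: (measurability _ (RGenOpens.measurableE R)).
move=> _ [_ [a [b ->] <-]]; rewrite setTI.
by apply: measurable_open_rV; apply: cf; exact: interval_open.
Qed.

Lemma measurable_enorm : measurable_fun setT (@enorm R n : 'rV[R]_n -> measurableTypeR R).
Proof. by apply: continuous_measurable_rV; exact: continuous_enorm. Qed.

End measurability.

Section null_sets.
Context d (T : measurableType d) (R : realType) (mu : {measure set T -> \bar R}).
Local Open Scope ereal_scope.
Import HBNNSimple.

(** A nonnegative integral is a supremum over simple functions. Cutting a simple function below [f]
    to 0 on [N] keeps its integral and places it below [g]. *)
Let ge0_le_integral_off_null (N : set T) (f g : T -> \bar R) :
  measurable N -> mu N = 0 -> (forall x, 0 <= f x) -> (forall x, 0 <= g x) ->
  (forall x, ~ N x -> f x = g x) -> \int[mu]_x f x <= \int[mu]_x g x.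
Proof.
move=> mN N0 f0 g0 fg; rewrite !ge0_integralTE//.
apply: ge_ereal_sup => _ [h /= hf <-].
have mNC := measurableC mN.
apply: ereal_sup_ge; exists (sintegral mu (proj_nnsfun h mNC)).
  exists (proj_nnsfun h mNC) => //= x; rewrite mindicE.
  have [xN|xN] := boolP (x \in ~` N); last by rewrite mulr0.
  by rewrite mulr1 -fg ?hf//; move/set_mem: xN.
rewrite -!integralT_nnsfun le_eqVlt; apply/orP; left; apply/eqP.
apply: ge0_ae_eq_integral => //.
- by apply/measurable_EFinP.
- by apply/measurable_EFinP.
- by move=> x _; rewrite lee_fin.
- by move=> x _; rewrite lee_fin.
- exists N; split => // x /= /not_implyP[_]; apply: contra_notP => xN.
  by rewrite mindicE mem_set ?mulr1.
Qed.

(** [f] and [g] need not be measurable. This matters for [Ltrunc], whose integrand contains [a],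
    known only to agree with a Borel function off a null set. *)
Lemma eq_integral_off_null (N D : set T) (f g : T -> \bar R) :
  measurable N -> mu N = 0 -> (forall x, D x -> ~ N x -> f x = g x) ->
  \int[mu]_(x in D) f x = \int[mu]_(x in D) g x.
Proof.
move=> mN N0 fg; rewrite (integral_mkcond D f) (integral_mkcond D g).
set F := f \_ D; set G := g \_ D.
have FG x : ~ N x -> F x = G x.
  by move=> xN; rewrite /F /G !patchE; case: ifPn => // /set_mem Dx; exact: fg.
rewrite integralE [RHS]integralE; congr (_ - _); apply/eqP; rewrite eq_le; apply/andP; split.
- by apply: (ge0_le_integral_off_null mN N0) => // x xN; rewrite !funeposE FG.
- by apply: (ge0_le_integral_off_null mN N0) => // x xN; rewrite !funeposE FG.
- by apply: (ge0_le_integral_off_null mN N0) => // x xN; rewrite !funenegE FG.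
- by apply: (ge0_le_integral_off_null mN N0) => // x xN; rewrite !funenegE FG.
Qed.

End null_sets.

(** * Integration along rays *)

Section rays.
Context {R : realType} {n : nat}.
Hypothesis n_gt0 : (0 < n)%N.
Local Notation leb := (@lebesgue_measure R).
Local Open Scope ereal_scope.

Lemma lebesgue_rV_cube (x : 'rV[R]_n) (h : R) : (0 < h)%R ->
  lebesgue_rV n [set y | forall i, `](x ord0 i - h)%R, (x ord0 i + h)%R[%classic (y ord0 i)]
  = ((h *+ 2) ^+ n)%:E.
Proof.
move=> h0; rewrite (@lebesgue_rV_box R n (fun i => `](x ord0 i - h)%R, (x ord0 i + h)%R[%classic)); last first.
  by move=> i; exact: measurable_itv.
rewrite (eq_bigr (fun=> (h *+ 2)%:E)) => [|i _]; last first.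
  rewrite lebesgue_measure_itv/= lte_fin ifT; last by lra.
  by rewrite -EFinB; congr (_%:E); lra.
by rewrite prodEFin prodr_const card_ord.
Qed.

Lemma measurable_cube (x : 'rV[R]_n) (h : R) :
  measurable [set y : 'rV[R]_n | forall i, `](x ord0 i - h)%R, (x ord0 i + h)%R[%classic (y ord0 i)].
Proof.
rewrite (_ : [set _ | _] = \bigcap_(i in [set: 'I_n])
    (rV_coord i @^-1` `](x ord0 i - h)%R, (x ord0 i + h)%R[%classic)).
  apply: fin_bigcap_measurable => // i _; rewrite -[X in measurable X]setTI.
  by apply: measurable_rV_coord.
by apply/seteqP; split => [y xy i _|y xy i]; apply: xy.
Qed.

Lemma measurable_set1_rV (x : 'rV[R]_n) : measurable [set x].
Proof.
rewrite -[X in measurable X]setCK; apply: measurableC; apply: measurable_open_rV.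
apply: closed_openC; apply: accessible_closed_set1.
apply: hausdorff_accessible; exact: norm_hausdorff.
Qed.

Lemma lebesgue_rV_set1 (x : 'rV[R]_n) : lebesgue_rV n [set x] = 0.
Proof.
rewrite (_ : [set x] = [set y | forall i, [set x ord0 i] (y ord0 i)]); last first.
  apply/seteqP; split => y /=; first by move=> ->.
  by move=> xy; apply/rowP => i; exact: xy.
rewrite (@lebesgue_rV_box R n (fun i => [set x ord0 i]))//.
rewrite (eq_bigr (fun=> 0%:E)) => [|i _]; last exact: lebesgue_measure_set1.
by rewrite prodEFin prodr_const card_ord expr0n eqn0Ngt n_gt0.
Qed.

Lemma measurable_scale_rV : measurable_fun setT
  (fun p : measurableTypeR R * 'rV[R]_n => p.1 *: p.2).
Proof.
apply/measurable_fun_rVP => i.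
rewrite (_ : _ \o _ = (fun p => p.1 * (rV_coord i p.2))%R); last first.
  by apply/funext => p; rewrite /rV_coord /= mxE.
apply: measurable_funM; first exact: measurable_fst.
by apply: measurableT_comp; [exact: measurable_rV_coord|exact: measurable_snd].
Qed.

Let shell (y : 'rV[R]_n) : R :=
  if (1 <= enorm y)%R && (enorm y < 2)%R then (enorm y `^ (-1))%R else 0%R.

Let shell_ge0 y : (0 <= shell y)%R.
Proof. by rewrite /shell; case: ifP => // _; exact: powR_ge0. Qed.

Let measurable_shell : measurable_fun setT (shell : 'rV[R]_n -> measurableTypeR R).
Proof.
apply: measurable_fun_ifT => //; last first.
  by apply: (measurableT_comp (measurable_powR _)); exact: measurable_enorm.
by apply: measurable_and; [apply: measurable_fun_ler|apply: measurable_fun_ltr] => //; exact: measurable_enorm.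
Qed.

(* Polar coordinates without a surface measure: the radii are averaged over the
   shell [1 <= |z| < 2], using
   [1/2 = \int_0^oo 1_{t <= |y| < 2t} / |y| dt] for [y != 0]. *)
Lemma ge0_integral_rays (f : 'rV[R]_n -> \bar R) :
  measurable_fun setT f -> (forall x, 0 <= f x) ->
  2^-1%:E * \int[lebesgue_rV n]_x f x =
  \int[lebesgue_rV n]_z ((shell z)%:E *
    \int[leb]_(t in `]0%R, +oo[) (f (t *: z) * (t ^+ n.-1)%:E)).
Proof.
move=> mf f0.
(* For [t > 0], [w t (t *: z) = shell z / t]. With the Jacobian [t^n] of the dilation by [t], this
   leaves the polar factor [t^(n-1)]. *)
pose w (t : R) (y : 'rV[R]_n) : R :=
  if ((0 < t) && (t <= enorm y) && (enorm y < t * 2))%R then (enorm y `^ (-1))%R else 0%R.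
have w0 t y : (0 <= w t y)%R by rewrite /w; case: ifP => // _; exact: powR_ge0.
pose P (p : measurableTypeR R * 'rV[R]_n) := f p.2 * (w p.1 p.2)%:E.
have mn2 : measurable_fun setT (fun p : measurableTypeR R * 'rV[R]_n => enorm p.2 : measurableTypeR R).
  by apply: (measurableT_comp measurable_enorm); exact: measurable_snd.
have mfst := @measurable_fst _ _ (measurableTypeR R) 'rV[R]_n.
have mP : measurable_fun setT P.
  apply: emeasurable_funM.
    by apply: measurableT_comp => //; exact: measurable_snd.
  apply/measurable_EFinP; apply: measurable_fun_ifT => //; last first.
    by apply: (measurableT_comp (measurable_powR _)).
  apply: measurable_and; first apply: measurable_and.
  - exact: measurable_fun_ltr.
  - exact: measurable_fun_ler.
  - by apply: measurable_fun_ltr => //; exact: measurable_funM.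
have P0 p : 0 <= P p by rewrite mule_ge0// lee_fin.
pose Q (p : measurableTypeR R * 'rV[R]_n) :=
  (if (0 < p.1)%R then f (p.1 *: p.2) * (p.1 ^+ n.-1)%:E else 0) * (shell p.2)%:E.
have mQ : measurable_fun setT Q.
  apply: emeasurable_funM; last first.
    by apply/measurable_EFinP; apply: (measurableT_comp measurable_shell); exact: measurable_snd.
  apply: measurable_fun_ifT => //; first exact: measurable_fun_ltr.
  apply: emeasurable_funM; first by apply: measurableT_comp => //; exact: measurable_scale_rV.
  by apply/measurable_EFinP; exact: measurable_funX.
have Q0 p : 0 <= Q p.
  rewrite mule_ge0 ?lee_fin//; case: ifP => // p0.
  by rewrite mule_ge0// lee_fin exprn_ge0// ltW.
have mPt t : measurable_fun setT (fun y => P (t, y)).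
  exact: (measurableT_comp mP (measurable_pair1 t)).
have PQ t : \int[lebesgue_rV n]_y P (t, y) = \int[lebesgue_rV n]_y Q (t, y).
  have [t0|t0] := ltP 0%R t; last first.
    by apply: eq_integral => y _; rewrite /P /Q/= /w ltNge t0/= mule0 mul0e.
  have tn0 : (t != 0)%R by rewrite gt_eqF.
  rewrite (ge0_integral_affine_rV 0%R tn0 (mPt t) (fun y => P0 (t, y))).
  rewrite -ge0_integralZl; last 4 first.
  - exact: measurableT.
  - exact: (measurableT_comp (mPt t) (@measurable_affine_rV R n t 0%R)).
  - by move=> y _; exact: P0.
  - by rewrite lee_fin exprn_ge0.
  apply: eq_integral => y _; rewrite /P /Q/= t0 addr0 gtr0_norm//.
  rewrite muleCA -muleA; congr (_ * _); rewrite -!EFinM; congr (_%:E).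
  rewrite /w /shell enormZ gtr0_norm// t0/= ler_pMr// ltr_pM2l//.
  case: ifP => _; last by rewrite !mulr0.
  rewrite powRM ?enorm_ge0 ?(ltW t0)// (powR_inv1 (ltW t0)) mulrA.
  by rewrite -{1}(prednK n_gt0) exprSr mulfK ?gt_eqF.
(* For fixed [y != 0] the function [t |-> w t y] equals [1 / |y|] on []|y| / 2, |y|]] and 0
   elsewhere, so its integral is [1 / 2]. The origin is negligible because [n > 0]. *)
transitivity (\int[lebesgue_rV n]_y \int[leb]_t P (t, y)).
  rewrite -ge0_integralZl//.
  apply: (eq_integral_off_null (@measurable_set1_rV 0%R) (lebesgue_rV_set1 0%R)) => y _ /=.
  move/eqP; rewrite -enorm_gt0 => y0; apply/esym.
  have y1 : (0 < enorm y `^ (-1))%R by exact: powR_gt0.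
  transitivity (\int[leb]_(t in `](enorm y / 2)%R, enorm y]) (f y * (enorm y `^ (-1))%:E)).
    rewrite [RHS]integral_mkcond; apply: eq_integral => t _; rewrite patchE /P /w/=.
    have -> : (t \in `](enorm y / 2)%R, enorm y]%classic) = ((0 < t) && (t <= enorm y) && (enorm y < t * 2))%R.
      rewrite mem_setE in_itv/= ltr_pdivrMr//.
      case: (ltP (enorm y) (t * 2)%R) => [yt|_]; last by rewrite andbF.
      by rewrite andbT/= (_ : (0 < t)%R = true)//; apply/idP; lra.
    by case: ifP => _ //; rewrite mule0.
  rewrite integral_cst/= // lebesgue_measure_itv/= lte_fin ifT; last by lra.
  rewrite -EFinB -muleA -EFinM powR_inv1 ?ltW// muleC; congr (_%:E * _).
  by field; rewrite gt_eqF.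
rewrite -(fubini_tonelli P mP P0).
under eq_integral do rewrite PQ.
rewrite (fubini_tonelli Q mQ Q0); apply: eq_integral => z _.
have mfz : measurable_fun (`]0%R, +oo[%classic : set (measurableTypeR R))
    (fun t : measurableTypeR R => f (t *: z) * (t ^+ n.-1)%:E).
  apply: emeasurable_funM.
    apply: (@measurable_funS _ _ _ _ setT) => //.
    exact: (measurableT_comp (measurableT_comp mf measurable_scale_rV) (measurable_pair2 z)).
  by apply/measurable_EFinP; apply: measurable_funX.
rewrite /Q/= muleC -ge0_integralZr ?lee_fin//; last first.
  by move=> t /=; rewrite in_itv/= andbT => t0; rewrite mule_ge0// lee_fin exprn_ge0// ltW.
rewrite [RHS]integral_mkcond; apply: eq_integral => t _.
rewrite patchE mem_setE in_itv/= andbT; case: ifP => // _.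
by rewrite mul0e.
Qed.

Let measurable_ray_integral (f : 'rV[R]_n -> \bar R) :
  measurable_fun setT f -> (forall x, 0 <= f x) ->
  measurable_fun setT (fun z : 'rV[R]_n =>
    \int[leb]_(t in `]0%R, +oo[) (f (t *: z) * (t ^+ n.-1)%:E)).
Proof.
move=> mf f0.
pose Q (p : measurableTypeR R * 'rV[R]_n) :=
  (if (0 < p.1)%R then f (p.1 *: p.2) * (p.1 ^+ n.-1)%:E else 0).
rewrite (_ : (fun z => _) = fubini_G leb Q); last first.
  apply/funext => z; rewrite integral_mkcond; apply: eq_integral => t _.
  by rewrite patchE mem_setE in_itv/= andbT.
have mfst := @measurable_fst _ _ (measurableTypeR R) 'rV[R]_n.
apply: measurable_fun_fubini_tonelli_G; last first.
  move=> p; rewrite /Q; case: ifP => // p0.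
  by rewrite mule_ge0// lee_fin exprn_ge0// ltW.
apply: measurable_fun_ifT => //; first exact: measurable_fun_ltr.
apply: emeasurable_funM; first by apply: measurableT_comp => //; exact: measurable_scale_rV.
by apply/measurable_EFinP; exact: measurable_funX.
Qed.

(** The passage from inequalities on half-lines to inequalities on the whole space; a kernel factor
    that is constant on rays may be merely measurable. *)
Lemma ge0_le_integral_rays (f g : 'rV[R]_n -> \bar R) :
  measurable_fun setT f -> measurable_fun setT g ->
  (forall x, 0 <= f x) -> (forall x, 0 <= g x) ->
  (forall z, z != 0%R ->
    \int[leb]_(t in `]0%R, +oo[) (f (t *: z) * (t ^+ n.-1)%:E) <=
    \int[leb]_(t in `]0%R, +oo[) (g (t *: z) * (t ^+ n.-1)%:E)) ->
  \int[lebesgue_rV n]_x f x <= \int[lebesgue_rV n]_x g x.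
Proof.
move=> mf mg f0 g0 fg.
have ray0 (h : 'rV[R]_n -> \bar R) (z : 'rV[R]_n) : (forall x, 0 <= h x) ->
    0 <= \int[leb]_(t in `]0%R, +oo[) (h (t *: z) * (t ^+ n.-1)%:E).
  move=> h0; apply: integral_ge0 => t /=; rewrite in_itv/= andbT => t0.
  by rewrite mule_ge0// lee_fin exprn_ge0// ltW.
rewrite -(@lee_pmul2l _ 2^-1%:E)// ?lte_fin ?invr_gt0//.
rewrite !ge0_integral_rays//.
apply: ge0_le_integral => //.
- by move=> z _; rewrite mule_ge0 ?lee_fin// ray0.
- by apply: emeasurable_funM; [exact/measurable_EFinP|exact: measurable_ray_integral].
- by apply: emeasurable_funM; [exact/measurable_EFinP|exact: measurable_ray_integral].
move=> z _; have [->|z0] := eqVneq z 0%R.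
  by rewrite /shell enorm0 ler10/= !mul0e.
by rewrite lee_wpmul2l ?lee_fin// fg.
Qed.

End rays.

(** * One-dimensional barriers *)

Section primitives.
Context {R : realType}.
Local Notation leb := (@lebesgue_measure R).
Implicit Types (f F : R -> R) (a b s p t : R).

Let is_derive_continuous F f a : is_derive a 1 F (f a) -> {for a, continuous F}.
Proof. by move=> [dF _]; apply: differentiable_continuous; exact/derivable1_diffP. Qed.

Lemma integral_is_derive_itvcc f F a b : a < b ->
  (forall x, a <= x <= b -> is_derive x 1 F (f x)) ->
  (forall x, a <= x <= b -> {for x, continuous f}) ->
  (\int[leb]_(x in `[a, b]) (f x)%:E = (F b - F a)%:E)%E.
Proof.
move=> ab dF cf; rewrite EFinB; apply: continuous_FTC2 => //.
- apply: continuous_in_subspaceT => x; rewrite inE/= in_itv/=; exact: cf.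
- split.
  + by move=> x; rewrite in_itv/= => /andP[ax xb]; have [] := dF x; rewrite ?(ltW ax) ?(ltW xb).
  + apply: cvg_at_right_filter; apply: (@is_derive_continuous _ f); apply: dF; rewrite lexx; exact: ltW.
  + apply: cvg_at_left_filter; apply: (@is_derive_continuous _ f); apply: dF; rewrite lexx andbT; exact: ltW.
- move=> x; rewrite in_itv/= => /andP[ax xb]; rewrite derive1E.
  by have [|_ ->] := dF x; rewrite ?(ltW ax) ?(ltW xb).
Qed.

Lemma integral_is_derive_itvcy f F a l :
  (forall x, a <= x -> 0 <= f x) ->
  (forall x, a <= x -> is_derive x 1 F (f x)) ->
  (forall x, a <= x -> {for x, continuous f}) ->
  F x @[x --> +oo] --> l ->
  (\int[leb]_(x in `[a, +oo[) (f x)%:E = (l - F a)%:E)%E.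
Proof.
move=> f0 dF cf Fl; rewrite EFinB; apply: ge0_continuous_FTC2y => //.
- apply: continuous_in_subspaceT => x; rewrite inE/= in_itv/= andbT; exact: cf.
- by move=> x /ltW ax; have [] := dF x ax.
- apply: cvg_at_right_filter; apply: (@is_derive_continuous _ f); exact: dF.
- move=> x; rewrite in_itv/= andbT => /ltW ax; rewrite derive1E.
  by have [_ ->] := dF x ax.
Qed.

Lemma continuous_powR p t : 0 < t -> {for t, continuous (@powR R ^~ p)}.
Proof.
move=> t0; apply: (@is_derive_continuous _ (fun t => p * t `^ (p - 1))).
exact: is_derive1_powR.
Qed.

Lemma powR_cvgy0 p : p < 0 -> t `^ p @[t --> +oo] --> (0 : R).
Proof.
move=> p0.
have E : {near +oo, (fun t => (t^-1) `^ (- p)) =1 (fun t => t `^ p)}.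
  near=> t; have t0 : 0 < t by near: t; exact: nbhs_pinfty_gt.
  by rewrite -powR_inv1 ?ltW// -powRrM mulrN mulN1r opprK.
apply: cvg_trans (near_eq_cvg E) _.
apply: (@cvg_comp _ _ _ (fun t : R => t^-1) (@powR R ^~ (- p)) _ (0^'+)); last first.
  by apply: powR_cvg0; rewrite oppr_gt0.
have V0 : (t^-1 : R) @[t --> +oo] --> (0 : R).
  by apply/gtr0_cvgV0; [exact: nbhs_pinfty_gt|exact: cvg_id].
have P0 : \forall t \near +oo, 0 < (t^-1 : R).
  by near=> t; rewrite invr_gt0; near: t; exact: nbhs_pinfty_gt.
move=> A A0; have VA : \forall t \near +oo, 0 < (t^-1 : R) -> A t^-1 := V0 _ A0.
by apply: filterS2 P0 VA => t t0; exact.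
Unshelve. all: by end_near. Qed.

Lemma integral_powR_itvcy p a : 0 < a -> 0 < p ->
  (\int[leb]_(t in `[a, +oo[) (t `^ (- p - 1))%:E = (a `^ (- p) / p)%:E)%E.
Proof.
move=> a0 p0.
have dF x : a <= x -> is_derive x 1 (fun t => - p^-1 * t `^ (- p)) (x `^ (- p - 1)).
  move=> ax; have x0 := lt_le_trans a0 ax.
  apply: (is_derive_eq (is_deriveZ (- p^-1) (is_derive1_powR (- p) x0))); rewrite /GRing.scale/=; field.
  by rewrite gt_eqF.
rewrite (integral_is_derive_itvcy (l := 0) _ dF).
- by rewrite sub0r -mulNr opprK mulrC.
- by move=> x _; exact: powR_ge0.
- by move=> x ax; apply: continuous_powR; exact: lt_le_trans ax.
- rewrite -(mulr0 (- p^-1)); apply: cvgM; first exact: cvg_cst.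
  by apply: powR_cvgy0; rewrite oppr_lt0.
Qed.

Lemma integral_powR_itvcc p a b : 0 < a -> a < b -> p != 0 ->
  (\int[leb]_(t in `[a, b]) (t `^ (p - 1))%:E = ((b `^ p - a `^ p) / p)%:E)%E.
Proof.
move=> a0 ab p0.
have dF x : a <= x <= b -> is_derive x 1 (fun t => p^-1 * t `^ p) (x `^ (p - 1)).
  move=> /andP[ax _]; have x0 := lt_le_trans a0 ax.
  apply: (is_derive_eq (is_deriveZ p^-1 (is_derive1_powR p x0))); rewrite /GRing.scale/=; field.
  exact: p0.
rewrite (integral_is_derive_itvcc ab dF); first by rewrite -mulrBr mulrC.
by move=> x /andP[ax _]; apply: continuous_powR; exact: lt_le_trans ax.
Qed.

(** Concavity of the power, in the form of its tangent line at [z]. *)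
Lemma powR_tangent s (y z : R) : 0 < s < 1 -> 0 < y -> 0 < z ->
  y `^ s <= z `^ s * (1 + s * (y / z - 1)).
Proof.
move=> /andP[s0 s1] y0 z0.
have [x x0 ->] : exists2 x, 0 < x & y = z * x.
  by exists (y / z); [exact: divr_gt0|field; rewrite gt_eqF].
rewrite powRM ?(ltW z0) ?(ltW x0)// ler_pM2l ?powR_gt0//.
have -> : z * x / z = x by field; rewrite gt_eqF.
rewrite /powR gt_eqF//; set L := ln x.
have xE : x = expR L by rewrite lnK// posrE.
(* Weights [s] and [1 - s] on [H1] and [H2] cancel [L] and leave [x^s <= 1 + s (x - 1)]. *)
have H1 : x >= expR (s * L) * (1 + (1 - s) * L).
  rewrite [leRHS]xE [X in _ <= expR X](_ : L = s * L + (1 - s) * L); last by ring.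
  by rewrite expRD ler_pM2l ?expR_gt0// expR_ge1Dx.
have H2 : 1 >= expR (s * L) * (1 - s * L).
  apply: (@le_trans _ _ (expR (s * L) * expR (- (s * L)))).
    by rewrite ler_pM2l ?expR_gt0// expR_ge1Dx.
  by rewrite -expRD subrr expR0.
nra.
Qed.

Lemma bernoulli_powR s x : 0 < s < 1 -> 0 <= x -> (1 + x) `^ s <= 1 + s * x.
Proof.
move=> s01 x0; have := @powR_tangent s (1 + x) 1 s01 (ltr_pwDl ltr01 x0) ltr01.
by rewrite powR1 mul1r invr1 mulr1 (addrC 1 x) addrK.
Qed.

End primitives.

(** The kernel of the one-dimensional fractional Laplacian: what [|y|^(-n - 2s)] leaves on a ray
    after multiplication by the polar factor [t^(n-1)]. *)
Definition singular_weight (R : realType) (s t : R) := t `^ (- (2 * s) - 1).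

Definition power_increment (R : realType) (s t : R) :=
  ((1 + t) `^ s - 1) * singular_weight s t.

(** The weighted difference [1 - (1 - x)^s] to the left of 1, transported by [x = t / (1 + t)] to
    the half-line on which [power_increment] lives. *)
Definition dual_increment (R : realType) (s t : R) :=
  ((1 + t) `^ (2 * s - 1) - (1 + t) `^ (s - 1)) * singular_weight s t.

Section half_line.
Context {R : realType}.
Local Notation leb := (@lebesgue_measure R).
Implicit Types (f F G : R -> R) (a b s t x : R).

Lemma integral_substitution_itvcc F f G a b : 0 < a -> a < b ->
  (forall x, 0 < x -> is_derive x 1 F (f x)) ->
  (forall x, 0 < x -> {for x, continuous f}) ->
  (forall x y, 0 < x -> x < y -> F x < F y) ->
  (forall x, F a <= x <= F b -> {for x, continuous G}) ->
  (\int[leb]_(x in `[F a, F b]) (G x)%:E =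
   \int[leb]_(x in `[a, b]) (G (F x) * f x)%:E)%E.
Proof.
move=> a0 ab dF cf Fi cG; have b0 := lt_trans a0 ab.
have E x : 0 < x -> F^`()%classic x = f x by move=> /dF[_ <-]; rewrite derive1E.
have cF' x : 0 < x -> F^`()%classic y @[y --> x] --> F^`()%classic x.
  move=> x0; rewrite (E _ x0); apply: cvg_trans (cf _ x0); apply: near_eq_cvg.
  by near=> y; rewrite E//; near: y; exact: lt_nbhsr.
have cF x : 0 < x -> F y @[y --> x] --> F x.
  by move=> /dF[dFx _]; apply: differentiable_continuous; exact/derivable1_diffP.
rewrite integration_by_substitution_increasing.
- apply: eq_integral => x; rewrite inE/= in_itv/= => /andP[ax _].
  by rewrite !fctE E//; exact: lt_le_trans ax.
- exact: ltW.
- move=> x y; rewrite !in_itv/= => /andP[ax _] _; apply: Fi.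
  exact: lt_le_trans ax.
- by move=> x; rewrite in_itv/= => /andP[ax _]; apply: cF'; exact: lt_trans ax.
- by apply: (cvgP (F^`()%classic a)); apply: cvg_at_right_filter; exact: cF'.
- by apply: (cvgP (F^`()%classic b)); apply: cvg_at_left_filter; exact: cF'.
- split.
  + move=> x; rewrite in_itv/= => /andP[ax _].
    by have [] := dF x (lt_trans a0 ax).
  + by apply: cvg_at_right_filter; exact: cF.
  + by apply: cvg_at_left_filter; exact: cF.
- by apply: continuous_in_subspaceT => x; rewrite inE/= in_itv/=; exact: cG.
Unshelve. all: by end_near. Qed.

Lemma ge0_integral_itv_split f a r (e : itv_bound R) :
  measurable_fun setT (f : measurableTypeR R -> measurableTypeR R) ->
  a <= r -> (BRight r <= e)%O ->
  (forall t, t \in Interval (BLeft a) e -> 0 <= f t) ->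
  (\int[leb]_(t in [set` Interval (BLeft a) e]) (f t)%:E =
   \int[leb]_(t in `[a, r]) (f t)%:E +
   \int[leb]_(t in [set` Interval (BLeft r) e]) (f t)%:E)%E.
Proof.
move=> mf ar re f0.
have mfD (D : set R) : measurable_fun (D : set (measurableTypeR R)) (EFin \o f).
  by apply/measurable_EFinP; exact: measurable_funS mf.
have E := @itv_bndbnd_setU _ _ (BLeft a) (BRight r) e ar re.
rewrite E ge0_integral_setU//=.
- by rewrite integral_itv_obnd_cbnd//; exact: mfD.
- move=> x xE; rewrite lee_fin f0//.
  by have : (`[a, r] `|` [set` Interval (BRight r) e]) x by []; rewrite -E.
- rewrite disj_set2E; apply/eqP; rewrite -subset0 => x []/=.
  by rewrite !in_itv/= => /andP[_ xr] /andP[]; rewrite ltNge xr.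
Qed.

Section exponent.
Variable s : R.
Hypothesis s01 : 0 < s < 1.

Local Notation k := (singular_weight s).
Local Notation alpha := (power_increment s).
Local Notation beta := (dual_increment s).

Let s0 : 0 < s. Proof. by case/andP: s01. Qed.

Lemma singular_weight_ge0 t : 0 <= k t. Proof. exact: powR_ge0. Qed.
#[local] Hint Resolve singular_weight_ge0 : core.

Lemma continuous_singular_weight t : 0 < t -> {for t, continuous k}. Proof. exact: continuous_powR. Qed.

Lemma powR1D_ge1 t : 0 <= t -> 1 <= (1 + t) `^ s.
Proof. by move=> t0; rewrite -[leLHS](powRr0 (1 + t)) ler_powR ?lerDl// ltW. Qed.

Lemma powR1D_le1 t : 0 <= t -> (1 + t) `^ (s - 1) <= 1.
Proof.
move=> t0; rewrite -[leRHS](powRr0 (1 + t)) ler_powR ?lerDl//.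
by case/andP: s01 => _ /ltW; rewrite subr_le0.
Qed.

Lemma continuous_powR1D p t : 0 < t -> {for t, continuous (fun t => (1 + t) `^ p)}.
Proof.
move=> t0; apply: (@continuous_comp _ _ _ (fun t => 1 + t) (@powR R ^~ p)).
  by apply: cvgD; [exact: cvg_cst|exact: cvg_id].
by apply: continuous_powR; rewrite addr_gt0.
Qed.

Lemma is_derive_powR1D p t : 0 < t -> is_derive t 1 (fun t => (1 + t) `^ p) (p * (1 + t) `^ (p - 1)).
Proof.
move=> t0.
have H : is_derive t 1 (fun t : R => 1 + t) 1.
  by apply: (is_derive_eq (is_deriveD (is_derive_cst (1 : R) t (1 : R)) (is_derive_id t (1 : R)))); rewrite add0r.
have t1 : 0 < 1 + t by rewrite addr_gt0.
have := @is_derive1_comp R (@powR R ^~ p) (fun t => 1 + t) t _ _ (is_derive1_powR p t1) H.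
by rewrite mulr1; apply.
Qed.

(** The integrand is [power_increment - dual_increment]. Since [(1 + t)^s = (1 + t) (1 + t)^(s-1)],
    it has the primitive [((1 + t)^s - 1)^2 t^(-2s) / (2s)]. The limit [1 / (2s)] at infinity is
    exactly the mass of the kernel beyond distance 1, where the profile vanishes on the left: this
    is why [x_+^s] is harmonic for the half-line. *)
Lemma integral_half_line_gap x : 0 < x ->
  (\int[leb]_(t in `[x, +oo[) (((1 + t) `^ s - 1) * (1 - (1 + t) `^ (s - 1)) * k t)%:E =
   ((2 * s)^-1 * (1 - ((1 + x) `^ s - 1) ^+ 2 * x `^ (- (2 * s))))%:E)%E.
Proof.
move=> x0.
pose H t := (2 * s)^-1 * (((1 + t) `^ s - 1) ^+ 2 * t `^ (- (2 * s))).
have s2 : 2 * s != 0 by rewrite gt_eqF// mulr_gt0.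
have dH t : x <= t -> is_derive t 1 H
   (((1 + t) `^ s - 1) * (1 - (1 + t) `^ (s - 1)) * k t).
  move=> xt; have t0 := lt_le_trans x0 xt.
  have h1 : is_derive t 1 (fun t => (1 + t) `^ s - 1) (s * (1 + t) `^ (s - 1)).
    apply: is_derive_eq (subr0 _); apply: is_deriveB; exact: is_derive_powR1D.
  have h2 := is_deriveM (is_deriveX 2 h1) (is_derive1_powR (- (2 * s)) t0).
  have h3 : is_derive t 1 H _ := is_deriveZ (2 * s)^-1 h2.
  apply: (is_derive_eq h3).
  rewrite /GRing.scale/= -/(k t) expr1.
  rewrite [X in X * _ + _](_ : _ = ((1 + t) `^ s - 1) ^+ 2)//.
  have -> : t `^ (- (2 * s)) = t * k t.
    by rewrite /singular_weight -{2}(powRr1 (ltW t0)) -powRD ?(gt_eqF t0) ?implybT//; congr (_ `^ _); ring.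
  have -> : (1 + t) `^ s = (1 + t) * (1 + t) `^ (s - 1).
    have t1 : 0 < 1 + t by rewrite addr_gt0.
    by rewrite -{2}(powRr1 (ltW t1)) -powRD ?(gt_eqF t1) ?implybT//; congr (_ `^ _); ring.
  field.
  by rewrite gt_eqF.
rewrite (integral_is_derive_itvcy (l := (2 * s)^-1) _ dH).
- by rewrite /H mulrBr mulr1.
- move=> t xt; have t0 := le_trans (ltW x0) xt.
  by rewrite !mulr_ge0// subr_ge0 ?powR1D_ge1 ?powR1D_le1.
- move=> t xt; have t0 := lt_le_trans x0 xt.
  apply: cvgM; last exact: continuous_singular_weight.
  apply: cvgM; apply: cvgB; try exact: cvg_cst; exact: continuous_powR1D.
rewrite -[X in _ --> X]mulr1; apply: cvgM; first exact: cvg_cst.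
(* Absorbing [t^(-2s)] into the square makes the limit 1 visible. *)
have E : {near +oo, (fun t => ((1 + t^-1) `^ s - t `^ (- s)) ^+ 2) =1
    (fun t => ((1 + t) `^ s - 1) ^+ 2 * t `^ (- (2 * s)))}.
  near=> t; have t0 : 0 < t by near: t; exact: nbhs_pinfty_gt.
  have -> : 1 + t^-1 = (1 + t) * t^-1 by field; rewrite gt_eqF.
  rewrite powRM ?addr_ge0 ?invr_ge0 ?(ltW t0)//.
  have -> : t^-1 `^ s = t `^ (- s) by rewrite -powR_inv1 ?(ltW t0)// -powRrM mulN1r.
  have -> : t `^ (- (2 * s)) = t `^ (- s) ^+ 2.
    by rewrite -powR_mulrn ?powR_ge0// -powRrM; congr (_ `^ _); ring.
  by ring.
apply: cvg_trans (near_eq_cvg E) _.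
have h1 : (1 + t^-1 : R) @[t --> +oo] --> (1 : R).
  suff : (1 + t^-1 : R) @[t --> +oo] --> (1 + 0 : R) by rewrite addr0.
  apply: cvgD; first exact: cvg_cst.
  by apply/gtr0_cvgV0; [exact: nbhs_pinfty_gt|exact: cvg_id].
have h2 : (1 + t^-1) `^ s @[t --> +oo] --> (1 `^ s : R).
  by apply: (@continuous_cvg _ _ _ _ _ (fun t : R => 1 + t^-1) (@powR R ^~ s) 1); [exact: continuous_powR|exact: h1].
have h3 : (1 + t^-1) `^ s - t `^ (- s) @[t --> +oo] --> (1 `^ s - 0 : R).
  by apply: cvgB => //; apply: powR_cvgy0; rewrite oppr_lt0.
by have := cvgM h3 h3; rewrite powR1 subr0 mulr1; exact.
Unshelve. all: by end_near. Qed.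


Lemma measurable_powR1D p : measurable_fun setT ((fun t => (1 + t) `^ p) : measurableTypeR R -> measurableTypeR R).
Proof. by apply: (measurableT_comp (@measurable_powR R p)); exact: measurable_funD. Qed.

Lemma measurable_powR1B p : measurable_fun setT ((fun t => (1 - t) `^ p) : measurableTypeR R -> measurableTypeR R).
Proof. by apply: (measurableT_comp (@measurable_powR R p)); exact: measurable_funB. Qed.

Lemma dual_increment_ge0 t : 0 <= t -> 0 <= beta t.
Proof.
move=> t0; rewrite mulr_ge0// subr_ge0 ler_powR ?lerDl//.
by rewrite lerD2r; move: s0; lra.
Qed.

Lemma measurable_dual_increment : measurable_fun setT (beta : measurableTypeR R -> measurableTypeR R).
Proof. by apply: measurable_funM; [apply: measurable_funB; exact: measurable_powR1D|exact: measurable_powR]. Qed.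

(* The change of variables [t = x / (1 + x)]. *)
Lemma integral_half_line_left e : 0 < e < 1 ->
  (\int[leb]_(t in `[e, 1%R]) ((1 - (1 - t) `^ s) * k t)%:E <=
   \int[leb]_(t in `[(e / (1 - e))%R, +oo[) (beta t)%:E)%E.
Proof.
move=> /andP[e0 e1]; set x := e / (1 - e).
have x0 : 0 < x by rewrite divr_gt0// subr_gt0.
pose F t : R := 1 - (1 + t) `^ (-1).
have FE t : 0 < t -> F t = 1 - (1 + t)^-1.
  by move=> t0; rewrite /F powR_inv1// addr_ge0// ltW.
have dF t : 0 < t -> is_derive t 1 F ((1 + t) `^ (-2)).
  move=> t0; apply: (is_derive_eq (is_deriveB (is_derive_cst (1 : R) t (1 : R)) (is_derive_powR1D (-1) t0))).
  by rewrite sub0r mulN1r opprK; congr (_ `^ _); lra.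
have Fx : F x = e by rewrite FE// /x; field; apply/andP; split; lra.
have b0 t : 0 <= t <= 1 -> 0 <= (1 - (1 - t) `^ s) * k t.
  have p1 : 1 `^ s = 1 :> R by rewrite powR1.
  move=> t01; rewrite mulr_ge0// subr_ge0 -[leRHS]p1.
  by rewrite ge0_ler_powR ?nnegrE ?(ltW s0)//; lra.
have mb : measurable_fun setT ((fun t => (1 - (1 - t) `^ s) * k t) : measurableTypeR R -> measurableTypeR R).
  by apply: measurable_funM; [apply: measurable_funB => //; exact: measurable_powR1B|exact: measurable_powR].
(* The substitution sends 1 to infinity, so it is stopped at [F T]. The remaining interval has
   length [1 / (1 + T)] and its integrand is at most [k e]; [T] is chosen to make this contribution
   at most [d]. *)
apply/lee_addgt0Pr => d d0.
pose T := x + 1 + k e / d.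
have ked : 0 <= k e / d by rewrite divr_ge0// ltW.
have xT : x < T by rewrite /T; lra.
have T1 : 0 < 1 + T by lra.
have T0 : 0 < T by lra.
have FT1 : F T < 1 by rewrite FE// ltrBlDr ltrDl invr_gt0.
have Finc y z : 0 < y -> y < z -> F y < F z.
  move=> y0 yz; rewrite !FE ?(lt_trans y0 yz)// ltrD2l ltrN2 ltf_pV2 ?posrE; lra.
have eFT : e < F T by rewrite -Fx; exact: Finc.
rewrite (ge0_integral_itv_split (r := F T) mb (ltW eFT)); last 2 first.
- by rewrite bnd_simp ltW.
- move=> t; rewrite in_itv/= => /andP[et t1]; apply: b0.
  by rewrite t1 andbT (le_trans (ltW e0)).
have cb t : F x <= t <= F T -> {for t, continuous (fun t => (1 - (1 - t) `^ s) * k t)}.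
  rewrite Fx => /andP[et tF].
  apply: cvgM; last by apply: continuous_singular_weight; exact: lt_le_trans et.
  apply: cvgB; first exact: cvg_cst.
  apply: (@continuous_comp _ _ _ (fun t => 1 - t) (@powR R ^~ s)).
    by apply: cvgB; [exact: cvg_cst|exact: cvg_id].
  by apply: continuous_powR; rewrite subr_gt0; exact: le_lt_trans FT1.
have k_le t : e <= t -> k t <= k e.
  move=> et; rewrite /singular_weight -opprD 2!powRN lef_pV2 ?posrE ?powR_gt0//; last exact: lt_le_trans et.
  rewrite ge0_ler_powR ?nnegrE ?(ltW e0)//; last exact: le_trans (ltW e0) et.
  by rewrite addr_ge0// mulr_ge0// ltW.
apply: leeD.
  rewrite -[X in `[X, F T]]Fx (integral_substitution_itvcc x0 xT dF _ Finc cb); last first.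
    by move=> t; exact: continuous_powR1D.
  apply: (@le_trans _ _ (\int[leb]_(t in `[x, T]) (beta t)%:E)%E); last first.
    apply: ge0_subset_integral => //.
    - by apply/measurable_EFinP; exact: measurable_funS measurable_dual_increment.
    - move=> t /=; rewrite in_itv/= andbT => xt; rewrite lee_fin dual_increment_ge0//.
      exact: le_trans (ltW x0) xt.
    - by move=> t /=; rewrite !in_itv/= => /andP[->].
  rewrite le_eqVlt; apply/orP; left; apply/eqP; apply: eq_integral => t.
  rewrite inE/= in_itv/= => /andP[xt _]; congr (_%:E).
  have t0 := lt_le_trans x0 xt.
  have t1 : 0 < 1 + t by rewrite addr_gt0.
  have pD p q : (1 + t) `^ (p + q) = (1 + t) `^ p * (1 + t) `^ q.
    by rewrite powRD// (gt_eqF t1) implybT.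
  rewrite /dual_increment FE// subKr.
  have -> : 1 - (1 + t)^-1 = t * (1 + t)^-1 by field; rewrite gt_eqF.
  rewrite /singular_weight powRM ?invr_ge0 ?(ltW t0) ?(ltW t1)// -powR_inv1 ?(ltW t1)// -!powRrM !mulN1r.
  have -> : 2 * s - 1 = (- (- (2 * s) - 1)) + -2 by ring.
  have -> : s - 1 = - s + ((- (- (2 * s) - 1)) + -2) by ring.
  by rewrite (pD (- s)) pD; ring.
apply: (@le_trans _ _ (\int[leb]_(t in `[F T, 1%R]) (k e)%:E)%E).
  apply: ge0_le_integral => //.
  - move=> t /=; rewrite in_itv/= => /andP[Ft t1]; rewrite lee_fin b0// t1 andbT.
    by rewrite (le_trans _ Ft)// ltW// (lt_trans e0).
  - by apply/measurable_EFinP; exact: measurable_funS mb.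
  - move=> t /=; rewrite in_itv/= => /andP[Ft t1]; rewrite lee_fin.
    have et := le_trans (ltW eFT) Ft.
    rewrite (le_trans _ (k_le t et))// ler_piMl// gerBl powR_ge0//.
rewrite integral_cst//= lebesgue_measure_itv/= lte_fin FT1 -EFinB -EFinM lee_fin.
rewrite FE// subKr ler_pdivrMr// mulrDr mulr1.
rewrite (@le_trans _ _ (d * T))//; last by rewrite lerDr ltW.
rewrite /T mulrDr (mulrCA d) mulfV ?gt_eqF// mulr1 lerDr mulr_ge0 ?(ltW d0)//; lra.
Qed.

Lemma power_increment_ge0 t : 0 <= t -> 0 <= alpha t.
Proof. by move=> t0; rewrite mulr_ge0// subr_ge0 powR1D_ge1. Qed.

Lemma measurable_power_increment : measurable_fun setT (alpha : measurableTypeR R -> measurableTypeR R).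
Proof. by apply: measurable_funM; [apply: measurable_funB => //; exact: measurable_powR1D|exact: measurable_powR]. Qed.

(* [((1 + t)^s - 1) / t] is nonincreasing by concavity. *)
Lemma increment_weight_anti t x : 0 < t -> t <= x -> alpha x <= alpha t.
Proof.
move=> t0 tx; have x0 := lt_le_trans t0 tx.
have kE y : 0 < y -> k y = y^-1 * y `^ (- (2 * s)).
  move=> y0; rewrite -powR_inv1 ?(ltW y0)// -powRD ?(gt_eqF y0) ?implybT//.
  by rewrite /singular_weight addrC.
rewrite /power_increment !kE// !mulrA ler_pM ?powR_ge0//.
- by rewrite divr_ge0 ?(ltW x0)// subr_ge0 powR1D_ge1// ltW.
- have t1 : 0 < 1 + t by rewrite addr_gt0.
  (* The tangent at [1 + t], evaluated at [1] and at [1 + x]: weights [x - t] and [t] cancel the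
     slopes and give [t ((1 + x)^s - 1) <= x ((1 + t)^s - 1)]. *)
  have h1 := powR_tangent s01 (ltr01 : 0 < 1 :> R) t1.
  have h2 := powR_tangent s01 (ltr_pwDl ltr01 (ltW x0)) t1.
  rewrite ler_pdivrMr// mulrAC ler_pdivlMr//.
  move: h1 h2; rewrite powR1; set Z := (1 + t) `^ s; set X := (1 + x) `^ s.
  have -> : 1 / (1 + t) - 1 = - t / (1 + t) by field; rewrite gt_eqF.
  have -> : (1 + x) / (1 + t) - 1 = (x - t) / (1 + t) by field; rewrite gt_eqF.
  set q := (1 + t)^-1 => h1 h2.
  have h3 : (x - t) * 1 <= (x - t) * (Z * (1 + s * (- t * q))) by rewrite ler_wpM2l// subr_ge0.
  have h4 : t * X <= t * (Z * (1 + s * ((x - t) * q))) by rewrite ler_wpM2l// ltW.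
  lra.
- rewrite 2!powRN lef_pV2 ?posrE ?powR_gt0// ge0_ler_powR ?nnegrE ?(ltW t0) ?(ltW x0)//.
  by rewrite mulr_ge0// ltW.
Qed.

(** With cut-off [e] on both sides, the transported left integral starts at [x = e / (1 - e)] and
    the right one already at [e]. The piece between, of length [e x], pays for the boundary term of
    [integral_half_line_gap] at [x]: as [e <= 1/2], [x <= 2 e], so [(1 + x)^s - 1 <= 2 s e]. *)
Lemma integral_increment_ge e : 0 < e <= 2^-1 ->
  (((2 * s)^-1 * (((1 + e / (1 - e)) `^ s - 1) ^+ 2 * (e / (1 - e)) `^ (- (2 * s))))%:E <=
  \int[leb]_(t in `[e, (e / (1 - e))%R]) (alpha t)%:E)%E.
Proof.
move=> /andP[e0 e2]; set x := e / (1 - e).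
have e1 : 0 < 1 - e by lra.
have x0 : 0 < x by rewrite divr_gt0.
have xe : x - e = e * x by rewrite /x; field; rewrite gt_eqF.
have ex : e < x by rewrite -subr_gt0 xe mulr_gt0.
have x2e : x <= 2 * e by rewrite ler_pdivrMr//; nra.
apply: (@le_trans _ _ (\int[leb]_(t in `[e, x]) (alpha x)%:E)%E); last first.
  apply: ge0_le_integral => //.
  - by move=> t _; rewrite lee_fin power_increment_ge0// ltW.
  - by apply/measurable_EFinP; exact: measurable_funS measurable_power_increment.
  - move=> t /=; rewrite in_itv/= => /andP[et tx]; rewrite lee_fin increment_weight_anti//.
    exact: lt_le_trans et.
rewrite integral_cst//= lebesgue_measure_itv/= lte_fin ex -EFinB -EFinM lee_fin xe.
have -> : x `^ (- (2 * s)) = x * k x.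
  by rewrite /singular_weight -{2}(powRr1 (ltW x0)) -powRD ?(gt_eqF x0) ?implybT//; congr (_ `^ _); ring.
have b := bernoulli_powR s01 (ltW x0).
have b1 := powR1D_ge1 (ltW x0).
rewrite /alpha; set y := (1 + x) `^ s - 1.
have y0 : 0 <= y by rewrite subr_ge0.
have ys : y <= s * (2 * e).
  by rewrite /y lerBlDl (le_trans b)// lerD2l ler_wpM2l// ltW.
have -> : (2 * s)^-1 * (y ^+ 2 * (x * k x)) = (y * k x * x) * (y / (2 * s)).
  by field; rewrite gt_eqF.
have -> : y * k x * (e * x) = (y * k x * x) * e by ring.
rewrite ler_wpM2l ?(mulr_ge0 (mulr_ge0 y0 (singular_weight_ge0 x)) (ltW x0))// ler_pdivrMr ?mulr_gt0//.
by rewrite (le_trans ys)// (_ : e * _ = s * (2 * e))//; ring.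
Qed.

End exponent.
End half_line.

Section half_line_subsolution.
Context {R : realType}.
Local Notation leb := (@lebesgue_measure R).
Variable s : R.
Hypothesis s01 : 0 < s < 1.
Local Notation k := (singular_weight s).
Local Notation alpha := (power_increment s).
Local Notation beta := (dual_increment s).
Implicit Types e t x : R.

Definition power_decrement t := (1 - (Num.max (1 - t) 0) `^ s) * k t.

Lemma power_decrement_ge0 t : 0 <= t -> 0 <= power_decrement t.
Proof.
move=> t0; have s0 : 0 <= s by case/andP: s01 => /ltW.
rewrite mulr_ge0 ?singular_weight_ge0// subr_ge0.
have p1 : 1 `^ s = 1 :> R by rewrite powR1.
rewrite -[leRHS]p1 ge0_ler_powR ?nnegrE// ?le_max ?lexx ?orbT//.
by rewrite ge_max ler01 andbT gerBl.
Qed.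

Lemma measurable_positive_part : measurable_fun setT
  ((fun t => (Num.max (1 - t) 0) `^ s) : measurableTypeR R -> measurableTypeR R).
Proof.
apply: (measurableT_comp (@measurable_powR R s)).
by apply: measurable_maxr => //; exact: measurable_funB.
Qed.

Lemma measurable_power_decrement : measurable_fun setT
  (power_decrement : measurableTypeR R -> measurableTypeR R).
Proof.
apply: measurable_funM; last exact: measurable_powR.
by apply: measurable_funB => //; exact: measurable_positive_part.
Qed.

Lemma integral_power_decrement e : 0 < e <= 2^-1 ->
  (\int[leb]_(t in `[e, +oo[) (power_decrement t)%:E =
   \int[leb]_(t in `[e, 1%R]) ((1 - (1 - t) `^ s) * k t)%:E + ((2 * s)^-1)%:E)%E.
Proof.
move=> /andP[e0 e2]; have s0 : 0 < s by case/andP: s01.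
have e1 : e <= 1 by lra.
rewrite (ge0_integral_itv_split measurable_power_decrement e1); last 2 first.
- by [].
- move=> t; rewrite in_itv/= andbT => et.
  by apply: power_decrement_ge0; exact: le_trans (ltW e0) et.
apply: (f_equal2 (fun a b => (a + b)%E)).
  apply: eq_integral => t; rewrite inE/= in_itv/= => /andP[_ t1].
  by rewrite /power_decrement max_l ?subr_ge0.
transitivity (\int[leb]_(t in `[1%R, +oo[) (t `^ (- (2 * s) - 1))%:E)%E.
  apply: eq_integral => t; rewrite inE/= in_itv/= andbT => t1.
  rewrite /power_decrement max_r ?subr_le0// powR0 ?(gt_eqF s0)//.
  by rewrite subr0 mul1r.
have s2 : 0 < 2 * s by rewrite mulr_gt0.
by rewrite (integral_powR_itvcy ltr01 s2) powR1 mul1r.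
Qed.

Lemma integral_power_increment x : 0 < x ->
  (\int[leb]_(t in `[x, +oo[) (alpha t)%:E =
    \int[leb]_(t in `[x, +oo[) (beta t)%:E +
    \int[leb]_(t in `[x, +oo[) (((1 + t) `^ s - 1) * (1 - (1 + t) `^ (s - 1)) * k t)%:E)%E.
Proof.
move=> x0.
have xt0 t : `[x, +oo[%classic t -> 0 < t.
  by rewrite /= in_itv/= andbT; exact: lt_le_trans.
rewrite -ge0_integralD//.
- apply: eq_integral => t; rewrite inE => /xt0 t0.
  have t1 : 0 < 1 + t by rewrite addr_gt0.
  rewrite -EFinD; congr (_%:E); rewrite /dual_increment /power_increment.
  have -> : (1 + t) `^ (2 * s - 1) = (1 + t) `^ s * (1 + t) `^ (s - 1).
    by rewrite -powRD ?(gt_eqF t1) ?implybT//; congr (_ `^ _); ring.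
  by ring.
- by move=> t /xt0/ltW t0; rewrite lee_fin; exact: dual_increment_ge0.
- by apply/measurable_EFinP; apply: measurable_funS (measurable_dual_increment s).
- move=> t /xt0/ltW t0; rewrite lee_fin.
  apply: mulr_ge0; last exact: singular_weight_ge0.
  by apply: mulr_ge0; rewrite subr_ge0; [exact: powR1D_ge1|exact: powR1D_le1].
- apply/measurable_EFinP; apply: (@measurable_funS _ _ _ _ setT) => //.
  apply: measurable_funM; last exact: measurable_powR.
  by apply: measurable_funM; apply: measurable_funB => //; exact: measurable_powR1D.
Qed.

(** The left side is at most the integral of [beta] from [x] plus the tail [1 / (2s)]. The right
    side is that same integral, plus [1 / (2s)] minus the boundary term at [x], plus the piece over
    [[e, x]], which dominates the boundary term. *)
Lemma integral_decrement_le_increment e : 0 < e <= 2^-1 ->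
  (\int[leb]_(t in `[e, +oo[) (power_decrement t)%:E <=
   \int[leb]_(t in `[e, +oo[) (alpha t)%:E)%E.
Proof.
move=> e02; have /andP[e0 e2] := e02.
have e1 : 0 < 1 - e by lra.
have e01 : 0 < e < 1 by rewrite e0/=; lra.
have [x xE] : exists x, x = e / (1 - e) by exists (e / (1 - e)).
have x0 : 0 < x by rewrite xE divr_gt0.
have ex : e <= x by rewrite xE ler_pdivlMr// ler_piMr ?(ltW e0)//; lra.
have lft : (\int[leb]_(t in `[e, 1%R]) ((1 - (1 - t) `^ s) * k t)%:E <=
    \int[leb]_(t in `[x, +oo[) (beta t)%:E)%E.
  by rewrite xE; exact: integral_half_line_left.
have inc : (((2 * s)^-1 * (((1 + x) `^ s - 1) ^+ 2 * x `^ (- (2 * s))))%:E <=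
    \int[leb]_(t in `[e, x]) (alpha t)%:E)%E.
  by rewrite xE; exact: integral_increment_ge.
rewrite (ge0_integral_itv_split (measurable_power_increment s) ex); last 2 first.
- by [].
- move=> t; rewrite in_itv/= andbT => et.
  by apply: power_increment_ge0 => //; exact: le_trans (ltW e0) et.
rewrite integral_power_decrement// integral_power_increment// integral_half_line_gap//.
rewrite addeCA; apply: leeD; first exact: lft.
apply: (le_trans _ (leeD2r _ inc)).
by rewrite -EFinD -mulrDr addrC subrK mulr1.
Qed.

(* [(-Delta)^s] of the half-line profile [x_+^s] is nonpositive at [1], already
   when the kernel is truncated at [e]. *)
Lemma half_line_subsolution e : 0 < e <= 2^-1 ->
  (\int[leb]_(t in `[e, +oo[) (2 * t `^ (- (2 * s) - 1))%:E <=
   \int[leb]_(t in `[e, +oo[) (((Num.max (1 + t) 0) `^ s + (Num.max (1 - t) 0) `^ s) *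
      t `^ (- (2 * s) - 1))%:E)%E.
Proof.
move=> e02; have /andP[e0 e2] := e02.
have t0 t : `[e, +oo[%classic t -> 0 <= t.
  by rewrite /= in_itv/= andbT; apply: le_trans; exact: ltW.
(* Adding [g] to both sides yields the two profiles without subtracting extended reals. *)
pose g t := (1 + (Num.max (1 - t) 0) `^ s) * k t.
have mg : measurable_fun (`[e, +oo[%classic : set (measurableTypeR R)) (EFin \o g).
  apply/measurable_EFinP; apply: (@measurable_funS _ _ _ _ setT) => //.
  apply: measurable_funM; last exact: measurable_powR.
  by apply: measurable_funD => //; exact: measurable_positive_part.
have g0 t : `[e, +oo[%classic t -> (0 <= (g t)%:E)%E.
  by move=> _; rewrite lee_fin mulr_ge0 ?singular_weight_ge0// addr_ge0// powR_ge0.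
apply: (@le_trans _ _ (\int[leb]_(t in `[e, +oo[) (power_decrement t)%:E +
  \int[leb]_(t in `[e, +oo[) (g t)%:E)%E).
  rewrite -ge0_integralD//.
  - rewrite le_eqVlt; apply/orP; left; apply/eqP; apply: eq_integral => t _.
    by rewrite -EFinD; congr (_%:E); rewrite /g /power_decrement /singular_weight; ring.
  - by move=> t /t0 ?; rewrite lee_fin; exact: power_decrement_ge0.
  - by apply/measurable_EFinP; apply: measurable_funS measurable_power_decrement.
apply: (le_trans (leeD2r _ (integral_decrement_le_increment e02))).
rewrite -ge0_integralD//.
- rewrite le_eqVlt; apply/orP; left; apply/eqP; apply: eq_integral => t.
  rewrite inE => /t0 tge0; rewrite -EFinD; congr (_%:E).
  rewrite /g /power_increment /singular_weight (@max_l _ _ (1 + t)) ?addr_ge0//.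
  by ring.
- by move=> t /t0 ?; rewrite lee_fin; exact: power_increment_ge0.
- by apply/measurable_EFinP; apply: measurable_funS (measurable_power_increment s).
Qed.

End half_line_subsolution.

(** * Concave quadratic profiles *)

Section quadratic_profile.
Context {R : realType}.
Local Notation leb := (@lebesgue_measure R).
Implicit Types (A B D e t x : R).

Definition ppow (s x : R) : R := (Num.max x 0) `^ s.

Lemma ppow_ge0 s x : 0 <= ppow s x. Proof. exact: powR_ge0. Qed.

Lemma ppowE s x : 0 <= x -> ppow s x = x `^ s.
Proof. by move=> x0; rewrite /ppow max_l. Qed.

Lemma ppow_eq0 s x : s != 0 -> x <= 0 -> ppow s x = 0.
Proof. by move=> s0 x0; rewrite /ppow max_r// powR0. Qed.

Lemma measurable_ppow s : measurable_fun setT (ppow s : measurableTypeR R -> measurableTypeR R).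
Proof. by apply: (measurableT_comp (measurable_powR s)); exact: measurable_maxr. Qed.

Lemma ppowM s c x : 0 <= c -> ppow s (c * x) = c `^ s * ppow s x.
Proof.
by move=> c0; rewrite /ppow -{1}(mulr0 c) -maxr_pMr// powRM// le_max lexx orbT.
Qed.

Lemma ge0_integral_scale_itvcy (f : measurableTypeR R -> \bar R) c e : 0 < c ->
  measurable_fun setT f -> (forall t, (0 <= f t)%E) ->
  (\int[leb]_(t in `[(c * e)%R, +oo[) f t =
   c%:E * \int[leb]_(t in `[e, +oo[) f (c * t)%R)%E.
Proof.
move=> c0 mf f0; rewrite [in LHS]integral_mkcond [in RHS]integral_mkcond.
rewrite (ge0_integral_affine_line 0 (lt0r_neq0 c0)).
- rewrite gtr0_norm//; congr (_ * _)%E; apply: eq_integral => t _.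
  by rewrite !patchE !mem_setE !in_itv/= !andbT addr0 ler_pM2l.
- by apply/(measurable_restrictT _ _).1 => //; exact: measurable_funS mf.
- by move=> t; apply: erestrict_ge0.
Qed.

Variable s : R.
Hypothesis s01 : 0 < s < 1.
Local Notation k := (singular_weight s).

Let s0 : 0 < s. Proof. by case/andP: s01. Qed.

Let s1 : s < 1. Proof. by case/andP: s01. Qed.

#[local] Hint Resolve singular_weight_ge0 : core.

Let mk : measurable_fun setT (k : measurableTypeR R -> measurableTypeR R).
Proof. exact: measurable_powR. Qed.

Lemma measurable_quadratic_profile A B D : measurable_fun setT
  ((fun t => ppow s (A + B * t - D * t ^+ 2)) : measurableTypeR R -> measurableTypeR R).
Proof.
apply: (measurableT_comp (measurable_ppow s)).
apply: measurable_funB; first by apply: measurable_funD => //; exact: measurable_funM.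
by apply: measurable_funM => //; exact: measurable_funX.
Qed.

Lemma measurable_affine_profile A B : measurable_fun setT
  ((fun t => ppow s (A + B * t)) : measurableTypeR R -> measurableTypeR R).
Proof.
apply: (measurableT_comp (measurable_ppow s)).
by apply: measurable_funD => //; exact: measurable_funM.
Qed.

(** Under [t = (A / B) t'] the affine function becomes [A (1 + t')], and [e * B <= A / 2] is the
    bound [1/2] on the rescaled cut-off. *)
Lemma line_subsolution_pos A B e : 0 < A -> 0 < B -> 0 < e -> e * B <= A / 2 ->
  (\int[leb]_(t in `[e, +oo[) (2 * A `^ s * k t)%:E <=
   \int[leb]_(t in `[e, +oo[) ((ppow s (A + B * t) + ppow s (A - B * t)) * k t)%:E)%E.
Proof.
move=> A0 B0 e0 eA.
pose c := A / B; have c0 : 0 < c by rewrite divr_gt0.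
have AE : A = B * c by rewrite /c mulrCA mulfV ?mulr1// gt_eqF.
have -> : e = c * (e / c) by rewrite mulrCA mulfV ?mulr1// gt_eqF.
have mN : measurable_fun setT
  ((fun t => (ppow s (A + B * t) + ppow s (A - B * t)) * k t) : measurableTypeR R -> measurableTypeR R).
  apply: measurable_funM => //; apply: measurable_funD; first exact: measurable_affine_profile.
  have -> : (fun t => ppow s (A - B * t)) = (fun t => ppow s (A + (- B) * t)).
    by apply/funext => t; rewrite mulNr.
  exact: measurable_affine_profile.
have mL : measurable_fun setT ((fun t => 2 * A `^ s * k t) : measurableTypeR R -> measurableTypeR R).
  exact: measurable_funM.
rewrite (ge0_integral_scale_itvcy (f := fun t => (2 * A `^ s * k t)%:E) _ c0); last 2 first.
- exact/measurable_EFinP.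
- by move=> t; rewrite lee_fin !mulr_ge0 ?powR_ge0.
rewrite (ge0_integral_scale_itvcy
  (f := fun t => ((ppow s (A + B * t) + ppow s (A - B * t)) * k t)%:E) _ c0); last 2 first.
- exact/measurable_EFinP.
- move=> t; rewrite lee_fin; apply: mulr_ge0; last exact: singular_weight_ge0.
  by apply: addr_ge0; exact: ppow_ge0.
apply: lee_wpmul2l; first by rewrite lee_fin; exact: ltW.
have kM t : 0 <= t -> k (c * t) = k c * k t by move=> t0; rewrite /singular_weight powRM// ltW.
have ec : 0 < e / c <= 2^-1.
  rewrite divr_gt0//= (_ : e / c = e * B / A); last by rewrite /c invf_div mulrA.
  by rewrite ler_pdivrMr// [leRHS]mulrC.
pose K := A `^ s * k c.
have K0 : 0 <= K by rewrite mulr_ge0// powR_ge0.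
have ect t : `[(e / c)%R, +oo[%classic t -> 0 <= t.
  by rewrite /= in_itv/= andbT; apply: le_trans; rewrite ltW//; case/andP: ec.
have mK (g : R -> R) : measurable_fun setT (g : measurableTypeR R -> measurableTypeR R) ->
    (forall t, 0 <= g t) ->
    (\int[leb]_(t in `[(e / c)%R, +oo[) (K * (g t * k t))%:E =
     K%:E * \int[leb]_(t in `[(e / c)%R, +oo[) (g t * k t)%:E)%E.
  move=> mg g0; rewrite -ge0_integralZl//=.
  - apply/measurable_EFinP; apply: (@measurable_funS _ _ _ _ setT) => //.
    exact: measurable_funM.
  - by move=> t _; rewrite lee_fin; apply: mulr_ge0; [exact: g0|exact: singular_weight_ge0].
rewrite (eq_integral (fun t : measurableTypeR R => (K * (2 * k t))%:E)); last first.
  by move=> t; rewrite inE => /ect t0; rewrite kM// /K; congr (_%:E); ring.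
rewrite [leRHS](eq_integral (fun t : measurableTypeR R => (K * ((ppow s (1 + t) + ppow s (1 - t)) * k t))%:E)); last first.
  move=> t; rewrite inE => /ect t0; rewrite kM// /K; congr (_%:E).
  have -> : A + B * (c * t) = A * (1 + t) by rewrite AE; ring.
  have -> : A - B * (c * t) = A * (1 - t) by rewrite AE; ring.
  by rewrite !ppowM ?(ltW A0)//; ring.
rewrite mK// (mK (fun t => ppow s (1 + t) + ppow s (1 - t))); last 2 first.
- apply: measurable_funD; apply: (measurableT_comp (measurable_ppow s)).
    exact: measurable_funD.
  exact: measurable_funB.
- by move=> t; apply: addr_ge0; exact: ppow_ge0.
have H := half_line_subsolution s01 ec.
apply: lee_wpmul2l; first by rewrite lee_fin.
exact H.
Qed.

Lemma line_subsolution A B e : 0 < A -> 0 < e -> e * `|B| <= A / 2 ->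
  (\int[leb]_(t in `[e, +oo[) (2 * A `^ s * t `^ (- (2 * s) - 1))%:E <=
   \int[leb]_(t in `[e, +oo[)
     ((ppow s (A + B * t) + ppow s (A - B * t)) * t `^ (- (2 * s) - 1))%:E)%E.
Proof.
move=> A0 e0; have [B0|B0|->] := ltgtP B 0.
- rewrite (ltr0_norm B0) => eA; have NB0 : 0 < - B by rewrite oppr_gt0.
  have H := line_subsolution_pos A0 NB0 e0 eA.
  apply: (le_trans H); rewrite le_eqVlt; apply/orP; left; apply/eqP.
  by apply: eq_integral => t _; rewrite !mulNr opprK addrC.
- by rewrite (gtr0_norm B0) => eA; exact: line_subsolution_pos.
- move=> _; rewrite le_eqVlt; apply/orP; left; apply/eqP; apply: eq_integral => t _.
  by rewrite !mul0r subr0 addr0 ppowE ?(ltW A0)// mulr_natl mulr2n.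
Qed.

(* At the root [T] of [A + B T = D T^2] the affine function is comparable with
   [D T t]: it lies above on [0, T] and below on [T, +oo[ because [A >= 0]. *)
Definition affine_gap D T t := if t <= T then D `^ s * T `^ (s - 1) * t `^ (1 + s)
                 else D `^ s * T `^ s * t `^ s.

Lemma measurable_affine_gap D T : measurable_fun setT (affine_gap D T : measurableTypeR R -> measurableTypeR R).
Proof.
apply: measurable_fun_ifT; first exact: measurable_fun_ler.
- by apply: measurable_funM => //; exact: measurable_powR.
- by apply: measurable_funM => //; exact: measurable_powR.
Qed.

Lemma affine_gap_ge0 D T t : 0 <= affine_gap D T t.
Proof. by rewrite /affine_gap; case: ifP => _; rewrite !mulr_ge0// powR_ge0. Qed.

(** Let [X = A + B t]. For [t <= T] one has [X >= D T t], and the loss in the power is at most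
    [X^(s-1) D t^2 <= (D T t)^(s-1) D t^2], because [s - 1 < 0]. For [t > T] one has [X <= D T t],
    and all of [X^s] is charged to the gap. *)
Lemma ppow_le_gap A B D T t : 0 <= A -> 0 < D -> 0 < T -> A + B * T = D * T ^+ 2 ->
  0 < t -> ppow s (A + B * t) <= ppow s (A + B * t - D * t ^+ 2) + affine_gap D T t.
Proof.
move=> A0 D0 T0 AT t0; set X := A + B * t.
have XE : X * T = A * (T - t) + D * T ^+ 2 * t by rewrite -AT /X; ring.
have [X0|X0] := leP X 0.
  rewrite (ppow_eq0 (lt0r_neq0 s0) X0).
  by apply: addr_ge0; [exact: ppow_ge0|exact: affine_gap_ge0].
have DT0 : 0 < D * T by rewrite mulr_gt0.
rewrite /affine_gap; case: (leP t T) => tT.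
- have XD : D * T * t <= X.
    rewrite -(ler_pM2r T0) XE (_ : D * T * t * T = D * T ^+ 2 * t); last by ring.
by rewrite lerDr; apply: mulr_ge0; [exact: A0|rewrite subr_ge0; exact: tT].
  have h2 : 0 <= D * t ^+ 2 by rewrite mulr_ge0 ?(ltW D0)// sqr_ge0.
  have h1 : X `^ s - X `^ (s - 1) * (D * t ^+ 2) <= ppow s (X - D * t ^+ 2).
    have -> : X `^ s = X `^ (s - 1) * X.
      by rewrite mulrC (mulr_powRB1 (ltW X0) s0).
    rewrite -mulrBr; have [Y0|Y0] := leP (X - D * t ^+ 2) 0.
      by rewrite (le_trans _ (ppow_ge0 _ _))// mulr_ge0_le0// powR_ge0.
    rewrite ppowE ?(ltW Y0)//; set Y := X - D * t ^+ 2.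
    have YE : Y = Y `^ (1 - s) * Y `^ s.
      by rewrite -powRD ?subrK ?powRr1 ?(ltW Y0)// (gt_eqF Y0) implybT.
    rewrite [leLHS](_ : _ = X `^ (s - 1) * Y `^ (1 - s) * Y `^ s); last by rewrite -mulrA -YE.
    rewrite ler_piMl ?powR_ge0//.
    have -> : 1 - s = - (s - 1) by rewrite opprB.
    rewrite powRN -ler_pdivlMr ?invr_gt0 ?powR_gt0// invrK mul1r.
    rewrite -(opprB 1 s) 2!powRN lef_pV2 ?posrE ?powR_gt0//.
    by rewrite ge0_ler_powR ?nnegrE ?(ltW X0) ?(ltW Y0) ?subr_ge0 ?(ltW s1)// gerBl.
  rewrite ppowE ?(ltW X0)// (le_trans _ (lerD h1 (lexx _)))// -addrA lerDl addrC subr_ge0.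
  apply: (@le_trans _ _ ((D * T * t) `^ (s - 1) * (D * t ^+ 2))).
    rewrite ler_wpM2r// -(opprB 1 s) 2!powRN lef_pV2 ?posrE ?powR_gt0 ?mulr_gt0//.
    by rewrite ge0_ler_powR ?nnegrE ?(ltW X0) ?subr_ge0 ?(ltW s1)// mulr_ge0 ?(ltW DT0) ?(ltW t0).
  rewrite !powRM ?(ltW DT0) ?(ltW D0) ?(ltW T0) ?(ltW t0)//.
  have -> : D `^ s = D `^ (s - 1) * D.
    by rewrite mulrC (mulr_powRB1 (ltW D0) s0).
  have -> : t `^ (1 + s) = t `^ (s - 1) * t ^+ 2.
    rewrite -powR_mulrn ?(ltW t0)// -powRD ?(gt_eqF t0) ?implybT//; congr (_ `^ _); ring.
  by rewrite le_eqVlt; apply/orP; left; apply/eqP; ring.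
- rewrite ppowE ?(ltW X0)// (le_trans _ (lerD (ppow_ge0 _ _) (lexx _)))// add0r.
  rewrite -!powRM ?(ltW DT0) ?(ltW D0) ?(ltW T0) ?(ltW t0)//.
  rewrite ge0_ler_powR ?nnegrE ?(ltW X0) ?(ltW s0) ?mulr_ge0 ?(ltW D0) ?(ltW T0) ?(ltW t0)//.
  rewrite -(ler_pM2r T0) XE (_ : D * T * t * T = D * T ^+ 2 * t); last by ring.
  by rewrite gerDr mulr_ge0_le0// subr_le0 ltW.
Qed.

End quadratic_profile.

Section quadratic_ray.
Context {R : realType}.
Local Notation leb := (@lebesgue_measure R).
Variable s : R.
Hypothesis s01 : 0 < s < 1.
Local Notation k := (singular_weight s).
Implicit Types (A B D T e t : R).

(** The powers of [T] cancel: the part below [T] contributes at most [D^s / (1 - s)], the part above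
    [D^s / s]. So the bound depends neither on the root nor on [e]. *)
Lemma integral_affine_gap D T e : 0 < D -> 0 < T -> 0 < e ->
  (\int[leb]_(t in `[e, +oo[) (affine_gap s D T t * k t)%:E <=
   (D `^ s * ((1 - s)^-1 + s^-1))%:E)%E.
Proof.
move=> D0 T0 e0; have /andP[s0 s1] := s01.
have s1' : 0 < 1 - s by rewrite subr_gt0.
(* Lowering the cut-off below [T] only enlarges the integral, and makes [T] a legitimate splitting
   point. *)
pose d := Num.min e (T / 2).
have d0 : 0 < d by rewrite lt_min e0 divr_gt0.
have dT : d < T by rewrite gt_min; apply/orP; right; lra.
have mg : measurable_fun setT
    ((fun t => affine_gap s D T t * k t) : measurableTypeR R -> measurableTypeR R).
  by apply: measurable_funM; [exact: measurable_affine_gap|exact: measurable_powR].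
have g0 t : 0 <= affine_gap s D T t * k t.
  by apply: mulr_ge0; [exact: affine_gap_ge0|exact: singular_weight_ge0].
have mgD (X : set R) : measurable_fun (X : set (measurableTypeR R))
    (EFin \o (fun t => affine_gap s D T t * k t)).
  by apply/measurable_EFinP; exact: measurable_funS mg.
apply: (@le_trans _ _ (\int[leb]_(t in `[d, +oo[) (affine_gap s D T t * k t)%:E)%E).
  apply: ge0_subset_integral; [exact: measurable_itv|exact: measurable_itv|exact: mgD| |].
    by move=> t _; rewrite lee_fin; exact: g0.
  move=> t /=; rewrite !in_itv/= !andbT; apply: le_trans.
  by rewrite ge_min lexx.
rewrite (ge0_integral_itv_split mg (ltW dT)); [|by []|by move=> t _; exact: g0].
have kE p t : 0 < t -> t `^ p * k t = t `^ (p + (- (2 * s) - 1)).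
  by move=> t0; rewrite /singular_weight powRD// (gt_eqF t0) implybT.
have cst_int (X : set (measurableTypeR R)) (c : R) (f : R -> R) : measurable X -> 0 <= c ->
    measurable_fun setT (f : measurableTypeR R -> measurableTypeR R) -> (forall t, 0 <= f t) ->
    (\int[leb]_(t in X) (c * f t)%:E = c%:E * \int[leb]_(t in X) (f t)%:E)%E.
  move=> mX c0 mf f0; rewrite -ge0_integralZl ?lee_fin//.
  - by apply/measurable_EFinP; exact: measurable_funS mf.
  - by move=> t _; rewrite lee_fin.
rewrite mulrDr EFinD; apply: leeD.
- rewrite (eq_integral (fun t : measurableTypeR R => ((D `^ s * T `^ (s - 1)) * t `^ ((1 - s) - 1))%:E)); last first.
    move=> t; rewrite inE/= in_itv/= => /andP[dt tT]; congr (_%:E).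
    have t0 := lt_le_trans d0 dt.
    by rewrite /affine_gap tT -mulrA kE//; congr (_ * _ `^ _); ring.
  rewrite cst_int; last 4 first.
  - exact: measurable_itv.
  - by apply: mulr_ge0; exact: powR_ge0.
  - exact: measurable_powR.
  - by move=> t; exact: powR_ge0.
  rewrite (integral_powR_itvcc d0 dT (lt0r_neq0 s1')) -EFinM lee_fin.
  rewrite -mulrA; apply: ler_wpM2l; first exact: powR_ge0.
  rewrite mulrA; apply: ler_piMl; first by rewrite invr_ge0 ltW.
  rewrite mulrBr -powRD ?(gt_eqF T0) ?implybT//.
  rewrite (_ : s - 1 + (1 - s) = 0); last by ring.
  by rewrite powRr0 gerBl; apply: mulr_ge0; exact: powR_ge0.
- rewrite (eq_integral (fun t : measurableTypeR R => ((D `^ s * T `^ s) * t `^ (- s - 1))%:E)); last first.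
    move=> t; rewrite inE/= in_itv/= andbT => Tt; congr (_%:E).
    have t0 := lt_le_trans T0 Tt.
    have -> : affine_gap s D T t = D `^ s * T `^ s * t `^ s.
      rewrite /affine_gap; case: (leP t T) => // tT.
      have -> : t = T by apply/eqP; rewrite eq_le tT Tt.
      rewrite -!mulrA -!powRD ?(gt_eqF T0) ?implybT//; congr (_ * _ `^ _); ring.
    by rewrite -mulrA kE//; congr (_ * _ `^ _); ring.
  rewrite cst_int; last 4 first.
  - exact: measurable_itv.
  - by apply: mulr_ge0; exact: powR_ge0.
  - exact: measurable_powR.
  - by move=> t; exact: powR_ge0.
  rewrite (integral_powR_itvcy T0 s0) -EFinM lee_fin.
  rewrite [leLHS](_ : _ = D `^ s * (T `^ s * T `^ (- s)) / s); last by rewrite !mulrA.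
  rewrite -powRD ?(gt_eqF T0) ?implybT// subrr powRr0 mulr1.
  exact: lexx.
Qed.

(** The two half-lines have slopes [B] and [- B], hence their own roots [T1] and [T2] and the factor
    2. That [A] is absent from the error keeps the estimate uniform up to the edge of the ball. *)
Lemma quadratic_subsolution A B D e : 0 < A -> 0 < D -> 0 < e -> e * `|B| <= A / 2 ->
  (\int[leb]_(t in `[e, +oo[) (2 * A `^ s * k t)%:E <=
   \int[leb]_(t in `[e, +oo[)
     ((ppow s (A + B * t - D * t ^+ 2) + ppow s (A - B * t - D * t ^+ 2)) * k t)%:E +
   (2 * (D `^ s * ((1 - s)^-1 + s^-1)))%:E)%E.
Proof.
move=> A0 D0 e0 eB.
(* The positive root of [D T^2 - B' T - A]; it exists for either sign of [B'] because [A] and [D]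
   are positive. *)
have root B' : exists2 T, 0 < T & A + B' * T = D * T ^+ 2.
  have d0 : 0 < B' ^+ 2 + 4 * A * D.
    by rewrite ltr_wpDl ?sqr_ge0//; apply: mulr_gt0 => //; apply: mulr_gt0.
  have qE := sqr_sqrtr (ltW d0); set q := Num.sqrt _ in qE.
  have qB : `|B'| < q.
    rewrite -(ltr_pXn2r (ltn0Sn 1)) ?nnegrE ?sqrtr_ge0// qE real_normK ?num_real//.
    by rewrite ltrDl; apply: mulr_gt0 => //; apply: mulr_gt0.
  have Bq : 0 < B' + q by move: qB; rewrite ltr_norml => /andP[]; lra.
  exists ((B' + q) / (2 * D)); first by rewrite divr_gt0// mulr_gt0.
  have -> : D * ((B' + q) / (2 * D)) ^+ 2 = (B' ^+ 2 + 2 * B' * q + q ^+ 2) / (4 * D).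
    by field; rewrite gt_eqF.
  by rewrite qE; field; rewrite gt_eqF.
have [T1 T10 E1] := root B.
have [T2 T20 E2] := root (- B).
apply: (le_trans (line_subsolution s01 A0 e0 eB)).
have et t : `[e, +oo[%classic t -> 0 < t.
  by rewrite /= in_itv/= andbT; exact: lt_le_trans.
pose g1 t := (ppow s (A + B * t - D * t ^+ 2) + ppow s (A - B * t - D * t ^+ 2)) * k t.
pose g2 t := affine_gap s D T1 t * k t.
pose g3 t := affine_gap s D T2 t * k t.
have mprof C : measurable_fun setT
    ((fun t => ppow s (A + C * t - D * t ^+ 2)) : measurableTypeR R -> measurableTypeR R).
  exact: measurable_quadratic_profile.
have mprof' C : measurable_fun setT
    ((fun t => ppow s (A + C * t)) : measurableTypeR R -> measurableTypeR R).
  exact: measurable_affine_profile.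
have NE : (fun t => ppow s (A - B * t - D * t ^+ 2)) = (fun t => ppow s (A + (- B) * t - D * t ^+ 2)).
  by apply/funext => t; rewrite mulNr.
have NE' : (fun t => ppow s (A - B * t)) = (fun t => ppow s (A + (- B) * t)).
  by apply/funext => t; rewrite mulNr.
have mE (X : set R) (f : R -> R) : measurable_fun setT (f : measurableTypeR R -> measurableTypeR R) ->
    measurable_fun (X : set (measurableTypeR R)) (EFin \o f).
  by move=> mf; apply/measurable_EFinP; exact: measurable_funS mf.
have m1 : measurable_fun setT (g1 : measurableTypeR R -> measurableTypeR R).
  apply: measurable_funM; last exact: measurable_powR.
  by apply: measurable_funD; rewrite ?NE; exact: mprof.
have m2 : measurable_fun setT (g2 : measurableTypeR R -> measurableTypeR R).
  by apply: measurable_funM; [exact: measurable_affine_gap|exact: measurable_powR].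
have m3 : measurable_fun setT (g3 : measurableTypeR R -> measurableTypeR R).
  by apply: measurable_funM; [exact: measurable_affine_gap|exact: measurable_powR].
have g10 t : 0 <= g1 t.
  by apply: mulr_ge0; [apply: addr_ge0; exact: ppow_ge0|exact: singular_weight_ge0].
have g20 t : 0 <= g2 t.
  by apply: mulr_ge0; [exact: affine_gap_ge0|exact: singular_weight_ge0].
have g30 t : 0 <= g3 t.
  by apply: mulr_ge0; [exact: affine_gap_ge0|exact: singular_weight_ge0].
apply: (@le_trans _ _ (\int[leb]_(t in `[e, +oo[) ((g1 t)%:E + ((g2 t)%:E + (g3 t)%:E)))%E).
  apply: ge0_le_integral.
  - exact: measurable_itv.
  - move=> t _; rewrite lee_fin; apply: mulr_ge0; last exact: powR_ge0.
    by apply: addr_ge0; exact: ppow_ge0.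
  - apply: mE; apply: measurable_funM; last exact: measurable_powR.
    by apply: measurable_funD; rewrite ?NE'; exact: mprof'.
  - apply: emeasurable_funD; first exact: mE.
    by apply: emeasurable_funD; exact: mE.
  - move=> t /et t0; rewrite -!EFinD lee_fin /g1 /g2 /g3 -!mulrDl.
    apply: ler_wpM2r; first exact: singular_weight_ge0.
    have h1 := ppow_le_gap s01 (ltW A0) D0 T10 E1 t0.
    have h2 := ppow_le_gap s01 (ltW A0) D0 T20 E2 t0.
    rewrite !mulNr in h2.
    by apply: (le_trans (lerD h1 h2)); rewrite addrACA.
have h1 := integral_affine_gap D0 T10 e0.
have h2 := integral_affine_gap D0 T20 e0.
rewrite ge0_integralD; last 5 first.
- exact: measurable_itv.
- by move=> t _; rewrite lee_fin; exact: g10.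
- exact: mE.
- by move=> t _; apply: adde_ge0; rewrite lee_fin; [exact: g20|exact: g30].
- by apply: emeasurable_funD; exact: mE.
apply: leeD2l; rewrite ge0_integralD; last 5 first.
- exact: measurable_itv.
- by move=> t _; rewrite lee_fin; exact: g20.
- exact: mE.
- by move=> t _; rewrite lee_fin; exact: g30.
- exact: mE.
apply: (le_trans (leeD h1 h2)).
by rewrite -EFinD mulr_natl mulr2n.
Qed.

End quadratic_ray.

(** * Anisotropic kernels *)

Section borel_kernel.
Context {R : realType} {n : nat}.
Hypothesis n_gt0 : (0 < n)%N.
Implicit Types (x y z : 'rV[R]_n) (F : set 'rV[R]_n).

Lemma measurable_direction : measurable_fun setT (@direction R n).
Proof.
apply/measurable_fun_rVP => i.
rewrite (_ : _ \o _ = fun y => enorm y `^ (-1) * rV_coord i y); last first.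
  by apply/funext => y; rewrite /rV_coord /direction /= mxE powR_inv1// enorm_ge0.
apply: measurable_funM; last exact: measurable_rV_coord.
by apply: (measurableT_comp (measurable_powR _)); exact: measurable_enorm.
Qed.

Lemma measurable_opp_rV : measurable_fun setT (fun x : 'rV[R]_n => - x).
Proof.
apply/measurable_fun_rVP => i.
rewrite (_ : _ \o _ = fun x => - rV_coord i x); last first.
  by apply/funext => y; rewrite /rV_coord /= mxE.
by apply: measurableT_comp => //; exact: measurable_rV_coord.
Qed.

Lemma measurable_sphere : measurable (@sphere R n).
Proof.
rewrite (_ : sphere = setT `&` enorm @^-1` [set 1]); last by rewrite setTI.
exact: measurable_enorm.
Qed.

Lemma measurable_preimageT (f : 'rV[R]_n -> 'rV[R]_n) F :
  measurable_fun setT f -> measurable F -> measurable (f @^-1` F).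
Proof. by move=> mf mF; rewrite -[X in measurable X]setTI; exact: mf. Qed.

Lemma lebesgue_rV_preimage_scale (l : R) F : l != 0 -> measurable F ->
  lebesgue_rV n ((fun y => l *: y) @^-1` F) = 0%E -> lebesgue_rV n F = 0%E.
Proof.
move=> l0 mF F0.
have ms : measurable_fun setT (fun y : 'rV[R]_n => l *: y).
  have := @measurable_affine_rV R n l 0.
  by rewrite (_ : (fun y => _) = (fun y => l *: y))//; apply/funext => y; rewrite addr0.
rewrite -[F]setIT -integral_indic// (ge0_integral_affine_rV (l := l) 0)//.
- rewrite (eq_integral (fun y => (\1_((fun y => l *: y) @^-1` F) y)%:E)).
    rewrite integral_indic//; last exact: measurable_preimageT.
    rewrite setIT -[RHS](mule0 (`|l| ^+ n)%:E); congr (_ * _)%E; exact: F0.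
  by move=> y _; rewrite addr0 /indic; congr (_%:R%:E).
- by apply/measurable_EFinP; exact: measurable_indic.
Qed.

(** [surface_measure] sees only the part of the cone in the unit ball; dilations by [2^k] carry the
    negligibility to the whole cone. *)
Lemma lebesgue_rV_cone F : measurable F -> F `<=` sphere -> surface_measure F = 0%E ->
  lebesgue_rV n (@direction R n @^-1` F) = 0%E.
Proof.
move=> mF Fs F0; set C := _ @^-1` F.
have mC : measurable C by apply: measurable_preimageT => //; exact: measurable_direction.
have C0 y : C y -> y != 0.
  move=> /Fs sy; apply/eqP => y0; move: sy; rewrite y0.
  by rewrite /sphere/= /direction scaler0 enorm0 => /eqP; rewrite eq_sym oner_eq0.
pose Ck (k : nat) := C `&` [set y | enorm y <= 2 ^+ k].
have mCk k : measurable (Ck k).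
  apply: measurableI => //.
  rewrite (_ : [set y | _] = setT `&` enorm @^-1` `]-oo, 2 ^+ k]); last first.
    by rewrite setTI; apply/seteqP; split => y /=; rewrite in_itv.
  by apply: measurable_enorm => //; exact: measurable_itv.
have Ck0 k : lebesgue_rV n (Ck k) = 0%E.
  have k0 : 0 < 2 ^+ k :> R by rewrite exprn_gt0.
  apply: (lebesgue_rV_preimage_scale (lt0r_neq0 k0) (mCk k)).
  rewrite (_ : _ @^-1` _ = [set y | (0 < enorm y <= 1)%R /\ F (direction y)]).
    move: F0; rewrite /surface_measure => /eqP; rewrite mule_eq0 => /orP[|/eqP//].
    by rewrite eqe pnatr_eq0 eqn0Ngt n_gt0.
  apply/seteqP; split => y; rewrite /Ck /C/= directionZ// enormZ gtr0_norm//.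
    move=> [Fy y1]; split=> //; rewrite enorm_gt0.
    rewrite (C0 y Fy)/=; move: y1; rewrite -{2}(mulr1 (2 ^+ k)) ler_pM2l//.
  by move=> [/andP[_ y1] Fy]; split=> //; rewrite ler_piMr// ltW.
have -> : C = \bigcup_k Ck k.
  apply/seteqP; split => [y Cy|y [k _ []]//].
  have [k yk] : exists k : nat, enorm y <= 2 ^+ k.
    exists (Num.truncn (enorm y)).+1; apply: (@le_trans _ _ (Num.truncn (enorm y)).+1%:R).
      by apply: ltW; exact: truncnS_gt.
    by rewrite -natrX ler_nat; apply: ltnW; exact: ltn_expl.
  by exists k.
apply/eqP; rewrite eq_le measure_ge0 andbT.
apply: (le_trans (measure_sigma_subadditive _ mCk (bigcup_measurable (fun k _ => mCk k)) _)) => //.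
by rewrite eseries0// => k _ _; exact: Ck0.
Qed.

(** Replaces [a] by a Borel function for which bounds, evenness and homogeneity hold at every point,
    at the price of a null set of [y]. *)
Lemma borel_kernel (a : 'rV[R]_n -> R) (lam Lam : R) : Linfty_sphere a ->
  (forall theta, sphere theta -> a theta = a (- theta)) ->
  lam <= Lam -> (forall theta, sphere theta -> lam <= a theta <= Lam) ->
  exists k : 'rV[R]_n -> R,
    [/\ measurable_fun setT (k : 'rV[R]_n -> measurableTypeR R),
        (forall y, lam <= k y <= Lam), (forall y, k (- y) = k y),
        (forall l y, 0 < l -> k (l *: y) = k y) &
        exists2 N, measurable N /\ lebesgue_rV n N = 0%E &
          forall y, y != 0 -> ~ N y -> a (direction y) = k y].
Proof.
move=> [[b [mb [F [mF Fs NF F0]]]] _] ae lL al.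
(* Clamping restores the bounds where the Borel representative [b] violates them, and changes
   nothing where it agrees with [a]. *)
pose c y := Num.max lam (Num.min Lam ((b \_ sphere) (direction y))).
have cb y : lam <= c y <= Lam by rewrite le_max lexx/= ge_max lL ge_min lexx.
have mc : measurable_fun setT (c : 'rV[R]_n -> measurableTypeR R).
  apply: measurable_maxr => //; apply: measurable_minr => //.
  apply: (@measurableT_comp _ _ _ _ _ _ (b \_ sphere)); last exact: measurable_direction.
  exact ((measurable_restrictT b measurable_sphere).1 mb).
exists (fun y => (c y + c (- y)) / 2); split.
- apply: measurable_funM => //; apply: measurable_funD => //.
  by apply: (measurableT_comp mc); exact: measurable_opp_rV.
- by move=> y; have := cb y; have := cb (- y); lra.
- by move=> y; rewrite opprK addrC.
- by move=> l y l0; rewrite /c -scalerN !directionZ.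
pose C := @direction R n @^-1` F.
have mC : measurable C by apply: measurable_preimageT => //; exact: measurable_direction.
have mNC : measurable ((fun x => - x) @^-1` C).
  by apply: measurable_preimageT => //; exact: measurable_opp_rV.
have C0 : lebesgue_rV n C = 0%E by exact: lebesgue_rV_cone.
have NC0 : lebesgue_rV n ((fun x => - x) @^-1` C) = 0%E.
  apply: (@lebesgue_rV_preimage_scale (-1)) => //.
  rewrite -[RHS]C0; congr (lebesgue_rV n _); apply/seteqP.
  by split=> y /=; rewrite scaleN1r opprK.
(* The average of [c y] and [c (- y)] equals [a] only when both directions avoid the exceptional
   set. *)
exists (C `|` ((fun x => - x) @^-1` C)).
  split; first exact: measurableU.
  apply/eqP; rewrite eq_le measure_ge0 andbT.
  apply: (le_trans (measureU2 _ mC mNC)).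
  by rewrite -[leRHS]adde0; apply: leeD; rewrite le_eqVlt; apply/orP; left; apply/eqP; [exact: C0|exact: NC0].
move=> y y0 /not_orP[Cy NCy].
have sy : sphere (direction y) by exact: direction_enorm.
have sNy : sphere (direction (- y)) by apply: direction_enorm; rewrite oppr_eq0.
have cE z : sphere (direction z) -> ~ C z -> c z = a (direction z).
  move=> sz Cz; rewrite /c patchE (mem_set sz).
  have -> : b (direction z) = a (direction z).
    by apply: esym; apply: contrapT => ab; apply: Cz; apply: NF.
  by have /andP[la aL] := al _ sz; rewrite (min_r aL) (max_r la).
by rewrite !cE// directionN -ae//; lra.
Qed.

End borel_kernel.

Section riesz_kernel.
Context {R : realType} {n : nat}.
Local Notation leb := (@lebesgue_measure R).
Implicit Types (x y z c : 'rV[R]_n) (s e t r : R).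

Definition riesz s y : R := enorm y `^ (- (n%:R + 2 * s)).

(** A reference density: its integral along the ray through [z], with polar factor, is
    [|z|^(-n) ln 2]. A bound [C |z|^(-n)] on every ray thus becomes a multiple of its finite
    integral. *)
Definition shell_density y : R :=
  if (1 <= enorm y) && (enorm y < 2) then enorm y `^ (- n%:R) else 0.

Lemma riesz_ge0 s y : 0 <= riesz s y. Proof. exact: powR_ge0. Qed.

Lemma shell_density_ge0 y : 0 <= shell_density y.
Proof. by rewrite /shell_density; case: ifP => // _; exact: powR_ge0. Qed.

Lemma measurable_enorm_powR p : measurable_fun setT
  ((fun y => enorm y `^ p) : 'rV[R]_n -> measurableTypeR R).
Proof. by apply: (measurableT_comp (measurable_powR _)); exact: measurable_enorm. Qed.

Lemma measurable_riesz s : measurable_fun setT (riesz s : 'rV[R]_n -> measurableTypeR R).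
Proof. exact: measurable_enorm_powR. Qed.

Lemma measurable_shell_density :
  measurable_fun setT (shell_density : 'rV[R]_n -> measurableTypeR R).
Proof.
apply: measurable_fun_ifT => //; last exact: measurable_enorm_powR.
apply: measurable_and; first by apply: measurable_fun_ler => //; exact: measurable_enorm.
by apply: measurable_fun_ltr => //; exact: measurable_enorm.
Qed.

Lemma measurable_eball x r : measurable (eball x r).
Proof. by apply: measurable_open_rV; exact: open_eball. Qed.

Lemma setC_eball0 e : ~` eball (0 : 'rV[R]_n) e = [set y | e <= enorm y].
Proof.
by apply/seteqP; split => y; rewrite /eball/= subr0; [move/negP; rewrite -leNgt|move=> ey; apply/negP; rewrite -leNgt].
Qed.

Lemma measurable_setC_eball e : measurable (~` eball (0 : 'rV[R]_n) e).
Proof. by apply: measurableC; exact: measurable_eball. Qed.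

Lemma measurable_scale_line z : measurable_fun setT
  (fun t : measurableTypeR R => t *: z).
Proof. exact: (measurableT_comp (@measurable_scale_rV R n) (measurable_pair2 z)). Qed.

Hypothesis n_gt0 : (0 < n)%N.

Lemma riesz_ray s t z : 0 < t -> z != 0 ->
  riesz s (t *: z) * t ^+ n.-1 = riesz s z * singular_weight s t.
Proof.
move=> t0 z0; rewrite /riesz enormZ gtr0_norm// powRM ?(ltW t0) ?enorm_ge0//.
rewrite mulrAC mulrC; congr (_ * _).
rewrite -powR_mulrn ?(ltW t0)// -powRD ?(gt_eqF t0) ?implybT//; congr (_ `^ _).
by rewrite -[in n%:R](prednK n_gt0) -natr1; ring.
Qed.

Lemma shell_density_ray z : z != 0 ->
  ((enorm z `^ (- n%:R) / 2)%:E <=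
  \int[leb]_(t in `]0%R, +oo[) ((shell_density (t *: z))%:E * (t ^+ n.-1)%:E))%E.
Proof.
rewrite -enorm_gt0 => z0.
set N := enorm z in z0 *.
pose F (t : measurableTypeR R) : \bar R := ((shell_density (t *: z))%:E * (t ^+ n.-1)%:E)%E.
have F0 (t : R) : 0 < t -> (0 <= F t)%E.
  move=> t0; apply: mule_ge0; rewrite lee_fin; first exact: shell_density_ge0.
  by apply: exprn_ge0; exact: ltW.
have mF : measurable_fun setT F.
  apply: emeasurable_funM; apply/measurable_EFinP.
    by apply: (measurableT_comp measurable_shell_density); exact: measurable_scale_line.
  exact: measurable_funX.
have ab : N^-1 < 2 * N^-1 by rewrite ltr_pMl ?invr_gt0// ltr1n.
(* On [[1/N, 2/N[] the integrand is [N^(-n) / t], at least [N^(-n) N / 2], and the interval has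
   length [1/N]. *)
apply: (@le_trans _ _ (\int[leb]_(t in `[(N^-1)%R, (2 * N^-1)%R[) (N `^ (- n%:R) * (N / 2))%:E)%E).
  rewrite integral_cst//= lebesgue_measure_itv/= lte_fin ab -EFinB -EFinM lee_fin.
  rewrite le_eqVlt; apply/orP; left; apply/eqP.
  by field; rewrite gt_eqF.
apply: (@le_trans _ _ (\int[leb]_(t in `[(N^-1)%R, (2 * N^-1)%R[) F t)%E); last first.
  apply: ge0_subset_integral.
  - exact: measurable_itv.
  - exact: measurable_itv.
  - exact: measurable_funS mF.
  - by move=> t /=; rewrite in_itv/= andbT; exact: F0.
  - move=> t /=; rewrite !in_itv/= andbT => /andP[+ _]; apply: lt_le_trans.
    by rewrite invr_gt0.
apply: ge0_le_integral.
- exact: measurable_itv.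
- move=> t _; rewrite lee_fin; apply: mulr_ge0; first exact: powR_ge0.
  by rewrite divr_ge0// ltW.
- exact: measurable_cst.
- exact: measurable_funS mF.
- move=> t /=; rewrite in_itv/= => /andP[t1 t2].
  have t0 : 0 < t by apply: lt_le_trans t1; rewrite invr_gt0.
  rewrite /F -EFinM lee_fin /shell_density enormZ (gtr0_norm t0) -/N ifT; last first.
    by rewrite -ler_pdivrMr// div1r t1/= -ltr_pdivlMr.
  rewrite powRM ?(ltW t0) ?(ltW z0)// [leRHS](_ : _ = N `^ (- n%:R) * (t `^ (- n%:R) * t ^+ n.-1)); last by rewrite mulrAC mulrC.
  apply: ler_wpM2l; first exact: powR_ge0.
  rewrite -powR_mulrn ?(ltW t0)// -powRD ?(gt_eqF t0) ?implybT//.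
  rewrite (_ : - n%:R + n.-1%:R = -1); last by rewrite -[in n%:R](prednK n_gt0) -natr1; ring.
  have tN : t * N < 2 by rewrite -ltr_pdivlMr.
  rewrite powR_inv1 ?(ltW t0)// -[leRHS]div1r ler_pdivlMr//; lra.
Qed.

Lemma integral_shell_density_lty :
  (\int[lebesgue_rV n]_y (shell_density y)%:E < +oo)%E.
Proof.
set Q := [set y : 'rV[R]_n | forall i, `](0 : 'rV[R]_n) ord0 i - 2, (0 : 'rV[R]_n) ord0 i + 2[%classic (y ord0 i)].
have mQ : measurable Q by exact: measurable_cube.
have vQ : lebesgue_rV n Q = ((2 *+ 2) ^+ n)%:E by exact: lebesgue_rV_cube.
apply: (@le_lt_trans _ _ (\int[lebesgue_rV n]_y (\1_Q y)%:E)%E); last first.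
  have -> : (\int[lebesgue_rV n]_y (\1_Q y)%:E = ((2 *+ 2) ^+ n)%:E)%E.
    by rewrite integral_indic// setIT; exact: vQ.
  exact: ltry.
apply: ge0_le_integral.
- exact: measurableT.
- by move=> y _; rewrite lee_fin; exact: shell_density_ge0.
- by apply/measurable_EFinP; exact: measurable_shell_density.
- by apply/measurable_EFinP; exact: measurable_indic.
move=> y _; rewrite lee_fin /shell_density; case: ifP => [/andP[y1 y2]|_]; last first.
  by rewrite indicE.
rewrite indicE mem_set.
  rewrite -[X in _ <= X](powRr0 (enorm y)); by apply: ler_powR => //; rewrite oppr_le0.
move=> i /=; rewrite mxE in_itv/= sub0r add0r -ltr_norml.
by apply: le_lt_trans y2; exact: enorm_coord.
Qed.

Lemma truncated_ray (F : 'rV[R]_n -> R) e z : 0 < e -> z != 0 ->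
  (\int[leb]_(t in `]0%R, +oo[)
     ((if e <= enorm (t *: z) then F (t *: z) else 0)%:E * (t ^+ n.-1)%:E) =
   \int[leb]_(t in `[(e / enorm z)%R, +oo[) (F (t *: z) * t ^+ n.-1)%:E)%E.
Proof.
rewrite -enorm_gt0 => e0 z0.
rewrite integral_mkcond [RHS]integral_mkcond; apply: eq_integral => t _.
rewrite !patchE !mem_setE !in_itv/= !andbT enormZ.
have [t0|t0] := ltP 0 t.
  rewrite gtr0_norm// -ler_pdivrMr//.
  by case: ifP => _; rewrite ?mul0e// EFinM.
rewrite ifF//; apply/negbTE; rewrite -ltNge; apply: le_lt_trans t0 _.
by rewrite divr_gt0.
Qed.

Lemma integral_riesz_tail s e : 0 < s -> 0 < e ->
  (\int[lebesgue_rV n]_(y in ~` eball 0 e) (riesz s y)%:E < +oo)%E.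
Proof.
move=> s0 e0; have s20 : 0 < 2 * s by rewrite mulr_gt0.
(* The tail along the ray through [z] is [e^(-2s) / (2s) |z|^(-n)]; the last factor 2 offsets the
   [1/2] of [shell_density_ray]. *)
pose K := e `^ (- (2 * s)) / (2 * s) * 2.
have K0 : 0 <= K by rewrite mulr_ge0// divr_ge0 ?powR_ge0// ltW.
apply: (@le_lt_trans _ _ (\int[lebesgue_rV n]_y (K * shell_density y)%:E)%E); last first.
  under eq_integral do rewrite EFinM.
  rewrite ge0_integralZl.
  - by apply: lte_mul_pinfty; [rewrite lee_fin| |exact: integral_shell_density_lty].
  - exact: measurableT.
  - by apply/measurable_EFinP; exact: measurable_shell_density.
  - by move=> y _; rewrite lee_fin; exact: shell_density_ge0.
  - by rewrite lee_fin.
rewrite integral_mkcond.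
have -> : ((fun y => (riesz s y)%:E) \_ (~` eball 0 e)) =
    (fun y => (if e <= enorm y then riesz s y else 0)%:E).
  apply/funext => y; rewrite patchE setC_eball0.
  by case: ifPn; [rewrite inE/= => ->|rewrite notin_setE/= => /negP/negbTE ->].
apply: (ge0_le_integral_rays n_gt0).
- apply/measurable_EFinP; apply: measurable_fun_ifT => //; last exact: measurable_riesz.
  by apply: measurable_fun_ler => //; exact: measurable_enorm.
- by apply/measurable_EFinP; apply: measurable_funM => //; exact: measurable_shell_density.
- by move=> y; rewrite lee_fin; case: ifP => // _; exact: riesz_ge0.
- by move=> y; rewrite lee_fin; apply: mulr_ge0 => //; exact: shell_density_ge0.
move=> z z0; rewrite (truncated_ray _ e0 z0).
have N0 : 0 < enorm z by rewrite enorm_gt0.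
have eN : 0 < e / enorm z by rewrite divr_gt0.
rewrite (eq_integral (fun t : measurableTypeR R => ((riesz s z)%:E * (t `^ (- (2 * s) - 1))%:E)%E)); last first.
  move=> t; rewrite inE/= in_itv/= andbT => et.
  by rewrite riesz_ray ?EFinM//; exact: lt_le_trans et.
rewrite ge0_integralZl; last 4 first.
- exact: measurable_itv.
- by apply/measurable_EFinP; apply: measurable_funS (measurable_powR _).
- by move=> t _; rewrite lee_fin; exact: powR_ge0.
- by rewrite lee_fin; exact: riesz_ge0.
rewrite (integral_powR_itvcy eN s20).
under [leRHS]eq_integral do rewrite EFinM -muleA.
rewrite ge0_integralZl; last 4 first.
- exact: measurable_itv.
- apply: emeasurable_funM; apply/measurable_EFinP.
    apply: (@measurable_funS _ _ _ _ setT) => //.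
    by apply: (measurableT_comp measurable_shell_density); exact: measurable_scale_line.
  by apply: (@measurable_funS _ _ _ _ setT) => //; exact: measurable_funX.
- move=> t /=; rewrite in_itv/= andbT => t0; apply: mule_ge0; rewrite lee_fin.
    exact: shell_density_ge0.
  by apply: exprn_ge0; exact: ltW.
- by rewrite lee_fin.
apply: (@le_trans _ _ (K%:E * (enorm z `^ (- n%:R) / 2)%:E)%E); last first.
  by apply: lee_wpmul2l; [rewrite lee_fin|exact: shell_density_ray].
rewrite -!EFinM lee_fin /K /riesz powRM ?invr_ge0 ?(ltW e0) ?(ltW N0)//.
rewrite -[(enorm z)^-1]powR_inv1 ?(ltW N0)// -powRrM mulN1r opprK.
have -> : enorm z `^ (- n%:R) = enorm z `^ (- (n%:R + 2 * s)) * enorm z `^ (2 * s).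
  by rewrite -powRD ?(gt_eqF N0) ?implybT//; congr (_ `^ _); ring.
rewrite le_eqVlt; apply/orP; left; apply/eqP.
by field; rewrite gt_eqF.
Qed.

End riesz_kernel.

(** * The barrier of a ball *)

Section ball_barrier.
Context {R : realType} {n : nat}.
Local Notation leb := (@lebesgue_measure R).
Implicit Types (x y z c : 'rV[R]_n) (e t r : R).

Lemma continuous_ppow (s : R) : 0 < s -> continuous (ppow s).
Proof.
move=> s0 x; have [x0|x0|->] := ltgtP x 0.
- rewrite /continuous_at (ppow_eq0 (lt0r_neq0 s0) (ltW x0)).
  apply: cvg_near_cst; near=> y; apply: ppow_eq0; first exact: lt0r_neq0.
  by apply: ltW; near: y; exact: lt_nbhsl.
- have h : y `^ s @[y --> x] --> x `^ s := @continuous_powR R s x x0.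
  rewrite /continuous_at (ppowE s (ltW x0)).
  apply: cvg_trans h; apply: near_eq_cvg; near=> y.
  by rewrite ppowE//; apply: ltW; near: y; exact: lt_nbhsr.
- rewrite /continuous_at (ppow_eq0 (lt0r_neq0 s0) (lexx 0)).
  apply/cvgr0Pnorm_lt => d d0.
  have d1 : 0 < d `^ s^-1 by exact: powR_gt0.
  near=> y; rewrite ger0_norm ?ppow_ge0//.
  have [y0|y0] := leP y 0; first by rewrite ppow_eq0// lt0r_neq0.
  rewrite ppowE ?(ltW y0)//.
  have -> : d = (d `^ s^-1) `^ s.
    by rewrite -powRrM mulVf ?lt0r_neq0// powRr1// ltW.
  apply: gt0_ltr_powR; rewrite ?nnegrE ?(ltW y0) ?(ltW d1)//.
  by near: y; exact: lt_nbhsl.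
Unshelve. all: by end_near. Qed.

Definition ball_profile (s : R) c r x : R := ppow s (r ^+ 2 - edot (x - c) (x - c)).

Lemma ball_profile_ge0 s c r x : 0 <= ball_profile s c r x.
Proof. exact: ppow_ge0. Qed.

Lemma continuous_ball_profile s c r : 0 < s -> continuous (ball_profile s c r).
Proof.
move=> s0 x.
have h : enorm (y - c) @[y --> x] --> enorm (x - c).
  apply: (@continuous_comp _ _ _ (fun y => y - c) (@enorm R n)).
    by apply: continuousB; [exact: cvg_id|exact: cst_continuous].
  exact: continuous_enorm.
have E : (fun x => r ^+ 2 - edot (x - c) (x - c)) =
    (fun x => r ^+ 2 - enorm (x - c) * enorm (x - c)).
  by apply/funext => y; rewrite -enorm_sqr expr2.
apply: (@continuous_comp _ _ _ (fun x => r ^+ 2 - edot (x - c) (x - c)) (ppow s)).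
  by rewrite E; apply: continuousB; [exact: cst_continuous|exact: continuousM].
exact: continuous_ppow.
Qed.

Lemma ball_profile_eball c r x : eball c r x ->
  0 < r ^+ 2 - edot (x - c) (x - c).
Proof.
move=> xc; rewrite subr_gt0 -enorm_sqr ltr_pXn2r ?nnegrE ?enorm_ge0//.
by apply: ltW; exact: le_lt_trans (enorm_ge0 _) xc.
Qed.

Lemma ball_profile_eq0 s c r x : 0 < s -> 0 <= r -> r <= enorm (x - c) ->
  ball_profile s c r x = 0.
Proof.
move=> s0 r0 rx; rewrite /ball_profile ppow_eq0 ?lt0r_neq0//.
by rewrite subr_le0 -enorm_sqr ler_pXn2r ?nnegrE ?enorm_ge0.
Qed.

Lemma ball_profile_line s c r x z t :
  ball_profile s c r (x + t *: z) = ppow s ((r ^+ 2 - edot (x - c) (x - c)) +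
    (- 2 * edot (x - c) z) * t - edot z z * t ^+ 2).
Proof.
rewrite /ball_profile (_ : x + t *: z - c = (x - c) + t *: z); last by rewrite addrAC.
move: (x - c) => w.
by rewrite edotDl !edotDr !edotZl !edotZr (edotC z w); congr ppow; ring.
Qed.

Lemma truncated_integral (F : 'rV[R]_n -> R) e :
  (\int[lebesgue_rV n]_(y in ~` eball 0%R e) (F y)%:E =
   \int[lebesgue_rV n]_y (if e <= enorm y then F y else 0)%:E)%E.
Proof.
rewrite integral_mkcond; apply: eq_integral => y _; rewrite patchE setC_eball0.
by case: ifPn; [rewrite inE/= => ->|rewrite notin_setE/= => /negP/negbTE ->].
Qed.

Lemma measurable_truncated (F : 'rV[R]_n -> R) e :
  measurable_fun setT (F : 'rV[R]_n -> measurableTypeR R) ->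
  measurable_fun setT (fun y => (if e <= enorm y then F y else 0)%:E).
Proof.
move=> mF; apply/measurable_EFinP; apply: measurable_fun_ifT => //.
by apply: measurable_fun_ler => //; exact: measurable_enorm.
Qed.

Hypothesis n_gt0 : (0 < n)%N.
Variables (s : R) (k : 'rV[R]_n -> R) (Lam : R).
Hypothesis s01 : 0 < s < 1.
Hypothesis mk : measurable_fun setT (k : 'rV[R]_n -> measurableTypeR R).
Hypothesis kb : forall y, 0 <= k y <= Lam.
Hypothesis k_even : forall y, k (- y) = k y.
Hypothesis k_hom : forall l y, 0 < l -> k (l *: y) = k y.

Let s0 : 0 < s. Proof. by case/andP: s01. Qed.

Definition anisotropic_kernel y := k y * riesz s y.
Local Notation K := anisotropic_kernel.

Lemma anisotropic_kernel_ge0 y : 0 <= K y.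
Proof. by apply: mulr_ge0; [case/andP: (kb y)|exact: riesz_ge0]. Qed.

Lemma measurable_anisotropic_kernel :
  measurable_fun setT (K : 'rV[R]_n -> measurableTypeR R).
Proof. by apply: measurable_funM; [exact: mk|exact: measurable_riesz]. Qed.

Lemma truncated_integral_opp (F : 'rV[R]_n -> R) e :
  measurable_fun setT (F : 'rV[R]_n -> measurableTypeR R) -> (forall y, 0 <= F y) ->
  (\int[lebesgue_rV n]_y (if e <= enorm y then F (- y) else 0)%:E =
   \int[lebesgue_rV n]_y (if e <= enorm y then F y else 0)%:E)%E.
Proof.
move=> mF F0; have N1 : (-1 : R) != 0 by rewrite oppr_eq0 oner_eq0.
rewrite [RHS](ge0_integral_affine_rV 0 N1).
- rewrite normrN1 expr1n mul1e; apply: eq_integral => y _.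
  by rewrite addr0 scaleN1r enormN.
- exact: measurable_truncated.
- by move=> y; rewrite lee_fin; case: ifP.
Qed.

Let cs := (1 - s)^-1 + s^-1.

Let cs0 : 0 <= cs.
Proof. by case/andP: s01 => s_gt0 s_lt1; rewrite addr_ge0// invr_ge0 ?subr_ge0 ltW. Qed.

Let Lam0 : 0 <= Lam.
Proof. by case/andP: (kb 0) => h /(le_trans h). Qed.

(** Here [A = r^2 - |x - c|^2], [B = - 2 (x - c).z] and [D = |z|^2] in [quadratic_subsolution]. The
    error [K z D^s] is at most [Lam |z|^(-n)], the form that [shell_density] can absorb. *)
Lemma ball_profile_ray c r x e z : eball c r x -> 0 < e ->
  4 * e * r <= r ^+ 2 - edot (x - c) (x - c) -> z != 0 ->
  (\int[leb]_(t in `[(e / enorm z)%R, +oo[)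
     (2 * ball_profile s c r x * K (t *: z) * t ^+ n.-1)%:E <=
   \int[leb]_(t in `[(e / enorm z)%R, +oo[)
     ((ball_profile s c r (x + t *: z) + ball_profile s c r (x - t *: z)) *
      K (t *: z) * t ^+ n.-1)%:E +
   (4 * Lam * cs)%:E * (enorm z `^ (- n%:R) / 2)%:E)%E.
Proof.
move=> xc e0; set A := _ - edot _ _ => eA z0.
have A0 : 0 < A by exact: ball_profile_eball.
have N0 : 0 < enorm z by rewrite enorm_gt0.
have en0 : 0 < e / enorm z by rewrite divr_gt0.
pose B := - 2 * edot (x - c) z; pose D := edot z z.
have DE : D = enorm z ^+ 2 by rewrite enorm_sqr.
have D0 : 0 < D by rewrite DE exprn_gt0.
(* As [|B| <= 2 r |z|], the left side is at most [2 e r]; this is the origin of the factor 4 in the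
   condition on [e]. *)
have eB : e / enorm z * `|B| <= A / 2.
  have Bn : `|B| <= 2 * (r * enorm z).
    rewrite /B mulNr normrN normrM ger0_norm// ler_pM2l//.
    have h : `|edot (x - c) z| <= enorm (x - c) * enorm z.
      rewrite ler_norml edot_le_enorm andbT lerNl -edotNl -(enormN (x - c)).
      exact: edot_le_enorm.
    by apply: (le_trans h); rewrite ler_pM2r//; exact: ltW.
  apply: (@le_trans _ _ (e / enorm z * (2 * (r * enorm z)))); first by rewrite ler_pM2l.
  rewrite [leLHS](_ : _ = 2 * e * r); last by field; rewrite gt_eqF.
  by lra.
have Kray t : 0 < t -> K (t *: z) * t ^+ n.-1 = K z * singular_weight s t.
  by move=> t0; rewrite /K k_hom// -mulrA riesz_ray// mulrA.
have tpos t : `[(e / enorm z)%R, +oo[%classic t -> 0 < t.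
  by rewrite /= in_itv/= andbT; exact: lt_le_trans.
have Kz0 := anisotropic_kernel_ge0 z.
have mline C : measurable_fun setT
    ((fun t => ppow s (A + C * t - D * t ^+ 2)) : measurableTypeR R -> measurableTypeR R).
  exact: measurable_quadratic_profile.
pose G t := (ppow s (A + B * t - D * t ^+ 2) + ppow s (A - B * t - D * t ^+ 2)) * singular_weight s t.
have mG : measurable_fun setT (G : measurableTypeR R -> measurableTypeR R).
  apply: measurable_funM; last exact: measurable_powR.
  apply: measurable_funD; first exact: mline.
  have -> : (fun t => ppow s (A - B * t - D * t ^+ 2)) = (fun t => ppow s (A + (- B) * t - D * t ^+ 2)).
    by apply/funext => t; rewrite mulNr.
  exact: mline.
have G0 t : 0 <= G t.
  by apply: mulr_ge0; [apply: addr_ge0; exact: ppow_ge0|exact: singular_weight_ge0].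
have -> : (\int[leb]_(t in `[(e / enorm z)%R, +oo[)
     (2 * ball_profile s c r x * K (t *: z) * t ^+ n.-1)%:E =
   (K z)%:E * \int[leb]_(t in `[(e / enorm z)%R, +oo[) (2 * A `^ s * singular_weight s t)%:E)%E.
  rewrite -ge0_integralZl; last 4 first.
  - exact: measurable_itv.
  - apply/measurable_EFinP; apply: (@measurable_funS _ _ _ _ setT) => //.
    by apply: measurable_funM => //; exact: measurable_powR.
  - move=> t _; rewrite lee_fin; apply: mulr_ge0; last exact: singular_weight_ge0.
    by apply: mulr_ge0 => //; exact: powR_ge0.
  - by rewrite lee_fin.
  apply: eq_integral => t; rewrite inE => /tpos t0.
  rewrite -EFinM -mulrA Kray//; congr (_%:E).
  by rewrite /ball_profile -/A ppowE ?(ltW A0)//; ring.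
have -> : (\int[leb]_(t in `[(e / enorm z)%R, +oo[)
     ((ball_profile s c r (x + t *: z) + ball_profile s c r (x - t *: z)) *
      K (t *: z) * t ^+ n.-1)%:E =
   (K z)%:E * \int[leb]_(t in `[(e / enorm z)%R, +oo[) (G t)%:E)%E.
  rewrite -ge0_integralZl; last 4 first.
  - exact: measurable_itv.
  - by apply/measurable_EFinP; exact: measurable_funS mG.
  - by move=> t _; rewrite lee_fin; exact: G0.
  - by rewrite lee_fin.
  apply: eq_integral => t; rewrite inE => /tpos t0.
  rewrite -EFinM -mulrA Kray//; congr (_%:E).
  rewrite -scaleNr !ball_profile_line -/A -/D -/B /G.
  by rewrite sqrrN mulrN; ring.
have Q := quadratic_subsolution s01 A0 D0 en0 eB.
apply: (@le_trans _ _ ((K z)%:E * (\int[leb]_(t in `[(e / enorm z)%R, +oo[) (G t)%:E +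
   (2 * (D `^ s * cs))%:E))%E).
  by apply: lee_wpmul2l; [rewrite lee_fin|exact Q].
rewrite ge0_muleDr; last 2 first.
- by apply: integral_ge0 => t _; rewrite lee_fin; exact: G0.
- by rewrite lee_fin; apply: mulr_ge0 => //; apply: mulr_ge0 => //; exact: powR_ge0.
apply: leeD2l; rewrite -!EFinM lee_fin.
have -> : D `^ s = enorm z `^ (2 * s) by rewrite DE -powR_mulrn ?(ltW N0)// -powRrM.
have -> : enorm z `^ (- n%:R) = riesz s z * enorm z `^ (2 * s).
  rewrite /riesz -powRD ?(gt_eqF N0) ?implybT//; congr (_ `^ _); ring.
rewrite /K; have /andP[_ kL] := kb z.
have h : 0 <= 2 * cs * (riesz s z * enorm z `^ (2 * s)).
  by apply: mulr_ge0; [exact: mulr_ge0|apply: mulr_ge0; exact: powR_ge0].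
rewrite [leLHS](_ : _ = (2 * cs * (riesz s z * enorm z `^ (2 * s))) * k z); last by ring.
rewrite [leRHS](_ : _ = (2 * cs * (riesz s z * enorm z `^ (2 * s))) * Lam); last by field.
exact: ler_wpM2l.
Qed.

End ball_barrier.

Section ball_barrier_integrals.
Context {R : realType} {n : nat}.
Local Notation leb := (@lebesgue_measure R).
Implicit Types (x y z c : 'rV[R]_n) (e t r : R).
Hypothesis n_gt0 : (0 < n)%N.
Variables (s : R) (k : 'rV[R]_n -> R) (Lam : R).
Hypothesis s01 : 0 < s < 1.
Hypothesis mk : measurable_fun setT (k : 'rV[R]_n -> measurableTypeR R).
Hypothesis kb : forall y, 0 <= k y <= Lam.
Hypothesis k_even : forall y, k (- y) = k y.
Hypothesis k_hom : forall l y, 0 < l -> k (l *: y) = k y.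
Local Notation K := (anisotropic_kernel s k).
Local Notation mu := (lebesgue_rV n).

Let cs := (1 - s)^-1 + s^-1.

Let s0 : 0 < s. Proof. by case/andP: s01. Qed.

Let cs0 : 0 <= cs.
Proof. by case/andP: s01 => s_gt0 s_lt1; rewrite addr_ge0// invr_ge0 ?subr_ge0 ltW. Qed.

Let Lam0 : 0 <= Lam.
Proof. by case/andP: (kb 0) => h /(le_trans h). Qed.

Let K0 y : 0 <= K y. Proof. exact: anisotropic_kernel_ge0 kb y. Qed.

Let mK : measurable_fun setT (K : 'rV[R]_n -> measurableTypeR R).
Proof. exact: measurable_anisotropic_kernel. Qed.

Lemma measurable_addr_rV (f : 'rV[R]_n -> R) x :
  measurable_fun setT (f : 'rV[R]_n -> measurableTypeR R) ->
  measurable_fun setT ((fun y => f (x + y)) : 'rV[R]_n -> measurableTypeR R).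
Proof.
move=> mf; have mx : measurable_fun setT (fun y => x + y).
  rewrite (_ : (fun y => _) = (fun y => 1 *: y + x)); first exact: measurable_affine_rV.
  by apply/funext => y; rewrite scale1r addrC.
exact: (measurableT_comp mf mx).
Qed.

Lemma measurable_subr_rV (f : 'rV[R]_n -> R) x :
  measurable_fun setT (f : 'rV[R]_n -> measurableTypeR R) ->
  measurable_fun setT ((fun y => f (x - y)) : 'rV[R]_n -> measurableTypeR R).
Proof.
move=> mf; have mx : measurable_fun setT (fun y => x - y).
  rewrite (_ : (fun y => _) = (fun y => -1 *: y + x)); first exact: measurable_affine_rV.
  by apply/funext => y; rewrite scaleN1r addrC.
exact: (measurableT_comp mf mx).
Qed.

(** Rays control only the symmetric sum at [x + y] and [x - y], so everything is doubled and the
    reflection [y |-> - y] undoes it, [K] being even. The constant is independent of the ball: the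
    profile scales like [r^(2s)] and [L] like [r^(-2s)]. *)
Lemma ball_profile_barrier c r x e : eball c r x -> 0 < e ->
  4 * e * r <= r ^+ 2 - edot (x - c) (x - c) ->
  (\int[mu]_(y in ~` eball 0%R e) (ball_profile s c r x * K y)%:E <=
   \int[mu]_(y in ~` eball 0%R e) (ball_profile s c r (x + y) * K y)%:E +
   (2 * Lam * cs)%:E * \int[mu]_y (shell_density y)%:E)%E.
Proof.
move=> xc e0 eA.
have mphi := continuous_measurable_rV (@continuous_ball_profile R n s c r s0).
have phi0 := @ball_profile_ge0 R n s c r.
have mp := measurable_addr_rV x mphi.
have mm := measurable_subr_rV x mphi.
have two0 : (0 < 2%:E :> \bar R)%E by rewrite lte_fin.
rewrite -(@lee_pmul2l _ 2%:E)//.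
pose F0 y := 2 * ball_profile s c r x * K y.
pose F1 y := (ball_profile s c r (x + y) + ball_profile s c r (x - y)) * K y.
pose Sh y := 4 * Lam * cs * shell_density y.
have mF0 : measurable_fun setT (F0 : 'rV[R]_n -> measurableTypeR R).
  exact: measurable_funM.
have mF1 : measurable_fun setT (F1 : 'rV[R]_n -> measurableTypeR R).
  exact: (measurable_funM (measurable_funD mp mm) mK).
have mSh : measurable_fun setT (Sh : 'rV[R]_n -> measurableTypeR R).
  by apply: measurable_funM => //; exact: measurable_shell_density.
have F00 y : 0 <= F0 y by apply: mulr_ge0 => //; exact: mulr_ge0.
have F10 y : 0 <= F1 y by apply: mulr_ge0 => //; exact: addr_ge0.
have Sh0 y : 0 <= Sh y.
  apply: mulr_ge0; last exact: shell_density_ge0.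
  by apply: mulr_ge0 => //; exact: mulr_ge0.
pose T (F : 'rV[R]_n -> R) (y : 'rV[R]_n) : \bar R := (if e <= enorm y then F y else 0)%:E.
have T0 F y : (forall y, 0 <= F y) -> (0 <= T F y)%E.
  by move=> h; rewrite /T lee_fin; case: ifP.
have mT F : measurable_fun setT (F : 'rV[R]_n -> measurableTypeR R) -> measurable_fun setT (T F).
  exact: measurable_truncated.
have mShE : measurable_fun setT (fun y => (Sh y)%:E) by exact/measurable_EFinP.
have main : (\int[mu]_y T F0 y <= \int[mu]_y (T F1 y + (Sh y)%:E))%E.
  apply: (ge0_le_integral_rays n_gt0).
  - exact: mT.
  - by apply: emeasurable_funD; [exact: mT|exact: mShE].
  - by move=> y; exact: T0.
  - by move=> y; apply: adde_ge0; [exact: T0|rewrite lee_fin; exact: Sh0].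
  move=> z z0; rewrite /T (truncated_ray _ e0 z0).
  have mline : measurable_fun (`]0%R, +oo[%classic : set (measurableTypeR R)) (fun t : measurableTypeR R => t *: z).
    by apply: (@measurable_funS _ _ _ _ setT) => //; exact: measurable_scale_line.
  have mpow : measurable_fun (`]0%R, +oo[%classic : set (measurableTypeR R)) (fun t : measurableTypeR R => (t ^+ n.-1)%:E).
    by apply/measurable_EFinP; apply: measurable_funX.
  have tn0 t : `]0%R, +oo[%classic t -> (0 <= (t ^+ n.-1)%:E)%E.
    by rewrite /= in_itv/= andbT => t0; rewrite lee_fin; apply: exprn_ge0; exact: ltW.
  have -> : (\int[leb]_(t in `]0%R, +oo[) ((T F1 (t *: z) + (Sh (t *: z))%:E) * (t ^+ n.-1)%:E) =
     \int[leb]_(t in `]0%R, +oo[) (T F1 (t *: z) * (t ^+ n.-1)%:E) +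
     \int[leb]_(t in `]0%R, +oo[) ((Sh (t *: z))%:E * (t ^+ n.-1)%:E))%E.
    rewrite -ge0_integralD; last 5 first.
    - exact: measurable_itv.
    - by move=> t /tn0 ?; apply: mule_ge0 => //; exact: T0.
    - by apply: emeasurable_funM => //; exact: (measurableT_comp (mT _ mF1) mline).
    - by move=> t /tn0 ?; apply: mule_ge0 => //; rewrite lee_fin; exact: Sh0.
    - by apply: emeasurable_funM => //; exact: (measurableT_comp mShE mline).
    apply: eq_integral => t _.
    by rewrite ge0_muleDl//; [exact: T0|rewrite lee_fin; exact: Sh0].
  rewrite /T (truncated_ray _ e0 z0).
  have H := ball_profile_ray n_gt0 s01 kb k_hom xc e0 eA z0.
  apply: (@le_trans _ _ (\int[leb]_(t in `[(e / enorm z)%R, +oo[) (F1 (t *: z) * t ^+ n.-1)%:E +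
    (4 * Lam * cs)%:E * (enorm z `^ (- n%:R) / 2)%:E)%E).
    exact H.
  apply: leeD2l.
  have -> : (\int[leb]_(t in `]0%R, +oo[) ((Sh (t *: z))%:E * (t ^+ n.-1)%:E) =
    (4 * Lam * cs)%:E * \int[leb]_(t in `]0%R, +oo[) ((shell_density (t *: z))%:E * (t ^+ n.-1)%:E))%E.
    rewrite -ge0_integralZl; last 4 first.
    - exact: measurable_itv.
    - apply: emeasurable_funM => //; apply/measurable_EFinP.
      exact: (measurableT_comp (@measurable_shell_density R n) mline).
    - move=> t /tn0 ?; apply: mule_ge0 => //; rewrite lee_fin; exact: shell_density_ge0.
    - by rewrite lee_fin; apply: mulr_ge0 => //; exact: mulr_ge0.
    by apply: eq_integral => t _; rewrite muleA -EFinM.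
  apply: lee_wpmul2l; last exact: shell_density_ray.
  by rewrite lee_fin; apply: mulr_ge0 => //; exact: mulr_ge0.
rewrite truncated_integral (truncated_integral (fun y => ball_profile s c r (x + y) * K y)).
have m1 : measurable_fun setT ((fun y => ball_profile s c r (x + y) * K y) : 'rV[R]_n -> measurableTypeR R).
  exact: (measurable_funM mp mK).
have m2 : measurable_fun setT ((fun y => ball_profile s c r (x - y) * K y) : 'rV[R]_n -> measurableTypeR R).
  exact: (measurable_funM mm mK).
have p1 y : 0 <= ball_profile s c r (x + y) * K y by exact: mulr_ge0.
have p2 y : 0 <= ball_profile s c r (x - y) * K y by exact: mulr_ge0.
have -> : (2%:E * \int[mu]_y (if (e <= enorm y)%R then (ball_profile s c r x * K y)%R else 0%R)%:E =
    \int[mu]_y T F0 y)%E.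
  rewrite -ge0_integralZl; last 4 first.
  - exact: measurableT.
  - exact: (measurable_truncated e (measurable_funM (measurable_cst (ball_profile s c r x)) mK)).
  - by move=> y _; rewrite lee_fin; case: ifP => // _; exact: mulr_ge0.
  - exact: ltW.
  apply: eq_integral => y _; rewrite /T -EFinM; congr (_%:E).
  by case: ifP => _; rewrite ?mulr0// /F0 mulrA.
apply: (le_trans main).
rewrite ge0_integralD; last 5 first.
- exact: measurableT.
- by move=> y _; exact: T0.
- exact: mT.
- by move=> y _; rewrite lee_fin; exact: Sh0.
- exact: mShE.
pose P1 y := ball_profile s c r (x + y) * K y.
pose P2 y := ball_profile s c r (x - y) * K y.
have -> : (\int[mu]_y T F1 y =
   2%:E * \int[mu]_y (if (e <= enorm y)%R then (ball_profile s c r (x + y) * K y)%R else 0%R)%:E)%E.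
  transitivity (\int[mu]_y T P1 y +
    \int[mu]_y T P2 y)%E.
    rewrite -ge0_integralD; last 5 first.
    - exact: measurableT.
    - by move=> y _; exact: (T0 _ _ p1).
    - exact: (mT P1 m1).
    - by move=> y _; exact: (T0 _ _ p2).
    - exact: (mT P2 m2).
    apply: eq_integral => y _; rewrite /T -EFinD; congr (_%:E).
    by case: ifP => _; rewrite ?addr0// /F1 mulrDl.
  have P21 : (\int[mu]_y T P2 y = \int[mu]_y T P1 y)%E.
    rewrite -[RHS](truncated_integral_opp e m1 p1); apply: eq_integral => y _.
    by rewrite /T /anisotropic_kernel k_even /riesz enormN.
  by rewrite [X in (_ + X)%E]P21 mule_natl mule2n.
have I1 : (0 <= \int[mu]_y (if (e <= enorm y)%R then (ball_profile s c r (x + y) * K y)%R else 0%R)%:E)%E.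
  by apply: integral_ge0 => y _; rewrite lee_fin; case: ifP => // _; exact: p1.
have I2 : (0 <= (2 * Lam * cs)%:E * \int[mu]_y (shell_density y)%:E)%E.
  apply: mule_ge0; first by rewrite lee_fin; apply: mulr_ge0 => //; exact: mulr_ge0.
  by apply: integral_ge0 => y _; rewrite lee_fin; exact: shell_density_ge0.
rewrite (ge0_muleDr _ I1 I2).
apply: leeD2l; rewrite muleA -EFinM /Sh.
rewrite (eq_integral (fun y => ((4 * Lam * cs)%:E * (shell_density y)%:E)%E)) => [|y _]; last by rewrite EFinM.
rewrite ge0_integralZl; last 4 first.
- exact: measurableT.
- by apply/measurable_EFinP; exact: measurable_shell_density.
- by move=> y _; rewrite lee_fin; exact: shell_density_ge0.
- by rewrite lee_fin; apply: mulr_ge0 => //; exact: mulr_ge0.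
by rewrite (_ : 2 * (2 * Lam * cs) = 4 * Lam * cs)//; ring.
Qed.

End ball_barrier_integrals.

(** * Absolute convergence of the truncated integrals *)

Section kernel_integrability.
Context {R : realType} {n : nat}.
Implicit Types (x y z c : 'rV[R]_n) (e t r M : R).
Hypothesis n_gt0 : (0 < n)%N.
Variables (s : R) (k : 'rV[R]_n -> R) (Lam : R).
Hypothesis s01 : 0 < s < 1.
Hypothesis mk : measurable_fun setT (k : 'rV[R]_n -> measurableTypeR R).
Hypothesis kb : forall y, 0 <= k y <= Lam.
Hypothesis k_even : forall y, k (- y) = k y.
Hypothesis k_hom : forall l y, 0 < l -> k (l *: y) = k y.
Local Notation K := (anisotropic_kernel s k).
Local Notation mu := (lebesgue_rV n).

Let s0 : 0 < s. Proof. by case/andP: s01. Qed.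

Let K0 y : 0 <= K y. Proof. exact: anisotropic_kernel_ge0 kb y. Qed.

Let mK : measurable_fun setT (K : 'rV[R]_n -> measurableTypeR R).
Proof. exact: measurable_anisotropic_kernel. Qed.

Let mD e := @measurable_setC_eball R n e.

Lemma measurable_funDE (D : set 'rV[R]_n) (f : 'rV[R]_n -> R) :
  measurable_fun setT (f : 'rV[R]_n -> measurableTypeR R) ->
  measurable_fun D (EFin \o f).
Proof. by move=> mf; apply/measurable_EFinP; exact: measurable_funS mf. Qed.

Lemma integrable_riesz e : 0 < e ->
  mu.-integrable (~` eball 0 e) (EFin \o (riesz s : 'rV[R]_n -> R)).
Proof.
move=> e0; apply/integrableP; split; first by apply: measurable_funDE; exact: measurable_riesz.
rewrite (eq_integral (fun y => (riesz s y)%:E)) => [|y _]; last first.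
  by rewrite /= ger0_norm// riesz_ge0.
exact: integral_riesz_tail.
Qed.

Lemma integrable_bounded_riesz e M (f : 'rV[R]_n -> R) : 0 < e ->
  measurable_fun setT (f : 'rV[R]_n -> measurableTypeR R) ->
  (forall y, `|f y| <= M * riesz s y) ->
  mu.-integrable (~` eball 0 e) (EFin \o f).
Proof.
move=> e0 mf fM.
apply: (@le_integrable _ _ _ _ _ (mD e) _ (fun y => (M%:E * (riesz s y)%:E)%E)).
- exact: measurable_funDE.
- move=> y _; rewrite -EFinM !abse_EFin lee_fin; apply: (le_trans (fM y)).
  exact: ler_norm.
- apply: (@integrableZl _ _ _ _ _ (mD e)); exact: integrable_riesz.
Qed.

Lemma integrable_kernel_bounded e M (f : 'rV[R]_n -> R) : 0 < e ->
  measurable_fun setT (f : 'rV[R]_n -> measurableTypeR R) ->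
  (forall y, `|f y| <= M) ->
  mu.-integrable (~` eball 0 e) (EFin \o (fun y => f y * K y)).
Proof.
move=> e0 mf fM; apply: (@integrable_bounded_riesz e (M * Lam)) => //.
  exact: measurable_funM.
move=> y; rewrite normrM (ger0_norm (K0 y)) /anisotropic_kernel mulrA.
apply: ler_wpM2r; first exact: riesz_ge0.
by have /andP[k0 kL] := kb y; apply: ler_pM.
Qed.

(** Away from the origin of [y], the kernel is dominated by the weight of [Zspace] evaluated at
    [x + y]. *)
Lemma integrable_kernel_shift e (u : 'rV[R]_n -> R) x : 0 < e -> continuous u ->
  (\int[mu]_x (`|u x| / (1 + enorm x `^ (n%:R + 2 * s)))%:E < +oo)%E ->
  mu.-integrable (~` eball 0 e) (EFin \o (fun y => u (x + y) * K y)).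
Proof.
move=> e0 cu fu; set p := n%:R + 2 * s in fu *.
have p0 : 0 < p by rewrite ltr_wpDl// mulr_gt0.
have Lam0 : 0 <= Lam by case/andP: (kb 0) => h /(le_trans h).
pose h z := `|u z| / (1 + enorm z `^ p).
have mu' := continuous_measurable_rV cu.
have w0 z : 0 < 1 + enorm z `^ p by rewrite ltr_pwDl// powR_ge0.
have h0 z : 0 <= h z by rewrite divr_ge0// ltW.
have mh : measurable_fun setT (h : 'rV[R]_n -> measurableTypeR R).
  rewrite (_ : h = fun z => `|u z| * (1 + enorm z `^ p) `^ (-1)); last first.
    by apply/funext => z; rewrite powR_inv1// ltW.
  apply: measurable_funM; first exact: measurableT_comp.
  apply: (measurableT_comp (measurable_powR _)).
  by apply: measurable_funD => //; exact: measurable_enorm_powR.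
have N1 : (1 : R) != 0 by exact: oner_neq0.
have hx : (\int[mu]_y (h (x + y))%:E < +oo)%E.
  have <- : (\int[mu]_y (h y)%:E = \int[mu]_y (h (x + y))%:E)%E.
    rewrite (ge0_integral_affine_rV x N1).
    - rewrite normr1 expr1n mul1e; apply: eq_integral => y _.
      by rewrite scale1r addrC.
    - exact/measurable_EFinP.
    - by move=> y; rewrite lee_fin.
  exact: fu.
(* For [|y| >= e], [1 <= e^(-p) |y|^p] and [|x + y| <= (|x| / e + 1) |y|]; the two terms of [C]
   bound [1] and [|x + y|^p]. *)
pose C := e `^ (- p) + (enorm x / e + 1) `^ p.
have C0 : 0 <= C by rewrite addr_ge0 ?powR_ge0.
apply: (@le_integrable _ _ _ _ _ (mD e) _ (fun y => ((Lam * C)%:E * (h (x + y))%:E)%E)).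
- apply: measurable_funDE; apply: measurable_funM => //.
  exact: (measurable_addr_rV x (continuous_measurable_rV cu)).
- move=> y; rewrite setC_eball0 /= => ey.
  have y0 : 0 < enorm y by exact: lt_le_trans ey.
  rewrite lee_fin normrM (ger0_norm (K0 y)) (ger0_norm (mulr_ge0 (mulr_ge0 Lam0 C0) (h0 (x + y)))).
  have key : 1 + enorm (x + y) `^ p <= C * enorm y `^ p.
    rewrite /C mulrDl; apply: lerD.
      rewrite powRN mulrC -(ler_pM2r (powR_gt0 p e0)) mul1r mulfVK ?gt_eqF ?powR_gt0//.
      by apply: ge0_ler_powR; rewrite ?nnegrE ?(ltW p0) ?(ltW e0) ?(ltW y0).
    have xy0 : 0 <= enorm x / e by rewrite divr_ge0 ?enorm_ge0// ltW.
    rewrite -powRM ?(ltW y0)//; last by rewrite addr_ge0.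
    apply: ge0_ler_powR; rewrite ?nnegrE ?(ltW p0) ?enorm_ge0//.
      by rewrite mulr_ge0 ?addr_ge0// ltW.
    apply: (le_trans (ler_enormD _ _)); rewrite mulrDl mul1r lerD2r.
    by rewrite mulrAC ler_pdivlMr// ler_wpM2l ?enorm_ge0.
  rewrite /anisotropic_kernel /h /riesz -/p powRN.
  have -> : `|u (x + y)| * (k y / enorm y `^ p) = k y * (`|u (x + y)| / enorm y `^ p) by ring.
  have -> : Lam * C * (`|u (x + y)| / (1 + enorm (x + y) `^ p)) =
     Lam * (C * (`|u (x + y)| / (1 + enorm (x + y) `^ p))) by ring.
  have /andP[k0 kL] := kb y.
  apply: ler_pM => //; first by rewrite divr_ge0// powR_ge0.
  rewrite ler_pdivrMr ?powR_gt0// -[leLHS]mulr1.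
  have -> : C * (`|u (x + y)| / (1 + enorm (x + y) `^ p)) * enorm y `^ p =
    `|u (x + y)| * ((C * enorm y `^ p) / (1 + enorm (x + y) `^ p)) by ring.
  by apply: ler_wpM2l => //; rewrite ler_pdivlMr// mul1r.
- apply: (@integrableZl _ _ _ _ _ (mD e)).
  apply: (@integrableS _ _ _ _ setT) => //.
  apply/integrableP; split.
    by apply/measurable_EFinP; exact: (measurable_addr_rV x mh).
  rewrite (eq_integral (fun y => (h (x + y))%:E)) => [|y _]; last by rewrite /= ger0_norm.
  exact: hx.
Qed.

Lemma ball_profile_le c r x : 0 <= r -> ball_profile s c r x <= r `^ (2 * s).
Proof.
move=> r0; rewrite /ball_profile /ppow.
have -> : r `^ (2 * s) = (r ^+ 2) `^ s by rewrite -powR_mulrn// -powRrM.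
apply: ge0_ler_powR; rewrite ?nnegrE ?(ltW s0) ?sqr_ge0//.
  by rewrite le_max lexx orbT.
by rewrite ge_max sqr_ge0 andbT gerBl edot_ge0.
Qed.

Lemma integrable_ball_profile_diff c r x e : 0 <= r -> 0 < e ->
  mu.-integrable (~` eball 0 e)
    (EFin \o (fun y => (ball_profile s c r x - ball_profile s c r (x + y)) * K y)).
Proof.
move=> r0 e0; apply: (@integrable_kernel_bounded e (r `^ (2 * s))) => //.
  apply: measurable_funB => //; apply: measurable_addr_rV.
  exact: (continuous_measurable_rV (continuous_ball_profile s0)).
move=> y; have := ball_profile_le c x r0; have := ball_profile_le c (x + y) r0.
have := ball_profile_ge0 s c r x; have := ball_profile_ge0 s c r (x + y).
by rewrite ler_norml; lra.
Qed.

(** [C] precedes the ball, the point and the cut-off: [hopf_comparison] fixes [d] before it knows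
    where the maximum lies. *)
Lemma Rintegral_ball_profile_le : exists2 C, 0 <= C & forall c r x e, eball c r x -> 0 < e ->
  4 * e * r <= r ^+ 2 - edot (x - c) (x - c) ->
  \int[mu]_(y in ~` eball 0 e)
    ((ball_profile s c r x - ball_profile s c r (x + y)) * K y) <= C.
Proof.
have sh0 : (0 <= \int[mu]_y (shell_density (y : 'rV[R]_n))%:E)%E.
  by apply: integral_ge0 => y _; rewrite lee_fin shell_density_ge0.
have shE : (\int[mu]_y (shell_density (y : 'rV[R]_n))%:E = (fine (\int[mu]_y (shell_density (y : 'rV[R]_n))%:E))%:E)%E.
  by apply/esym/fineK; rewrite (ge0_fin_numE sh0); exact: integral_shell_density_lty.
set Sg := fine _ in shE.
have Sg0 : 0 <= Sg by rewrite -lee_fin -shE.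
have Lam0 : 0 <= Lam by case/andP: (kb 0) => h /(le_trans h).
exists (2 * Lam * ((1 - s)^-1 + s^-1) * Sg).
  have /andP[_ s1] := s01.
  by rewrite !mulr_ge0// addr_ge0// invr_ge0 ?subr_ge0 ltW.
move=> c r x e xc e0 eA.
have r0 : 0 <= r by apply: ltW; exact: le_lt_trans (enorm_ge0 _) xc.
have cphi := @continuous_ball_profile R n s c r s0.
have bnd z : `|ball_profile s c r z| <= r `^ (2 * s).
  by rewrite ger0_norm ?ball_profile_ge0// ball_profile_le.
have i1 : mu.-integrable (~` eball 0 e) (EFin \o (fun y => ball_profile s c r x * K y)).
  exact: (@integrable_kernel_bounded e (r `^ (2 * s)) (fun=> ball_profile s c r x)).
have i2 : mu.-integrable (~` eball 0 e) (EFin \o (fun y => ball_profile s c r (x + y) * K y)).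
  apply: (@integrable_kernel_bounded e (r `^ (2 * s))) => //.
  exact: (measurable_addr_rV x (continuous_measurable_rV cphi)).
rewrite (_ : (fun y => _) = (fun y => ball_profile s c r x * K y - ball_profile s c r (x + y) * K y)); last first.
  by apply/funext => y; rewrite mulrBl.
rewrite (RintegralB (mD e) i1 i2) lerBlDl.
have H := ball_profile_barrier n_gt0 s01 mk kb k_even k_hom xc e0 eA.
have f1 := esym (fineK (integrable_fin_num (mD e) i1)).
have f2 := esym (fineK (integrable_fin_num (mD e) i2)).
rewrite -lee_fin EFinD; move: H; rewrite shE -EFinM.
rewrite [X in (X <= _)%E -> _]f1 [X in (_ <= X + _)%E -> _]f2.
exact.
Qed.

End kernel_integrability.

(** * Comparison with the ball profile *)

Section truncated_operator.
Context {R : realType} {n : nat}.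
Implicit Types (x y z c q : 'rV[R]_n) (e t r h : R).
Hypothesis n_gt0 : (0 < n)%N.
Variables (s : R) (k : 'rV[R]_n -> R) (lam Lam : R).
Hypothesis s01 : 0 < s < 1.
Hypothesis mk : measurable_fun setT (k : 'rV[R]_n -> measurableTypeR R).
Hypothesis lam0 : 0 < lam.
Hypothesis kb : forall y, lam <= k y <= Lam.
Hypothesis k_even : forall y, k (- y) = k y.
Hypothesis k_hom : forall l y, 0 < l -> k (l *: y) = k y.
Local Notation K := (anisotropic_kernel s k).
Local Notation mu := (lebesgue_rV n).

Let kb0 y : 0 <= k y <= Lam.
Proof. by have /andP[h ->] := kb y; rewrite (le_trans (ltW lam0)). Qed.

Let s0 : 0 < s. Proof. by case/andP: s01. Qed.

Let mD e := @measurable_setC_eball R n e.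

(** Cubes serve as the regions of gain because their volume is explicit. *)
Definition cube q h : set 'rV[R]_n :=
  [set z | forall i, `](q ord0 i - h), (q ord0 i + h)[%classic (z ord0 i)].

Lemma cubeP q h z : cube q h z <-> forall i, `|z ord0 i - q ord0 i| < h.
Proof.
by split=> H i; have := H i; rewrite /= in_itv/= ltr_distl.
Qed.

Lemma eball_sub_cube q h z : eball q h z -> cube q h z.
Proof.
move=> qz; apply/cubeP => i; apply: le_lt_trans qz.
by have := enorm_coord (z - q) i; rewrite !mxE.
Qed.

Lemma cube_sub_enorm q h z : cube q h z -> enorm (z - q) <= n%:R * h.
Proof.
move=> /cubeP qz.
have h0 : 0 <= h by apply: ltW; exact: le_lt_trans (normr_ge0 _) (qz (Ordinal n_gt0)).
by apply: enorm_le_coord => // i; rewrite !mxE ltW.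
Qed.

Lemma cube_shift q h x y : cube (q - x) h y -> cube q h (x + y).
Proof.
move=> /cubeP H; apply/cubeP => i; have := H i; rewrite !mxE.
by rewrite (_ : _ - (_ - _) = x ord0 i + y ord0 i - q ord0 i)//; ring.
Qed.

(** The removed ball lies in a cube of half-side [e <= h / 2], which has at most half the volume
    since [n > 0]. The cube of gain may therefore contain the singularity. *)
Lemma cube_minus_eball_ge q h e : 0 < e -> e <= h / 2 ->
  (((h *+ 2) ^+ n / 2)%:E <= mu (~` eball 0 e `&` cube q h))%E.
Proof.
move=> e0 eh; have h0 : 0 < h by lra.
have mQ : measurable (cube q h) by exact: measurable_cube.
have mB : measurable (cube 0 e) by exact: measurable_cube.
have mDQ : measurable (~` eball 0 e `&` cube q h) by exact: measurableI.
have vQ : mu (cube q h) = ((h *+ 2) ^+ n)%:E by exact: lebesgue_rV_cube.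
have vB : mu (cube 0 e) = ((e *+ 2) ^+ n)%:E by exact: lebesgue_rV_cube.
have sub : cube q h `<=` (~` eball 0 e `&` cube q h) `|` cube 0 e.
  move=> z qz; have [ze|ze] := pselect (eball 0 e z); last by left.
  by right; exact: eball_sub_cube.
have H : (mu (cube q h) <= mu (~` eball 0 e `&` cube q h) + mu (cube 0 e))%E.
  apply: (le_trans (le_measure mu _ _ sub)).
  - by rewrite inE.
  - by rewrite inE; exact: measurableU.
  - exact: measureU2.
have finDQ : mu (~` eball 0 e `&` cube q h) \is a fin_num.
  rewrite ge0_fin_numE ?measure_ge0//; apply: (@le_lt_trans _ _ (mu (cube q h))).
    by apply: le_measure; rewrite ?inE//; exact: subIsetr.
  by move: vQ => /= ->; exact: ltry.
have e2 : (e *+ 2) ^+ n <= (h *+ 2) ^+ n / 2.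
  have e1 : e *+ 2 <= h *+ 2 / 2 by rewrite mulr2n; lra.
  have e20 : 0 <= e *+ 2 by rewrite mulrn_wge0// ltW.
  have h20 : 0 <= h *+ 2 by rewrite mulrn_wge0// ltW.
  apply: (@le_trans _ _ ((h *+ 2 / 2) ^+ n)); first by rewrite lerXn2r ?nnegrE// divr_ge0.
  rewrite exprMn ler_wpM2l ?exprn_ge0// -[leRHS]expr1 ler_wiXn2l//; lra.
rewrite -(fineK finDQ) lee_fin.
have : ((h *+ 2) ^+ n <= fine (mu (~` eball 0 e `&` cube q h)) + (e *+ 2) ^+ n).
  rewrite -lee_fin EFinD fineK//; move: H; rewrite vQ vB; exact.
by lra.
Qed.

Variable u : 'rV[R]_n -> R.
Hypothesis cu : continuous u.
Hypothesis fu : (\int[mu]_x (`|u x| / (1 + enorm x `^ (n%:R + 2 * s)))%:E < +oo)%E.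

Lemma integrable_kernel_diff e x : 0 < e ->
  mu.-integrable (~` eball 0 e) (EFin \o (fun y => (u x - u (x + y)) * K y)).
Proof.
move=> e0.
have i1 : mu.-integrable (~` eball 0 e) (EFin \o (fun y => u x * K y)).
  exact: (@integrable_kernel_bounded R n n_gt0 s k Lam s01 mk kb0 e `|u x| (fun=> u x)).
have i2 := integrable_kernel_shift s01 mk kb0 x e0 cu fu.
have := integrableB (mD e) i1 i2.
by apply: eq_integrable => // y _; rewrite /= mulrBl.
Qed.

(* [w = u + d * ball_profile] has a positive maximum over [eball c r] at [x]:
   outside [eball x0 rho] the integrand is controlled by [M], inside it is
   nonnegative, and on the cube [u <= - eta] yields a definite gain. *)
Lemma truncated_operator_ge (x0 c q : 'rV[R]_n) (rho r h eta M d Dist x e : _) :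
  0 < e -> e <= h / 2 -> e <= rho / 2 -> 0 < Dist -> 0 <= M -> 0 < eta -> 0 <= d ->
  eball c r x ->
  enorm (c - x0) + r <= rho / 2 ->
  (forall z, u z <= M) ->
  (forall z, eball x0 rho z -> u z <= 0) ->
  (forall z, cube q h z -> u z <= - eta) ->
  (forall z, cube q h z -> enorm (z - x) <= Dist) ->
  d * r `^ (2 * s) <= eta / 2 ->
  0 < u x + d * ball_profile s c r x ->
  (forall z, eball c r z -> u z + d * ball_profile s c r z <= u x + d * ball_profile s c r x) ->
  eta / 2 * (lam * Dist `^ (- (n%:R + 2 * s))) * ((h *+ 2) ^+ n / 2) -
    M * Lam * \int[mu]_(y in ~` eball 0 (rho / 2)) riesz s y <=
  \int[mu]_(y in ~` eball 0 e) ((u x - u (x + y)) * K y) +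
  d * \int[mu]_(y in ~` eball 0 e)
     ((ball_profile s c r x - ball_profile s c r (x + y)) * K y).
Proof.
move=> e0 eh erho Dist0 M0 eta0 d0 xc crho uM u0 ueta qDist deta wx wmax.
have r0 : 0 <= r by apply: ltW; exact: le_lt_trans (enorm_ge0 _) xc.
have h0 : 0 < h by lra.
have rho0 : 0 < rho by lra.
have Lam0 : 0 <= Lam by have /andP[_] := kb0 0; apply: le_trans; case/andP: (kb0 0).
set a := eta / 2 * (lam * Dist `^ (- (n%:R + 2 * s))).
have a0 : 0 <= a by rewrite !mulr_ge0 ?powR_ge0// ltW.
have i1 := integrable_kernel_diff x e0.
have i2 := @integrable_ball_profile_diff R n n_gt0 s k Lam s01 mk kb0 c r x e r0 e0.
rewrite -(RintegralZl d (mD e) i2).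
have i2' : mu.-integrable (~` eball 0 e) (EFin \o (fun y =>
    d * ((ball_profile s c r x - ball_profile s c r (x + y)) * K y))).
  have := @integrableZl _ _ _ _ _ (mD e) d _ i2.
  by apply: eq_integrable => // y _; rewrite /= EFinM.
rewrite -(RintegralD (mD e) i1 i2').
have mQ : measurable (cube (q - x) h) by exact: measurable_cube.
have mDQ : measurable (~` eball 0 e `&` cube (q - x) h) by exact: measurableI.
have DD : ~` eball 0 e `&` ~` eball 0 (rho / 2) = ~` eball (0 : 'rV[R]_n) (rho / 2).
  apply/setIidPr; rewrite !setC_eball0 => y /=; exact: le_trans.
have finQ : (mu (~` eball 0 e `&` cube (q - x) h) < +oo)%E.
  apply: (@le_lt_trans _ _ (mu (cube (q - x) h))).
    by apply: le_measure; rewrite ?inE//; exact: subIsetr.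
  have vQ : mu (cube (q - x) h) = ((h *+ 2) ^+ n)%:E by exact: lebesgue_rV_cube.
  by move: vQ => /= ->; exact: ltry.
(* The integrand is bounded below by [f1 - f2]: gain on the cube shifted to the variable [y], loss
   only at distance at least [rho / 2] from [x]. *)
pose f1 : 'rV[R]_n -> R := (fun=> a) \_ (cube (q - x) h).
pose f2 : 'rV[R]_n -> R := (fun y => M * Lam * riesz s y) \_ (~` eball 0 (rho / 2)).
have j1 : mu.-integrable (~` eball 0 e) (EFin \o f1).
  rewrite /f1 -restrict_EFin; apply/(integrable_restrict mu mQ (mD e)).
  apply/integrableP; split; first exact: measurable_cst.
  rewrite (eq_integral (cst `|a|%:E)); last by move=> y _.
  by rewrite integral_cst//; apply: lte_mul_pinfty.
have j2 : mu.-integrable (~` eball 0 e) (EFin \o f2).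
  rewrite /f2 -restrict_EFin; apply/(integrable_restrict mu (mD (rho / 2)) (mD e)).
  rewrite DD; have rho2 : 0 < rho / 2 by lra.
  have := @integrableZl _ _ _ _ _ (mD (rho / 2)) (M * Lam) _ (integrable_riesz n_gt0 s01 rho2).
  by apply: eq_integrable => // y _; rewrite /= EFinM.
have I1 : \int[mu]_(y in ~` eball 0 e) f1 y = a * fine (mu (~` eball 0 e `&` cube (q - x) h)).
  by rewrite /f1 -Rintegral_mkcondr Rintegral_cst.
have I2 : \int[mu]_(y in ~` eball 0 e) f2 y =
    M * Lam * \int[mu]_(y in ~` eball 0 (rho / 2)) riesz s y.
  rewrite /f2 -Rintegral_mkcondr DD RintegralZl//.
  by apply: integrable_riesz => //; lra.
apply: (@le_trans _ _ (\int[mu]_(y in ~` eball 0 e) (f1 y - f2 y))).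
  rewrite RintegralB// I1 I2 lerD2r ler_wpM2l//.
  have fQ : mu (~` eball 0 e `&` cube (q - x) h) \is a fin_num.
    by rewrite ge0_fin_numE// measure_ge0.
  rewrite -lee_fin fineK//; exact: cube_minus_eball_ge.
apply: le_Rintegral.
- exact: mD.
- have := integrableB (mD e) j1 j2.
  by apply: eq_integrable => // y _.
- have := integrableD (mD e) i1 i2'.
  by apply: eq_integrable => // y _.
move=> y; rewrite setC_eball0/= => ey.
have y0 : 0 < enorm y by exact: lt_le_trans ey.
have [k0 kL] : 0 <= k y /\ k y <= Lam by apply/andP.
have K0 : 0 <= K y by exact: anisotropic_kernel_ge0 kb0 y.
have rz0 : 0 <= riesz s y by exact: riesz_ge0.
have f20 : 0 <= f2 y.
  rewrite /f2 patchE; case: ifP => // _; rewrite mulr_ge0// mulr_ge0//.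
rewrite [leRHS](_ : _ = ((u x - u (x + y)) +
  d * (ball_profile s c r x - ball_profile s c r (x + y))) * K y); last by ring.
set v := _ + d * _.
have vE : v = (u x + d * ball_profile s c r x) - (u (x + y) + d * ball_profile s c r (x + y)).
  by rewrite /v; ring.
have [yQ|yQ] := pselect (cube (q - x) h y).
  have zQ := cube_shift yQ.
  have f1E : f1 y = a by rewrite /f1 patchE mem_set.
  (* [w x > 0], while on the cube [w <= - eta + d r^(2s) <= - eta / 2]. *)
  have v1 : eta / 2 <= v.
    have := ueta _ zQ; have := ball_profile_le s01 c (x + y) r0 => b1 b2.
    have b3 : d * ball_profile s c r (x + y) <= d * r `^ (2 * s) by rewrite ler_wpM2l.
    by rewrite vE; lra.
  have K1 : lam * Dist `^ (- (n%:R + 2 * s)) <= K y.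
    have /andP[k1 _] := kb y.
    apply: ler_pM => //; [exact: ltW|exact: powR_ge0|].
    have yD : enorm y <= Dist by have := qDist _ zQ; rewrite addrC addKr.
    rewrite /riesz 2!powRN lef_pV2 ?posrE ?powR_gt0//.
    apply: ge0_ler_powR; rewrite ?nnegrE ?(ltW y0) ?(ltW Dist0)//.
    by rewrite addr_ge0// mulr_ge0// ltW.
  have : a <= v * K y.
    apply: ler_pM => //; first by rewrite divr_ge0// ltW.
    by rewrite mulr_ge0 ?powR_ge0// ltW.
  by rewrite f1E; lra.
have f1E : f1 y = 0 by rewrite /f1 patchE memNset.
rewrite f1E sub0r.
(* Near [x0] there is no loss: in the ball [w] is at most its maximum, and elsewhere the profile
   vanishes and [u <= 0 < w x]. *)
have [zr|zr] := pselect (eball x0 rho (x + y)).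
  apply: (@le_trans _ _ 0); first by rewrite oppr_le0.
  apply: mulr_ge0 => //; rewrite vE subr_ge0.
  have [zc|zc] := ltP (enorm (x + y - c)) r; first exact: wmax.
  rewrite (ball_profile_eq0 s0 r0 zc) mulr0 addr0.
  by apply: ltW; exact: le_lt_trans (u0 _ zr) wx.
(* [x] is within [rho / 2] of [x0], so a point outside [eball x0 rho] is at distance at least
   [rho / 2] from [x], where the tail of [riesz] takes over. *)
have xr : enorm (x - x0) < rho / 2.
  apply: (le_lt_trans (ler_edistD c _ _)); apply: lt_le_trans crho.
  by rewrite [ltRHS]addrC ltrD2r.
have yr : rho / 2 <= enorm y.
  move/negP: zr; rewrite -leNgt => zr.
  have := ler_enormD (x - x0) y; rewrite (_ : x - x0 + y = x + y - x0); last by rewrite addrAC.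
  by lra.
have f2E : f2 y = M * Lam * riesz s y.
  by rewrite /f2 patchE mem_set// setC_eball0.
have zc : r <= enorm (x + y - c).
  rewrite leNgt; apply/negP => zc; apply: zr.
  apply: (le_lt_trans (ler_edistD c _ _)).
  by have : enorm (x + y - c) + enorm (c - x0) < rho / 2; [lra|lra].
have v1 : - M <= v.
  rewrite vE (ball_profile_eq0 s0 r0 zc) mulr0 addr0.
  by have := uM (x + y); lra.
apply: (@le_trans _ _ (- M * K y)); last by rewrite ler_wpM2r.
rewrite f2E mulNr lerN2 /anisotropic_kernel mulrA ler_wpM2r// ler_wpM2l//.
Qed.

Lemma compact_closed_eball c r : compact [set z : 'rV[R]_n | enorm (z - c) <= r].
Proof.
apply: bounded_closed_compact.
  exists (enorm c + r); split; first exact: num_real.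
  move=> M cM z /= zr; apply: (le_trans _ (ltW cM)).
  have r0 : 0 <= r by exact: le_trans (enorm_ge0 _) zr.
  rewrite /Num.norm/= mx_normrE; apply: bigmax_le; first by rewrite addr_ge0// enorm_ge0.
  move=> [i j] _ /=; rewrite ord1; apply: (le_trans (enorm_coord z j)).
  by have := ler_enormD (z - c) c; rewrite subrK; lra.
rewrite (_ : [set z | _] = (fun z => enorm (z - c)) @^-1` [set t | t <= r])//.
apply: closed_comp; last exact: closed_le.
move=> z _; apply: (@continuous_comp _ _ _ (fun y => y - c) (@enorm R n)).
  by apply: continuousB; [exact: cvg_id|exact: cst_continuous].
exact: continuous_enorm.
Qed.

(** The cube is not tied to the ball: it may be centred in it, or in another interior ball at
    comparable distance. The strict inequality says that the gain from the cube beats the loss from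
    [u^+] far from [x0]. *)
Lemma hopf_comparison (a V : 'rV[R]_n -> R) (Omega : set 'rV[R]_n)
    (x0 c q : 'rV[R]_n) (rho r h eta M Dist Cv : R) :
  (forall x e, 0 < e -> Ltrunc s a u x e =
     \int[mu]_(y in ~` eball 0 e) ((u x - u (x + y)) * K y)) ->
  (forall x, Omega x -> cvg (Ltrunc s a u x eps @[eps --> 0^'+])) ->
  (forall x, Omega x -> Lop s a u x <= V x * u x) ->
  0 <= Cv -> (forall x, Omega x -> - V x <= Cv) ->
  0 < r -> 0 < h -> 0 < Dist -> 0 <= M -> 0 < eta ->
  eball c r `<=` Omega ->
  enorm (c - x0) + r <= rho / 2 ->
  (forall z, u z <= M) ->
  (forall z, eball x0 rho z -> u z <= 0) ->
  (forall z, cube q h z -> u z <= - eta) ->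
  (forall x z, eball c r x -> cube q h z -> enorm (z - x) <= Dist) ->
  M * Lam * \int[mu]_(y in ~` eball 0 (rho / 2)) riesz s y <
    eta / 2 * (lam * Dist `^ (- (n%:R + 2 * s))) * ((h *+ 2) ^+ n / 2) ->
  exists2 d, 0 < d & forall x, eball c r x -> u x <= - (d * ball_profile s c r x).
Proof.
move=> LE Lcvg Lle Cv0 VCv r0 h0 Dist0 M0 eta0 BO crho uM u0 ueta qDist.
set lhs := M * _ * _; set rhs := eta / 2 * _ * _ => gain.
have rho0 : 0 < rho by have := enorm_ge0 (c - x0); lra.
have [Cb Cb0 HCb] := Rintegral_ball_profile_le n_gt0 s01 mk kb0 k_even k_hom.
(* The last condition makes the lower bound [rhs - lhs - d Cb] for [L u] exceed the upper bound
   [Cv d r^(2s)] coming from the inequality. The added 1 keeps the denominators positive. *)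
have [d [d0 deta dgap]] : exists d, [/\ 0 < d, d * r `^ (2 * s) <= eta / 2 &
    d * (Cb + Cv * r `^ (2 * s)) < rhs - lhs].
  set P := r `^ (2 * s); have P0 : 0 <= P by exact: powR_ge0.
  have CP0 : 0 <= Cb + Cv * P by rewrite addr_ge0// mulr_ge0.
  have d1 : 0 < eta / 2 / (P + 1) by rewrite !divr_gt0// ltr_wpDl.
  have d2 : 0 < (rhs - lhs) / (Cb + Cv * P + 1) by rewrite divr_gt0 ?subr_gt0// ltr_wpDl.
  exists (Num.min (eta / 2 / (P + 1)) ((rhs - lhs) / (Cb + Cv * P + 1))); split.
  - by rewrite lt_min d1.
  - apply: (@le_trans _ _ (eta / 2 / (P + 1) * P)); first by rewrite ler_wpM2r// ge_min lexx.
    rewrite mulrAC ler_pdivrMr ?ltr_wpDl// ler_wpM2l//; [by rewrite divr_ge0// ltW|lra].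
  - apply: (@le_lt_trans _ _ ((rhs - lhs) / (Cb + Cv * P + 1) * (Cb + Cv * P))).
      by rewrite ler_wpM2r// ge_min lexx orbT.
    rewrite mulrAC ltr_pdivrMr ?ltr_wpDl// ltr_pM2l ?subr_gt0//; lra.
exists d => // x xc; rewrite leNgt; apply/negP => ux.
pose w z := u z + d * ball_profile s c r z.
have cw : continuous w.
  move=> z; have h1 : {for z, continuous u} := @cu z.
  have h2 : {for z, continuous (ball_profile s c r)} := @continuous_ball_profile R n s c r s0 z.
  have h3 : {for z, continuous (fun _ : 'rV[R]_n => d)} by exact: cst_continuous.
  exact: (continuousD h1 (continuousM h3 h2)).
have wx : 0 < w x by rewrite /w; lra.
have B0 : [set z : 'rV[R]_n | enorm (z - c) <= r] !=set0 by exists x; exact: ltW.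
have [xm] := EVT_max_rV B0 (@compact_closed_eball c r) (continuous_subspaceT cw).
rewrite inE/= => xmr wmax.
have wxm : 0 < w xm by apply: (lt_le_trans wx); apply: wmax; rewrite inE/=; exact: ltW.
have inrho z : enorm (z - c) <= r -> eball x0 rho z.
  move=> zr; apply: (le_lt_trans (ler_edistD c _ _)).
  by apply: (@le_lt_trans _ _ (rho / 2)); [rewrite (le_trans _ crho)// addrC lerD2l|lra].
(* On the bounding sphere the profile is 0 and [u <= 0], so a positive maximum is interior. *)
have xmc : eball c r xm.
  rewrite /eball/= lt_neqAle xmr andbT; apply/eqP => xmE.
  move: wxm; rewrite /w (ball_profile_eq0 s0 (ltW r0)) ?xmE// mulr0 addr0 ltNge => /negP; apply.
  by apply: u0; exact: inrho.
have Oxm := BO _ xmc.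
have A0 := ball_profile_eball xmc.
have up z : eball c r z -> w z <= w xm by move=> zc; apply: wmax; rewrite inE/=; exact: ltW.
have dphi : d * ball_profile s c r xm <= d * r `^ (2 * s).
  by apply: ler_wpM2l; [exact: ltW|exact: (ball_profile_le s01 c xm (ltW r0))].
have uxm0 : u xm <= 0 by apply: u0; exact: inrho.
(* Since [u xm <= 0], only the lower bound on [V] counts, and [w xm > 0] bounds [- u xm] by
   [d r^(2s)]. *)
have Lup : Lop s a u xm <= Cv * (d * r `^ (2 * s)).
  apply: (le_trans (Lle _ Oxm)).
  have h1 : - u xm <= d * r `^ (2 * s) by move: wxm; rewrite /w; lra.
  apply: (@le_trans _ _ (Cv * (- u xm))); last by rewrite ler_wpM2l.
  by rewrite mulrN -mulNr ler_wnM2r// lerNl; exact: VCv.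
have Llow : rhs - lhs - d * Cb <= Lop s a u xm.
  apply: limr_ge; first exact: Lcvg.
  set A := r ^+ 2 - _ in A0.
  (* The third bound gives [4 e r <= A]; [A > 0] because [xm] is interior, and it is fixed while [e]
     tends to 0. *)
  have m0 : 0 < Num.min (Num.min (h / 2) (rho / 2)) (A / (4 * r)).
    by rewrite !lt_min !divr_gt0// mulr_gt0.
  near=> e.
  have e0 : 0 < e by near: e; exact: nbhs_right_gt.
  have : e < Num.min (Num.min (h / 2) (rho / 2)) (A / (4 * r)) by near: e; exact: nbhs_right_lt.
  rewrite !lt_min => /andP[/andP[/ltW eh /ltW er]]; rewrite ltr_pdivlMr ?mulr_gt0// => /ltW eA.
  rewrite LE//.
  have H := @truncated_operator_ge x0 c q rho r h eta M d Dist xm e e0 eh er Dist0 M0 eta0 (ltW d0)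
    xmc crho uM u0 ueta (fun z => qDist xm z xmc) deta wxm up.
  have eA' : 4 * e * r <= A by rewrite (le_trans _ eA)// mulrCA mulrA.
  have H2 := HCb c r xm e xmc e0 eA'.
  have H3 : d * \int[mu]_(y in ~` eball 0 e) ((ball_profile s c r xm - ball_profile s c r (xm + y)) * K y) <= d * Cb.
    by rewrite ler_pM2l.
  move: H H3; rewrite -/lhs -/rhs; lra.
by move: dgap Lup Llow; rewrite mulrDr (mulrCA d Cv); lra.
Unshelve. all: by end_near. Qed.

End truncated_operator.

(** * Interior tangent balls *)

Section interior_ball_geometry.
Context {R : realType} {n : nat}.
Implicit Types (x y z c v : 'rV[R]_n) (r t : R) (Omega : set 'rV[R]_n).

Lemma bdry_eball c r x : bdry (eball c r) x -> enorm (c - x) = r.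
Proof.
move=> [clx nix]; rewrite enormC; apply/eqP; rewrite eq_le; apply/andP; split.
  rewrite leNgt; apply/negP => rx.
  have d0 : 0 < enorm (x - c) - r by rewrite subr_gt0.
  have /clx[y [yc yx]] : nbhs x (eball x (enorm (x - c) - r)).
    by apply/nbhs_eball; exists (enorm (x - c) - r).
  have := ler_edistD y x c; rewrite (enormC x y).
  by move: yc yx; rewrite /eball/= => yc yx; lra.
rewrite leNgt; apply/negP => xr; apply: nix.
by apply: open_nbhs_nbhs; split => //; exact: open_eball.
Qed.

Lemma eball_sub_tangent x0 v r t : enorm v = 1 -> t <= r ->
  eball (x0 + t *: v) t `<=` eball (x0 + r *: v) r.
Proof.
move=> v1 tr z; rewrite /eball/= => zt.
apply: (le_lt_trans (ler_edistD (x0 + t *: v) _ _)).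
have -> : x0 + t *: v - (x0 + r *: v) = (t - r) *: v.
  by rewrite opprD addrACA subrr add0r scalerBl.
by rewrite enormZ v1 mulr1 distrC ger0_norm ?subr_ge0//; lra.
Qed.

(** For a ball tangent at [x0] the base of the profile has a linear main term in [x - x0], whence
    the exponent [s] in the conclusion. *)
Lemma edot_ball_center x0 v x t : enorm v = 1 ->
  t ^+ 2 - edot (x - (x0 + t *: v)) (x - (x0 + t *: v)) =
  2 * t * edot (x - x0) v - enorm (x - x0) ^+ 2.
Proof.
move=> v1; rewrite opprD addrA enorm_sqr; move: (x - x0) => w.
rewrite edotDl !edotDr !(edotNl, edotNr) !edotZl !edotZr (edotC v w).
by rewrite -(enorm_sqr v) v1; ring.
Qed.

Lemma bdry_dist_tangent Omega x0 v t : open Omega -> bdry Omega x0 -> enorm v = 1 -> 0 < t ->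
  eball (x0 + t *: v) t `<=` Omega -> bdry_dist Omega (x0 + t *: v) = t.
Proof.
move=> oO bx0 v1 t0 BO.
have mt : [set enorm (x0 + t *: v - z) | z in bdry Omega] t.
  by exists x0 => //; rewrite addrAC subrr add0r enormZ v1 mulr1 gtr0_norm.
have lt : lbound [set enorm (x0 + t *: v - z) | z in bdry Omega] t.
  move=> _ [z [_ nz] <-]; rewrite leNgt; apply/negP => zt; apply: nz.
  by apply: open_nbhs_nbhs; split => //; apply: BO; rewrite /eball/= enormC.
apply/eqP; rewrite eq_le; apply/andP; split.
  by apply: ge_inf => //; exists t.
by apply: lb_le_inf => //; exists t.
Qed.

(** The cosine decreases on [[0, pi]], and that of [pi / 2 - beta] is [sin beta]. *)
Lemma cone_edot x0 v beta x : 0 < beta < pi / 2 -> 0 < enorm v -> cone x0 v beta x ->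
  0 < enorm (x - x0) /\ sin beta * (enorm (x - x0) * enorm v) <= edot (x - x0) v.
Proof.
move=> /andP[b0 b2] v0; rewrite /cone/= /angle; set q := _ / _ => qb.
have pi0 := pi_gt0 R.
have q1 : -1 <= q <= 1.
  rewrite -ler_norml /q normrM normfV (ger0_norm (mulr_ge0 (enorm_ge0 _) (enorm_ge0 _))).
  have [->|xn0] := eqVneq (x - x0) 0.
    by rewrite enorm0 mul0r invr0 mulr0.
  have P : 0 < enorm (x - x0) * enorm v by rewrite mulr_gt0// enorm_gt0.
  rewrite (ler_pdivrMr _ _ P) mul1r ler_norml edot_le_enorm andbT lerNl -edotNl -(enormN (x - x0)).
  exact: edot_le_enorm.
have sq : sin beta < q.
  have cq : cos (acos q) = q by apply: acosK; rewrite in_itv/= q1.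
  have h1 : pi / 2 - beta \in `[0, pi].
    by rewrite in_itv/= subr_ge0 (ltW b2)/=; lra.
  have h2 : acos q \in `[0, pi] by rewrite in_itv/= acos_ge0 ?acos_lepi.
  by rewrite -cosBpihalf -cosN opprB -[ltRHS]cq (ltr_cos h2 h1).
have sb : 0 < sin beta by apply: sin_gt0_pi; rewrite b0/=; lra.
have xn0 : 0 < enorm (x - x0).
  rewrite lt0r enorm_ge0 andbT; apply/eqP => x0E.
  (* At [x = x0] the quotient is 0 by convention, which is not above [sin beta]; so the vertex is
     outside the cone. *)
  by move: sq; rewrite /q x0E mul0r invr0 mulr0 => /(lt_trans sb); rewrite ltxx.
by split=> //; rewrite -ler_pdivlMr ?mulr_gt0// ltW.
Qed.

End interior_ball_geometry.

(** * From one interior ball to all of them *)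

(** Kernel at distance [4 t] times half the volume of a cube of half-side [t / (4 n)]: the powers
    [t^(-n)] and [t^n] cancel, leaving a fixed multiple of [t^(-2s)]. *)
Lemma kernel_gainE (R : realType) (n : nat) (s lam t : R) : (0 < n)%N -> 0 < t ->
  (lam * (4 * t) `^ (- (n%:R + 2 * s))) * ((t / (4 * n%:R) *+ 2) ^+ n / 2) =
  (lam * 4 `^ (- (n%:R + 2 * s)) * (2 * n%:R) ^- n / 2) * t `^ (- (2 * s)).
Proof.
move=> n0 t0; have nn0 : n%:R != 0 :> R by rewrite pnatr_eq0 -lt0n.
have -> : t / (4 * n%:R) *+ 2 = t * (2 * n%:R)^-1 by rewrite -mulr_natr; field.
rewrite exprMn powRM ?(ltW t0)// exprVn.
have -> : t `^ (- (n%:R + 2 * s)) = t `^ (- (2 * s)) * (t ^+ n)^-1.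
  rewrite -powR_mulrn ?(ltW t0)// -powRN -powRD ?(gt_eqF t0) ?implybT//.
  by congr (_ `^ _); ring.
have tn0 : t ^+ n != 0 by rewrite expf_neq0// gt_eqF.
have mn0 : (2 * n%:R) ^+ n != 0 :> R by rewrite expf_neq0// mulf_neq0.
by field; rewrite tn0 mn0.
Qed.

(** The hypothesis on [x] says that the base of the profile is at least [q |x - x0|]. It is used
    with [q = t * sin beta] in cones and with [q = t] on the axis. *)
Lemma tangent_ball_ratio_le (R : realType) (n : nat) (u : 'rV[R]_n -> R)
    (s d t q : R) (x0 v x : 'rV[R]_n) :
  0 < s -> 0 < d -> 0 < t -> 0 < q -> enorm v = 1 ->
  (forall z, eball (x0 + t *: v) t z -> u z <= - (d * ball_profile s (x0 + t *: v) t z)) ->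
  0 < enorm (x - x0) ->
  q * enorm (x - x0) + enorm (x - x0) ^+ 2 <= 2 * t * edot (x - x0) v ->
  u x / enorm (x - x0) `^ s <= - (d * q `^ s).
Proof.
move=> s0 d0 t0 q0 v1 Hd y0 xq.
have gap : q * enorm (x - x0) <=
    t ^+ 2 - edot (x - (x0 + t *: v)) (x - (x0 + t *: v)).
  by rewrite (edot_ball_center _ _ _ v1); lra.
have P0 : 0 < q * enorm (x - x0) by exact: mulr_gt0.
have xB : eball (x0 + t *: v) t x.
  by rewrite /eball/= -(ltr_pXn2r (ltn0Sn 1)) ?nnegrE ?enorm_ge0 ?(ltW t0)// enorm_sqr; lra.
rewrite ler_pdivrMr ?powR_gt0//; apply: (le_trans (Hd x xB)).
rewrite mulNr lerN2 -mulrA ler_pM2l// -powRM ?(ltW q0) ?(ltW y0)//.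
rewrite /ball_profile ppowE; last by exact: le_trans (ltW P0) gap.
by apply: ge0_ler_powR; rewrite ?nnegrE ?(ltW s0) ?(ltW P0)//; exact: le_trans (ltW P0) gap.
Qed.

(** Two comparisons. The first uses a cube centred in a ball [xc r1] where [Phi] is large. The
    second concerns the ball of radius [t] on the axis [v] of the given [r0], with its cube on the
    axis [w] of the first ball. *)
Lemma hopf_tangent_balls (R : realType) (n : nat) (n_gt0 : (0 < n)%N)
  (Omega : set 'rV[R]_n) (x0 : 'rV[R]_n) (rbar : R) (xc : R -> 'rV[R]_n)
  (int_balls : interior_balls Omega x0 rbar xc)
  (s : R) (s01 : 0 < s < 1)
  (a : 'rV[R]_n -> R) (a_Linfty : Linfty_sphere a)
  (a_even : forall theta, sphere theta -> a theta = a (- theta))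
  (lam Lam : R) (lam_gt0 : 0 < lam) (lam_le_Lam : lam <= Lam)
  (a_bounds : forall theta, sphere theta -> lam <= a theta <= Lam)
  (u : 'rV[R]_n -> R) (u_Z : Zspace s a Omega u)
  (u_pos : Linfty setT u^\+)
  (V : 'rV[R]_n -> R) (V_neg : Linfty Omega V^\-)
  (Lu_le : forall x, Omega x -> Lop s a u x <= V x * u x)
  (rho : R) (rho_gt0 : 0 < rho)
  (u_le0 : forall x, eball x0 rho x -> u x <= 0)
  (u_lt0 : forall x, (eball x0 rho `&` Omega) x -> u x < 0)
  (u_grows : grows_faster s u x0 xc) (r0 : R) : 0 < r0 <= rbar ->
  let v := r0^-1 *: (xc r0 - x0) in
  exists t, exists2 d, 0 < d &
    0 < t <= r0 /\ forall x, eball (x0 + t *: v) t x ->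
      u x <= - (d * ball_profile s (x0 + t *: v) t x).
Proof.
move=> r0b v.
have /andP[s0 s1] := s01.
have [k [mk kb k_even k_hom [N [mN N0] aN]]] :=
  borel_kernel n_gt0 a_Linfty a_even lam_le_Lam a_bounds.
have [cu fu Lcvg] := u_Z.
have [_ [Mu HMu]] := u_pos.
have [_ [Cv HCv]] := V_neg.
have [rbar0 balls] := int_balls.
have M0 : 0 <= Mu by exact: (le_trans (normr_ge0 _) (HMu x0 I)).
have uM z : u z <= Mu.
  apply: (le_trans _ (HMu z I)); apply: (le_trans _ (ler_norm _)).
  by rewrite /funrpos le_max lexx.
have Cv0 : 0 <= `|Cv| by [].
have VCv x : Omega x -> - V x <= `|Cv|.
  move=> Ox; apply: (le_trans _ (ler_norm _)); apply: le_trans (HCv x Ox).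
  apply: (le_trans _ (ler_norm _)).
  by rewrite /funrneg le_max lexx.
have LE x e : 0 < e -> Ltrunc s a u x e =
    \int[lebesgue_rV n]_(y in ~` eball 0 e)
      ((u x - u (x + y)) * anisotropic_kernel s k y).
  move=> e0; rewrite /Ltrunc /Rintegral; congr fine.
  apply: (eq_integral_off_null mN N0) => y; rewrite setC_eball0/= => ey Ny.
  have y0 : y != 0 by rewrite -enorm_gt0; exact: lt_le_trans ey.
  by rewrite (aN y y0 Ny) /anisotropic_kernel /riesz powRN -mulrA (mulrC (_^-1)).
set It := \int[lebesgue_rV n]_(y in ~` eball (0 : 'rV[R]_n) (rho / 2)) riesz s y.
pose kap := lam * 4 `^ (- (n%:R + 2 * s)) * (2 * n%:R) ^- n / 2.
have kap0 : 0 < kap.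
  by rewrite !mulr_gt0 ?powR_gt0// invr_gt0 exprn_gt0// mulr_gt0// ltr0n.
have nn0 : 0 < n%:R :> R by rewrite ltr0n.
have unit r : 0 < r <= rbar -> enorm (r^-1 *: (xc r - x0)) = 1 /\
    x0 + r *: (r^-1 *: (xc r - x0)) = xc r.
  move=> rb; have /andP[r_gt0 _] := rb; have [_ [_ bx]] := balls r rb.
  rewrite enormZ (bdry_eball bx) gtr0_norm ?invr_gt0// mulVf ?gt_eqF//.
  by rewrite scalerA mulfV ?gt_eqF// scale1r addrC subrK.
have cubeh (t : R) (q z : 'rV[R]_n) : cube q (t / (4 * n%:R)) z -> enorm (z - q) <= t / 4.
  move=> /(cube_sub_enorm n_gt0) zq; apply: (le_trans zq).
  by rewrite le_eqVlt; apply/orP; left; apply/eqP; field; rewrite gt_eqF.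
have gainE (t eta : R) : 0 < t -> Mu * Lam * It < eta / 2 * kap * t `^ (- (2 * s)) ->
    Mu * Lam * It < eta / 2 * (lam * (4 * t) `^ (- (n%:R + 2 * s))) *
      ((t / (4 * n%:R) *+ 2) ^+ n / 2).
  by move=> t0; rewrite -[X in _ -> _ < X]mulrA (kernel_gainE s lam n_gt0 t0) mulrA.
have [r1 [r1b r1rho [d1 d10 H1]]] : exists r1, [/\ 0 < r1 <= rbar, r1 <= rho / 4 &
    exists2 d, 0 < d & forall x, eball (xc r1) r1 x -> u x <= - (d * ball_profile s (xc r1) r1 x)].
  have [_ _ _ lsup] := u_grows.
  pose m := Num.min rbar (rho / 4).
  have m0 : 0 < m by rewrite lt_min rbar0 divr_gt0.
  pose I := [set r : R | 0 < r < m].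
  have VI : (0:R)^'+ I.
    near=> r; apply/andP; split; near: r; [exact: nbhs_right_gt|exact: nbhs_right_lt].
  (* The limsup is an infimum of suprema over neighbourhoods; being infinite, it makes each of these
     suprema infinite. *)
  have supV : ereal_sup [set (Phi s u xc r)%:E | r in I] = +oo%E.
    apply/eqP; rewrite -leye_eq -[X in (X <= _)%E]lsup; apply: ereal_inf_lbound.
    by exists I.
  (* With [eta = Phi r * r^(2s)] the gain is [Phi r * kap / 2], which fixes this threshold. *)
  have : ((2 * (Mu * Lam * It) / kap)%:E < ereal_sup [set (Phi s u xc r)%:E | r in I])%E.
    by rewrite supV ltry.
  move=> /ereal_sup_gt[_ [r /= /andP[r_gt0 rm] <-]]; rewrite lte_fin => Phir.
  move: rm; rewrite /m lt_min => /andP[rbr /ltW rrho].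
  have rb : 0 < r <= rbar by rewrite r_gt0 ltW.
  have [BO [_ bx]] := balls r rb.
  have cx := bdry_eball bx.
  exists r; split => //.
  pose eta := inf [set `|u y| | y in eball (xc r) (r / 2)].
  have r2s : 0 < r `^ (2 * s) by exact: powR_gt0.
  have PhiE : Phi s u xc r * r `^ (2 * s) = eta by rewrite /Phi mulfVK// gt_eqF.
  have gain : Mu * Lam * It < eta / 2 * kap * r `^ (- (2 * s)).
    rewrite -PhiE powRN [ltRHS](_ : _ = Phi s u xc r * kap / 2); last by field; rewrite gt_eqF.
    by move: Phir; rewrite ltr_pdivrMr//; lra.
  (* Pointwise [|u| > 0] would not make the infimum positive; it is positive because [Phi] exceeds a
     nonnegative threshold. *)
  have eta0 : 0 < eta.
    have It0 : 0 <= It by apply: Rintegral_ge0 => y _; exact: riesz_ge0.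
    have Lam0 : 0 <= Lam by exact: le_trans (ltW lam_gt0) lam_le_Lam.
    have P0 : 0 < Phi s u xc r.
      by apply: le_lt_trans Phir; rewrite divr_ge0 ?(ltW kap0)// !mulr_ge0.
    by rewrite -PhiE mulr_gt0.
  have cz (z : 'rV[R]_n) : cube (xc r) (r / (4 * n%:R)) z -> u z <= - eta.
    move=> /cubeh zc.
    have zO : Omega z by apply: BO; rewrite /eball/=; lra.
    have zrho : eball x0 rho z.
      by apply: (le_lt_trans (ler_edistD (xc r) _ _)); rewrite cx; lra.
    have uz : u z < 0 by exact: u_lt0.
    rewrite lerNr -(ltr0_norm uz); apply: ge_inf; last by exists z => //; rewrite /eball/=; lra.
    by exists 0 => _ [y _ <-].
  apply: (hopf_comparison (h := r / (4 * n%:R)) (q := xc r) (eta := eta) (M := Mu) (Dist := 4 * r)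
    (Cv := `|Cv|) (V := V) (x0 := x0) (rho := rho) n_gt0 s01 mk lam_gt0 kb k_even k_hom cu fu LE Lcvg Lu_le) => //.
  - by rewrite divr_gt0// mulr_gt0.
  - by rewrite mulr_gt0.
  - by rewrite cx; lra.
  - move=> x z; rewrite /eball/= => xcr /cubeh zc.
    by have := ler_edistD (xc r) z x; rewrite (enormC (xc r)); lra.
  - exact: gainE.
have /andP[r1_gt0 r1rb] := r1b.
have /andP[r0_gt0 r0rb] := r0b.
have [v1 v1E] := unit r0 r0b.
have [w1 w1E] := unit r1 r1b.
rewrite -/v in v1 v1E; set w := r1^-1 *: _ in w1 w1E.
have [BO0 _] := balls r0 r0b.
have [BO1 _] := balls r1 r1b.
(* With [eta = d1 (3/4 r1 t)^s], the gain [eta / 2 * kap * t^(-2s)] equals [b t^(-s)]. *)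
pose b := d1 * (3 / 4 * r1) `^ s * kap / 2.
have b0 : 0 < b.
  have p0 : 0 < (3 / 4 * r1) `^ s by apply: powR_gt0; lra.
  by rewrite divr_gt0// mulr_gt0// mulr_gt0.
have [t [t0 tr0 tr1 trho tgain]] : exists t, [/\ 0 < t, t <= r0, t <= r1, t <= rho / 8 &
    Mu * Lam * It < b * t `^ (- s)].
  have It0 : 0 <= It by apply: Rintegral_ge0 => y _; exact: riesz_ge0.
  have Lam0 : 0 <= Lam by exact: le_trans (ltW lam_gt0) lam_le_Lam.
  have J0 : 0 < Mu * Lam * It + 1 by rewrite ltr_wpDl// !mulr_ge0.
  (* For [t <= T], [b t^(-s)] is at least the loss plus 1. *)
  pose T := (b / (Mu * Lam * It + 1)) `^ (s^-1).
  have T0 : 0 < T by rewrite powR_gt0// divr_gt0.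
  pose t := Num.min (Num.min r0 r1) (Num.min (rho / 8) T).
  have t0 : 0 < t by rewrite !lt_min r0_gt0 r1_gt0 T0 divr_gt0.
  have tT : t <= T by rewrite !ge_min lexx !orbT.
  exists t; split=> //.
  - by rewrite !ge_min lexx.
  - by rewrite !ge_min lexx ?orbT.
  - by rewrite !ge_min lexx ?orbT.
  apply: (@lt_le_trans _ _ (Mu * Lam * It + 1)); first by rewrite ltrDl.
  have ts : t `^ s <= b / (Mu * Lam * It + 1).
    apply: (@le_trans _ _ (T `^ s)).
      by apply: ge0_ler_powR; rewrite ?nnegrE ?(ltW s0) ?(ltW t0) ?(ltW T0).
    by rewrite /T -powRrM mulVf ?gt_eqF// powRr1// divr_ge0// ltW.
  rewrite powRN ler_pdivlMr ?powR_gt0// mulrC -ler_pdivlMr//.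
exists t.
suff [d d0 Hd] : exists2 d, 0 < d & forall x, eball (x0 + t *: v) t x ->
    u x <= - (d * ball_profile s (x0 + t *: v) t x).
  by exists d => //; rewrite t0.
have tv0 y : enorm y = 1 -> enorm (x0 + t *: y - x0) = t.
  by move=> y1; rewrite addrAC subrr add0r enormZ y1 mulr1 gtr0_norm.
pose eta := d1 * (3 / 4 * r1 * t) `^ s.
have eta0 : 0 < eta by rewrite mulr_gt0//; apply: powR_gt0; rewrite !mulr_gt0.
apply: (hopf_comparison (h := t / (4 * n%:R)) (q := x0 + t *: w) (eta := eta) (M := Mu) (Dist := 4 * t)
    (Cv := `|Cv|) (V := V) (x0 := x0) (rho := rho) n_gt0 s01 mk lam_gt0 kb k_even k_hom cu fu LE Lcvg Lu_le) => //.
- by rewrite divr_gt0// mulr_gt0.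
- by rewrite mulr_gt0.
- by move=> z /(eball_sub_tangent v1 tr0); rewrite v1E; exact: BO0.
- by rewrite tv0//; lra.
- move=> z /cubeh zq.
  (* The centre of the cube has depth [t] in the first ball, and its points are within [t / 4] of
     that centre. Hence the profile has base at least [r1^2 - (r1 - 3/4 t)^2 >= 3/4 r1 t], using
     [t <= r1]. *)
  have zE : enorm (z - xc r1) <= r1 - 3 / 4 * t.
    apply: (le_trans (ler_edistD (x0 + t *: w) _ _)).
    rewrite -w1E (_ : x0 + t *: w - (x0 + r1 *: w) = (t - r1) *: w); last first.
      by rewrite opprD addrACA subrr add0r scalerBl.
    by rewrite enormZ w1 mulr1 distrC ger0_norm ?subr_ge0//; lra.
  have zB : eball (xc r1) r1 z by rewrite /eball/=; lra.
  apply: (le_trans (H1 z zB)); rewrite lerN2 ler_pM2l//.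
  have zA := ball_profile_eball zB.
  rewrite /ball_profile ppowE ?(ltW zA)//.
  apply: ge0_ler_powR; rewrite ?nnegrE ?(ltW s0) ?(ltW zA) ?mulr_ge0 ?(ltW r1_gt0) ?(ltW t0)//.
  rewrite -enorm_sqr.
  have : enorm (z - xc r1) ^+ 2 <= (r1 - 3 / 4 * t) ^+ 2.
    by rewrite lerXn2r ?nnegrE ?enorm_ge0//; lra.
  have : t * t <= r1 * t by rewrite ler_pM2r.
  by rewrite !expr2; nra.
- move=> x z; rewrite /eball/= => xt /cubeh zq.
  have h1 := ler_edistD (x0 + t *: w) z x.
  have h2 := ler_edistD x0 (x0 + t *: w) x.
  have h3 := ler_edistD (x0 + t *: v) x0 x.
  rewrite (tv0 _ w1) in h2; rewrite (enormC x0 (x0 + t *: v)) (tv0 _ v1) (enormC (x0 + t *: v) x) in h3.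
  by clear - h1 h2 h3 xt zq t0; lra.
- apply: gainE => //; rewrite /eta powRM ?mulr_ge0 ?(ltW r1_gt0) ?(ltW t0)//.
  have -> : t `^ (- (2 * s)) = (t `^ s)^-1 * t `^ (- s).
    by rewrite -powRN -powRD ?(gt_eqF t0) ?implybT//; congr (_ `^ _); ring.
  have ts0 : 0 < t `^ s by exact: powR_gt0.
  by rewrite (_ : _ * (_^-1 * _) = b * t `^ (- s))// /b; field; rewrite gt_eqF.
Unshelve. all: by end_near. Qed.

Theorem corollary1p3 (R : realType) (n : nat) (n_gt0 : (0 < n)%N)
  (Omega : set 'rV[R]_n) (Omega_open : open Omega)
  (x0 : 'rV[R]_n) (x0_bdry : bdry Omega x0)
  (rbar : R) (xc : R -> 'rV[R]_n)
  (int_balls : interior_balls Omega x0 rbar xc)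
  (s : R) (s01 : 0 < s < 1)
  (a : 'rV[R]_n -> R) (a_Linfty : Linfty_sphere a)
  (a_even : forall theta, sphere theta -> a theta = a (- theta))
  (lam Lam : R) (lam_gt0 : 0 < lam) (lam_le_Lam : lam <= Lam)
  (a_bounds : forall theta, sphere theta -> lam <= a theta <= Lam)
  (u : 'rV[R]_n -> R) (u_Z : Zspace s a Omega u)
  (u_x0 : u x0 = 0) (u_pos : Linfty setT u^\+)
  (V : 'rV[R]_n -> R) (V_L1loc : L1loc Omega V) (V_neg : Linfty Omega V^\-)
  (Lu_le : forall x, Omega x -> Lop s a u x <= V x * u x)
  (rho : R) (rho_gt0 : 0 < rho)
  (u_le0 : forall x, eball x0 rho x -> u x <= 0)
  (u_lt0 : forall x, (eball x0 rho `&` Omega) x -> u x < 0)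
  (u_grows : grows_faster s u x0 xc) :
  (forall beta : R, 0 < beta < pi / 2 ->
   forall r : R, 0 < r <= rbar ->
     (limf_esup (fun x => (u x / enorm (x - x0) `^ s)%:E)
        (within (Omega `&` cone x0 (xc r - x0) beta) (nbhs x0)) < 0)%E) /\
  (forall (U : set 'rV[R]_n) (g : 'rV[R]_n -> R),
     open U -> U x0 ->
     {within Omega `|` (bdry Omega `&` U), continuous g} ->
     (forall x, Omega x -> g x = u x / bdry_dist Omega x `^ s) ->
     g x0 < 0).

Proof.
have [rbar0 balls] := int_balls.
have /andP[s0 _] := s01.
have unit r : 0 < r <= rbar -> enorm (xc r - x0) = r /\ enorm (r^-1 *: (xc r - x0)) = 1.
  move=> rb; have /andP[r_gt0 _] := rb; have [_ [_ bx]] := balls r rb.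
  by rewrite enormZ (bdry_eball bx) gtr0_norm ?invr_gt0// mulVf ?gt_eqF.
have tangent r0 := hopf_tangent_balls n_gt0 int_balls s01 a_Linfty a_even lam_gt0 lam_le_Lam
  a_bounds u_Z u_pos V_neg Lu_le rho_gt0 u_le0 u_lt0 u_grows (r0 := r0).
split.
  move=> beta b02 r rb.
  have /andP[b0 b2] := b02; have /andP[r_gt0 _] := rb.
  have [vr v1] := unit r rb.
  have [t [d d0 [/andP[t0 tr] Hd]]] := tangent r rb.
  set v := r^-1 *: (xc r - x0) in v1 Hd.
  have sb : 0 < sin beta by apply: sin_gt0_pi; rewrite b0/=; have := pi_gt0 R; lra.
  have tsb : 0 < t * sin beta by exact: mulr_gt0.
  (* Within distance [t sin beta] of [x0], half of the linear term [2 t sin beta |x - x0|] absorbs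
     [|x - x0|^2]; the other half gives [q = t sin beta]. *)
  pose W := [set x | eball x0 (t * sin beta) x /\ (Omega `&` cone x0 (xc r - x0) beta) x].
  have WF : within (Omega `&` cone x0 (xc r - x0) beta) (nbhs x0) W.
    rewrite /within/=; have : nbhs x0 (eball x0 (t * sin beta)).
      by apply/nbhs_eball; exists (t * sin beta).
    by apply: filterS => x xb xD; split.
  pose m := d * (t * sin beta) `^ s.
  have m0 : 0 < m by rewrite mulr_gt0// powR_gt0.
  apply: (@le_lt_trans _ _ (- m)%:E); last by rewrite lte_fin oppr_lt0.
  apply: (le_trans (ereal_inf_lbound (ex_intro2 _ _ W WF erefl))).
  apply: ge_ereal_sup => _ [x [xt [Ox cx]] <-]; rewrite lee_fin.
  have vr0 : 0 < enorm (xc r - x0) by rewrite vr.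
  have [y0 yv] := cone_edot b02 vr0 cx.
  have ev : edot (x - x0) (xc r - x0) = r * edot (x - x0) v.
    by rewrite /v edotZr mulrA mulfV ?gt_eqF// mul1r.
  have {}yv : sin beta * enorm (x - x0) <= edot (x - x0) v.
    by move: yv; rewrite ev vr mulrA mulrC ler_pM2l.
  apply: (tangent_ball_ratio_le s0 d0 t0 tsb v1 Hd y0).
  have h1 : enorm (x - x0) ^+ 2 <= t * sin beta * enorm (x - x0).
    by rewrite expr2 ler_pM2r// ltW.
  have h2 : t * (sin beta * enorm (x - x0)) <= t * edot (x - x0) v by rewrite ler_pM2l.
  by lra.
move=> U g U_open Ux0 cg gE.
have rb : 0 < rbar <= rbar by rewrite rbar0 lexx.
have [vr v1] := unit rbar rb.
have [t [d d0 [/andP[t0 tr] Hd]]] := tangent rbar rb.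
set v := rbar^-1 *: (xc rbar - x0) in v1 Hd.
have [BO _] := balls rbar rb.
have vE : x0 + rbar *: v = xc rbar.
  by rewrite /v scalerA mulfV ?gt_eqF// scale1r addrC subrK.
pose m := d * t `^ s.
have m0 : 0 < m by rewrite mulr_gt0// powR_gt0.
have sub tau : 0 < tau <= t -> eball (x0 + tau *: v) tau `<=` Omega.
  by move=> /andP[_ tt] z /(eball_sub_tangent v1 (le_trans tt tr)); rewrite vE; exact: BO.
(* On the axis the distance to the boundary equals the distance [tau] to [x0], so the bound on
   [u / |x - x0|^s] is a bound on [g]. Continuity then carries it to [x0]. *)
have gtau tau : 0 < tau < t -> Omega (x0 + tau *: v) /\ g (x0 + tau *: v) <= - m.
  move=> /andP[tau0 taut].
  have tt : 0 < tau <= t by rewrite tau0 ltW.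
  have Ot : Omega (x0 + tau *: v).
    by apply: (sub tau tt); rewrite /eball/= subrr enorm0.
  split=> //; rewrite (gE _ Ot) (bdry_dist_tangent Omega_open x0_bdry v1 tau0 (sub tau tt)).
  have Ev : edot (x0 + tau *: v - x0) v = tau.
    by rewrite addrAC subrr add0r edotZl -enorm_sqr v1 expr1n mulr1.
  have nv : enorm (x0 + tau *: v - x0) = tau.
    by rewrite addrAC subrr add0r enormZ v1 mulr1 gtr0_norm.
  rewrite -[X in _ / X `^ _]nv.
  apply: (tangent_ball_ratio_le s0 d0 t0 t0 v1 Hd); rewrite nv// Ev.
  have : tau * tau <= t * tau by rewrite ler_pM2r// ltW.
  by rewrite expr2; lra.
rewrite ltNge; apply/negP => g0.
have x0D : (Omega `|` (bdry Omega `&` U)) x0 by right.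
have /cvgr_gt/(_ (- m)) : g x @[x --> within (Omega `|` (bdry Omega `&` U)) (nbhs x0)] --> g x0.
  by have /subspace_continuousP/(_ x0 x0D) := cg.
move=> /(_ (lt_le_trans (_ : - m < 0) g0)); rewrite oppr_lt0 => /(_ m0).
rewrite /within/= => /nbhs_eball[e e0 He].
pose tau := Num.min (t / 2) (e / 2).
have tau0 : 0 < tau by rewrite lt_min !divr_gt0.
have taut : tau <= t / 2 by rewrite ge_min lexx.
have taue : tau <= e / 2 by rewrite ge_min lexx orbT.
have [Ot gt] : Omega (x0 + tau *: v) /\ g (x0 + tau *: v) <= - m.
  by apply: gtau; rewrite tau0/=; lra.
have /He/(_ (or_introl Ot)) : eball x0 e (x0 + tau *: v).
  by rewrite /eball/= addrAC subrr add0r enormZ v1 mulr1 gtr0_norm//; lra.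
by rewrite ltNge gt.
Qed.
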